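(* Let $n\geqslant2$ and let $q>n$ be real. There exists a constant $C=C(q,n)$ such that for any closed, connected, isometrically immersed hypersurface $X:(M^n,g)\to\mathbb{R}^{n+1}$ we have $$\sup_M\Bigl|\,|X-\overline{X}|-\|X-\overline{X}\|_2\Bigr|\leqslant C\bigl(\mathrm{Vol}(M)\,\|H\|_q^n\bigr)^{\gamma}\,\|X-\overline{X}\|_2\Bigl(1-\frac{\|X-\overline{X}\|_1}{\|X-\overline{X}\|_2}\Bigr)^{\frac{1}{2(1+n\gamma)}},$$ where $\gamma=\frac{q}{2(q-n)}$. In particular (for a constant $C=C(q,n)$) $$\|X-\overline{X}\|_\infty\leqslant C\bigl(\mathrm{Vol}(M)\,\|H\|_q^n\bigr)^{\gamma}\,\|X-\overline{X}\|_2.$$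
   Context: $X$ is a smooth isometric immersion of a closed (compact without boundary) Riemannian $n$-manifold. $\mathrm{Vol}(M)$ is the volume of $(M,g)$, $dv$ its volume measure, and $\overline{X}=\frac{1}{\mathrm{Vol}(M)}\int_M X\,dv$. If $\nu$ is a local unit normal field, the second fundamental form is $B(\cdot,\cdot)=\langle\nabla^0_{\cdot}\nu,\cdot\rangle$ and the mean curvature is $H=\frac1n\mathrm{tr}(B)$ (so $|H|$ does not depend on $\nu$). Norms are normalized: $\|f\|_p^p=\frac{1}{\mathrm{Vol}(M)}\int_M|f|^p\,dv$, with $|f|$ the Euclidean norm for vector-valued $f$; $\|\cdot\|_\infty$ is the sup norm. *)

(* Defs.v *)
From HB Require Import structures.
From mathcomp Require Import all_boot all_order all_algebra.
From mathcomp Require Import all_classical all_reals all_analysis.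

Set Implicit Arguments.
Unset Strict Implicit.
Unset Printing Implicit Defensive.

Import Order.TTheory GRing.Theory Num.Theory.
Import numFieldNormedType.Exports.

Local Open Scope classical_set_scope.
Local Open Scope ring_scope.

Notation borel T := (g_sigma_algebraType (@open T)).

(* The topology of ['rV[R]_m] is the one given by the library's sup norm; the
   norm |.| used for vector-valued maps is the Euclidean one. *)
Definition enorm (R : realType) (m : nat) (v : 'rV[R]_m) : R :=
  Num.sqrt (\sum_i v 0 i ^+ 2).

(* Meaningful for [U] open: the derivatives at a point of [U] then do not
   depend on the values of [f] outside [U]. *)
Fixpoint Ck_on (R : realType) (V W : normedModType R) (k : nat) (U : set V)
    (f : V -> W) : Prop :=
  (forall x, U x -> {for x, continuous f}) /\
  if k is k'.+1 then
    forall v : V, (forall x, U x -> derivable f x v) /\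
                  Ck_on k' U (fun x => 'D_v f x)
  else True.

Definition smooth_on (R : realType) (V W : normedModType R) (U : set V)
  (f : V -> W) : Prop := forall k, Ck_on k U f.

(* n-dimensional Lebesgue measure on Borel sets: by Tonelli, the measure of a
   set is the integral of the measures of its slices in the first coordinate. *)
Fixpoint lebesgue_rV (R : realType) (n : nat) : set 'rV[R]_n -> \bar R :=
  match n with
  | 0 => fun A => (\1_A (0 : 'rV[R]_0))%:E
  | n'.+1 => fun A =>
      (\int[@lebesgue_measure R]_t
         lebesgue_rV [set v : 'rV[R]_n' | A (row_mx (t%:M : 'M[R]_1) v)])%E
  end.

Section Hypersurfaces.
Variables (R : realType) (n : nat) (M : ptopologicalType).

(* A homeomorphism between the open sets [dom] of R^n and [img] of [M]; the
   values of [par] and [coord] outside these sets are irrelevant. *)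
Record chart := Chart {
  dom : set 'rV[R]_n;
  img : set M;
  par : 'rV[R]_n -> M;
  coord : M -> 'rV[R]_n;
  dom_open : open dom;
  img_open : open img;
  parP : forall x, dom x -> img (par x) /\ coord (par x) = x;
  coordP : forall p, img p -> dom (coord p) /\ par (coord p) = p;
  par_cont : forall x, dom x -> {for x, continuous par};
  coord_cont : forall p, img p -> {for p, continuous coord}
}.

Definition smooth_atlas (A : set chart) : Prop :=
  (forall p, exists2 c, A c & img c p) /\
  (forall c c', A c -> A c' ->
     smooth_on (dom c `&` par c @^-1` img c') (coord c' \o par c)).

(* Second countability follows from compactness and the existence of charts. *)
Definition closed_manifold (A : set chart) : Prop :=
  [/\ hausdorff_space M, compact [set: M] & smooth_atlas A].

Definition smooth_map (A : set chart) (O : set M) (m : nat)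
    (f : M -> 'rV[R]_m) : Prop :=
  forall c, A c -> smooth_on (dom c `&` par c @^-1` O) (f \o par c).

(* [g c x] is the Gram matrix at [par c x] of the coordinate fields of [c].
   Vectors are rows: row [i] of ['J f x] is the i-th partial derivative of
   [f] at [x], whence the position of the transposes below. *)
Definition riemannian_metric (A : set chart)
    (g : chart -> 'rV[R]_n -> 'M[R]_n) : Prop :=
  [/\ forall c, A c -> smooth_on (dom c) (g c),
      forall c x, A c -> dom c x ->
        (g c x)^T = g c x /\
        (forall v : 'rV[R]_n, v != 0 -> 0 < (v *m g c x *m v^T) 0 0)
    & forall c c' x, A c -> A c' -> dom c x -> img c' (par c x) ->
        let J := 'J (coord c' \o par c) x in
        g c x = J *m g c' (coord c' (par c x)) *m J^T].

(* In each chart, dv = sqrt(det g) dx. *)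
Definition volume_measure (A : set chart) (g : chart -> 'rV[R]_n -> 'M[R]_n)
    (dv : {measure set (borel M) -> \bar R}) : Prop :=
  forall c (B : set (borel M)), A c -> measurable B -> B `<=` img c ->
    dv B = (\int[@lebesgue_rV R n : set (borel 'rV[R]_n) -> \bar R]_(x in
              dom c `&` par c @^-1` B) (Num.sqrt (\det (g c x)))%:E)%E.

(* Positivity of [g] makes the differential of such an [X] injective. *)
Definition isometric_immersion (A : set chart)
    (g : chart -> 'rV[R]_n -> 'M[R]_n) (X : M -> 'rV[R]_n.+1) : Prop :=
  smooth_map A setT X /\
  forall c x, A c -> dom c x ->
    g c x = 'J (X \o par c) x *m ('J (X \o par c) x)^T.

Definition unit_normal_field (A : set chart) (X : M -> 'rV[R]_n.+1)
    (O : set M) (nu : M -> 'rV[R]_n.+1) : Prop :=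
  [/\ open O, smooth_map A O nu,
      forall p, O p -> enorm (nu p) = 1
    & forall c x, A c -> dom c x -> O (par c x) ->
        nu (par c x) *m ('J (X \o par c) x)^T = 0].

(* Entry (i, j) is B(d_i, d_j) = <d_i nu, d_j X>. *)
Definition second_fundamental_form (X nu : M -> 'rV[R]_n.+1) (c : chart)
    (p : M) : 'M[R]_n :=
  'J (nu \o par c) (coord c p) *m ('J (X \o par c) (coord c p))^T.

(* The trace with respect to [g] is the trace of g^-1 B. The normal field is
   chosen independently at each point, so only the absolute value of
   [mean_curvature A g X p] is meaningful. *)
Definition mean_curvature (A : set chart) (g : chart -> 'rV[R]_n -> 'M[R]_n)
    (X : M -> 'rV[R]_n.+1) (p : M) : R :=
  xget 0 [set h | exists c O nu,
    [/\ A c, img c p, O p, unit_normal_field A X O nu &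
      h = n%:R^-1 *
          \tr (invmx (g c (coord c p)) *m second_fundamental_form X nu c p)]].

Definition Vol (dv : {measure set (borel M) -> \bar R}) : R :=
  fine (dv [set: M]).

Definition barycenter (dv : {measure set (borel M) -> \bar R}) (m : nat)
    (X : M -> 'rV[R]_m) : 'rV[R]_m :=
  \row_i ((Vol dv)^-1 * \int[dv]_p X p 0 i).

Definition normalized_Lp (dv : {measure set (borel M) -> \bar R}) (p : R)
    (f : M -> R) : R :=
  ((Vol dv)^-1 * \int[dv]_x (`|f x| `^ p)) `^ p^-1.

End Hypersurfaces.

(* Main.v *)
Require Import Defs.
From HB Require Import structures.
From mathcomp Require Import all_boot all_order all_algebra.
From mathcomp Require Import all_classical all_reals all_analysis.
From mathcomp Require Import perm measurable_realfun.
From mathcomp Require Import ring lra.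

Import Order.TTheory GRing.Theory Num.Theory.
Import numFieldNormedType.Exports.

Local Open Scope classical_set_scope.
Local Open Scope ring_scope.

(* Let [b] be any centre, [r = |X - b|] and [phi = |r - N2|], with [N1], [N2] the
   normalized L^1 and L^2 norms of [r]. As [phi] is 1-Lipschitz in [X], a value
   [m] of [phi] at [p] forces [phi >= m / 2] on the extrinsic ball of radius
   [m / 2] around [p], while [phi ^ 2] has mean [2 N2 ^ 2 (1 - N1 / N2)]. So it
   suffices that extrinsic balls of radius [s] have volume at least [c s ^ n], for
   [s] up to a multiple of [L ^ (- q / (q - n))], [L] being the L^q norm of [H].

   This follows from the first variation formula, the divergence theorem for the
   field [h(|X - b| ^ 2) (X - b)]: with [b = X p] and [h x = (1 - t x)_+ ^ 2],
   [K t = \int h(|X - X p| ^ 2)] satisfies [n K + 2 t K' <= n t ^ (-1/2) L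
   K ^ (1 - 1/q)], so [t ^ (n / 2q) K ^ (1/q) + n L / (q - n) t ^ (- (1 - n/q) / 2)]
   is nonincreasing in [t]; it is bounded below as [t] grows, since small balls
   have at least a multiple of the Euclidean volume. With [h = 1] the formula and
   Hoelder's inequality give [1 <= ||H||_q N2]. *)

Set Implicit Arguments.
Unset Strict Implicit.
Unset Printing Implicit Defensive.

(** * Maps of class C^k *)

(** The exponents come from two regimes. Write [T] for [(V NH^n)^gamma], [eps] for [1 - N1 / N2],
    and let [s0] be the largest radius at which the volume bound is available. If [m / 2 >= s0],
    only the volume at [s0] can be used: [m^2 s0^n <= C V N2^2 eps], and [gamma] is the exponent for
    which [T^2 s0^n] is a multiple of [V], so that [m <= C T N2 eps^(1/2)]. If [m / 2 < s0], then
    [m^(n+2) <= C V N2^2 eps], whose homogeneity is repaired by [1 <= NH N2]; the power of [eps] is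
    now [1/(n+2)]. As [eps <= 1] and [gamma > 1/2], both powers are bounded by the one in the
    statement. The geometry is carried by C^1 fields [Y] along [X] with values in R^(n+1). The
    divergence of the tangential part of [Y] is a trace plus the pairing of [Y] with the Laplacian
    of [X]; no connection enters, and curvature appears only through the norm [n |H|] of that
    Laplacian. The cut-off is a squared positive part because its Taylor remainder is quadratic
    uniformly, which differentiates [K] under the integral by a direct estimate. *)

Section CkCalculus.
Context {R : realType} {V : normedModType R}.
Implicit Types (W : normedModType R) (U : set V) (k : nat).

Lemma Ck_on_continuous W k U (f : V -> W) :
  Ck_on k U f -> forall x, U x -> {for x, continuous f}.
Proof. by case: k => [[]|k []]. Qed.

Lemma Ck_on_derivable W k U (f : V -> W) v x :
  Ck_on k.+1 U f -> U x -> is_derive x v f ('D_v f x).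
Proof. by move=> [_ /(_ v)[+ _]] Ux => /(_ x Ux); exact: derivableP. Qed.

Lemma Ck_on_derive W k U (f : V -> W) v :
  Ck_on k.+1 U f -> Ck_on k U (fun x => 'D_v f x).
Proof. by move=> [_ /(_ v)[]]. Qed.

Lemma Ck_onS W k U (f : V -> W) : Ck_on k.+1 U f -> Ck_on k U f.
Proof.
elim: k f => [f [//]|k IH f [cf df]]; split=> // v.
by have [d1 d2] := df v; split=> //; exact: IH.
Qed.

Lemma Ck_on_sub W k U U' (f : V -> W) : U' `<=` U -> Ck_on k U f -> Ck_on k U' f.
Proof.
move=> UU'; elim: k f => [|k IH] f [cf df].
  by split=> // x U'x; exact/cf/UU'.
split=> [x U'x|v]; first exact/cf/UU'.
have [d1 d2] := df v; split=> [x U'x|]; first exact/d1/UU'.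
exact: IH.
Qed.

Lemma open_near_eq W U (f g : V -> W) x : open U -> U x ->
  (forall y, U y -> f y = g y) -> \forall y \near x, f y = g y.
Proof. by move=> oU Ux fg; apply: filterS (open_nbhs_nbhs (conj oU Ux)). Qed.

Lemma Ck_on_eq W k U (f g : V -> W) : open U -> (forall x, U x -> f x = g x) ->
  Ck_on k U f -> Ck_on k U g.
Proof.
move=> oU; elim: k f g => [|k IH] f g fg [cf df].
  split=> // x Ux; rewrite /prop_for /continuous_at -fg//.
  exact: cvg_trans (near_eq_cvg (open_near_eq oU Ux fg)) (cf x Ux).
split=> [x Ux|v].
  rewrite /prop_for /continuous_at -fg//.
  exact: cvg_trans (near_eq_cvg (open_near_eq oU Ux fg)) (cf x Ux).
have [d1 d2] := df v; split=> [x Ux|].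
  exact: near_eq_derivable (open_near_eq oU Ux fg) (d1 x Ux).
apply: IH d2 => x Ux; apply: near_eq_derive; exact: open_near_eq Ux fg.
Qed.

(** Closure properties are proved by exhibiting an explicit derivative [g], which equals ['D_v f] on
    [U] only; [U] being open, this agreement is enough. *)
Lemma Ck_on_intro W k U (f : V -> W) : open U ->
  (forall x, U x -> {for x, continuous f}) ->
  (forall v, exists2 g, (forall x, U x -> is_derive x v f (g x)) & Ck_on k U g) ->
  Ck_on k.+1 U f.
Proof.
move=> oU cf df; split=> // v; have [g fg Cg] := df v; split=> [x Ux|].
  by have [] := fg x Ux.
by apply: Ck_on_eq Cg => // x Ux; have [_ ->] := fg x Ux.
Qed.

Lemma Ck_on_cst W k U (a : W) : Ck_on k U (cst a).
Proof.
elim: k a => [|k IH] a; first by split=> // x _; exact: cst_continuous.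
split=> [x _|v]; first exact: cst_continuous.
split=> [x _|]; first exact: derivable_cst.
have -> : 'D_v (cst a) = cst 0 by apply/funext => x; exact: derive_cst.
exact: IH.
Qed.

Lemma Ck_onD W k U (f g : V -> W) : open U ->
  Ck_on k U f -> Ck_on k U g -> Ck_on k U (fun x => f x + g x).
Proof.
move=> oU; elim: k f g => [|k IH] f g Cf Cg.
  by split=> // x Ux; apply: cvgD; [exact: Ck_on_continuous Cf _ Ux|
    exact: Ck_on_continuous Cg _ Ux].
apply: Ck_on_intro => // [x Ux|v].
  by apply: cvgD; [exact: Ck_on_continuous Cf _ Ux|
    exact: Ck_on_continuous Cg _ Ux].
exists (fun x => 'D_v f x + 'D_v g x) => [x Ux|].
  exact: (is_deriveD (Ck_on_derivable v Cf Ux) (Ck_on_derivable v Cg Ux)).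
by apply: IH; exact: Ck_on_derive.
Qed.

Lemma Ck_onM k U (f g : V -> R) : open U ->
  Ck_on k U f -> Ck_on k U g -> Ck_on k U (fun x => f x * g x).
Proof.
move=> oU; elim: k f g => [|k IH] f g Cf Cg.
  by split=> // x Ux; apply: cvgM; [exact: Ck_on_continuous Cf _ Ux|
    exact: Ck_on_continuous Cg _ Ux].
apply: Ck_on_intro => // [x Ux|v].
  by apply: cvgM; [exact: Ck_on_continuous Cf _ Ux|
    exact: Ck_on_continuous Cg _ Ux].
exists (fun x => f x * 'D_v g x + g x * 'D_v f x) => [x Ux|].
  exact: (is_deriveM (Ck_on_derivable v Cf Ux) (Ck_on_derivable v Cg Ux)).
by apply: Ck_onD => //; apply: IH; (exact: Ck_onS || exact: Ck_on_derive).
Qed.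

Lemma Ck_onN k U (f : V -> R) : open U ->
  Ck_on k U f -> Ck_on k U (fun x => - f x).
Proof.
move=> oU Cf; apply: (@Ck_on_eq _ _ _ (fun x => cst (-1) x * f x)) => //.
  by move=> x _; rewrite mulN1r.
by apply: Ck_onM => //; exact: Ck_on_cst.
Qed.

Lemma Ck_onB k U (f g : V -> R) : open U ->
  Ck_on k U f -> Ck_on k U g -> Ck_on k U (fun x => f x - g x).
Proof. by move=> oU Cf Cg; apply: Ck_onD => //; exact: Ck_onN. Qed.

Lemma Ck_on_sum W (I : Type) (r : seq I) (P : pred I) k U (f : I -> V -> W) :
  open U -> (forall i, Ck_on k U (f i)) ->
  Ck_on k U (fun x => \sum_(i <- r | P i) f i x).
Proof.
move=> oU Cf; elim: r => [|i r IH].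
  apply: (@Ck_on_eq _ _ _ (cst (0 : W))) => // [x _|]; last exact: Ck_on_cst.
  by rewrite big_nil.
apply: (@Ck_on_eq _ _ _ (fun x => (if P i then f i x else 0) +
    \sum_(j <- r | P j) f j x)) => // [x _|].
  by rewrite big_cons; case: ifP; rewrite ?add0r.
apply: Ck_onD => //; case: (P i) => //; exact: Ck_on_cst.
Qed.

Lemma Ck_on_prod (I : Type) (r : seq I) (P : pred I) k U (f : I -> V -> R) :
  open U -> (forall i, Ck_on k U (f i)) ->
  Ck_on k U (fun x => \prod_(i <- r | P i) f i x).
Proof.
move=> oU Cf; elim: r => [|i r IH].
  apply: (@Ck_on_eq R^o _ _ (cst (1 : R))) => // [x _|]; last exact: Ck_on_cst.
  by rewrite big_nil.
apply: (@Ck_on_eq _ _ _ (fun x => (if P i then f i x else 1) *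
    \prod_(j <- r | P j) f j x)) => // [x _|].
  by rewrite big_cons; case: ifP; rewrite ?mul1r.
apply: Ck_onM => //; case: (P i) => //; exact: Ck_on_cst.
Qed.

Lemma derive_line W (f : V -> W) x v :
  'D_1 (fun t : R => f (t *: v + x)) 0 = 'D_v f x.
Proof.
rewrite /derive; set g1 := fun h => _; set g2 := fun h => _.
suff -> : g1 = g2 by [].
by apply/funext => t; rewrite /g1 /g2 /= scale0r add0r addr0 scaler1.
Qed.

(** Restriction to the line through [x] in direction [v] reduces this to the chain rule in one
    variable, so a directional derivative of [f] suffices. *)
Lemma is_derive_compR (h : R -> R) (f : V -> R) x v a b :
  is_derive x v f a -> is_derive (f x) 1 h b ->
  is_derive x v (h \o f) (b * a).
Proof.
move=> [df <-] dh.
pose l := fun t : R => f (t *: v + x).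
have dl : is_derive (0 : R) 1 l ('D_v f x).
  split; first by move/derivable1P : df.
  exact: derive_line.
have dh' : is_derive (l 0) 1 h b by rewrite /l scale0r add0r.
have [d1 d2] := is_derive1_comp dh' dl.
split; first by apply/derivable1P; exact: d1.
by rewrite -d2 -derive_line.
Qed.

(** Limited to order 1 because the outer functions of interest are built from [relu2], which is not
    C^2. *)
Lemma Ck_on_comp1 U (h h' : R -> R) (f : V -> R) : open U ->
  (forall t : R, is_derive t 1 h (h' t)) -> continuous h' ->
  Ck_on 1 U f -> Ck_on 1 U (h \o f).
Proof.
move=> oU dh ch' Cf; have ch t : {for t, continuous h}.
  have [dht _] := dh t; exact/differentiable_continuous/derivable1_diffP.
apply: Ck_on_intro => // [x Ux|v].
  by apply: continuous_comp; [exact: Ck_on_continuous Cf _ Ux|exact: ch].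
exists (fun x => (h' \o f) x * 'D_v f x) => [x Ux|].
  exact: is_derive_compR (Ck_on_derivable v Cf Ux) (dh _).
apply: Ck_onM => //; last exact: Ck_on_derive.
split=> // x Ux; apply: continuous_comp; last exact: ch'.
exact: Ck_on_continuous Cf _ Ux.
Qed.

(** The derivative is a product of [1/f], taken twice, with a derivative of [f], so order [k] for
    [1/f] yields order [k.+1]. The square root is treated in the same way. *)
Lemma Ck_onV k U (f : V -> R) : open U -> (forall x, U x -> f x != 0) ->
  Ck_on k U f -> Ck_on k U (fun x => (f x)^-1).
Proof.
move=> oU f0; elim: k => [|k IH] Cf.
  by split=> // x Ux; apply: cvgV; [exact: f0|exact: Ck_on_continuous Cf _ Ux].
have IHf := IH (Ck_onS Cf).
apply: Ck_on_intro => // [x Ux|v].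
  by apply: cvgV; [exact: f0|exact: Ck_on_continuous Cf _ Ux].
exists (fun x => - ((f x)^-1 * (f x)^-1 * 'D_v f x)) => [x Ux|].
  split; first by apply: derivableV; [exact: f0|case: (Ck_on_derivable v Cf Ux)].
  rewrite deriveV ?f0//; last by case: (Ck_on_derivable v Cf Ux).
  by rewrite /GRing.scale/= mulNr -expr2 exprVn.
apply: Ck_onN => //; apply: Ck_onM => //; last exact: Ck_on_derive.
exact: Ck_onM.
Qed.

Lemma Ck_on_sqrt k U (f : V -> R) : open U -> (forall x, U x -> 0 < f x) ->
  Ck_on k U f -> Ck_on k U (fun x => Num.sqrt (f x)).
Proof.
move=> oU f0; elim: k => [|k IH] Cf.
  split=> // x Ux; apply: continuous_comp; last exact: sqrt_continuous.
  exact: Ck_on_continuous Cf _ Ux.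
have IHf := IH (Ck_onS Cf).
apply: Ck_on_intro => // [x Ux|v].
  apply: continuous_comp; last exact: sqrt_continuous.
  exact: Ck_on_continuous Cf _ Ux.
exists (fun x => (cst 2 x * Num.sqrt (f x))^-1 * 'D_v f x) => [x Ux|].
  apply: (@is_derive_compR Num.sqrt); first exact: (Ck_on_derivable v Cf Ux).
  exact: is_derive1_sqrt (f0 _ Ux).
apply: Ck_onM => //; last exact: Ck_on_derive.
apply: Ck_onV => // [x Ux|]; last by apply: Ck_onM => //; exact: Ck_on_cst.
by rewrite mulf_neq0 ?pnatr_eq0// gt_eqF// sqrtr_gt0 f0.
Qed.

Lemma continuous_mxP (T : topologicalType) m p (F : T -> 'M[R]_(m, p)) x :
  (forall i j, {for x, continuous (fun y => F y i j)}) <->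
  {for x, continuous F}.
Proof.
split=> [Fc|Fc i j]; last first.
  exact: (cvg_comp _ _ Fc (@coord_continuous R m p i j (F x))).
apply/cvgrPdist_lt => /= e e0.
have : \forall y \near x, forall ij : 'I_m * 'I_p, `|F x ij.1 ij.2 - F y ij.1 ij.2| < e.
  apply: filter_forall => -[i j] /=.
  by move: (Fc i j) => /cvgrPdist_lt /(_ _ e0).
apply: filterS => y Fy; rewrite [ltLHS]/Num.Def.normr/= mx_normrE.
apply: bigmax_lt => // ij _; rewrite !mxE; exact: Fy.
Qed.

Lemma Ck_on_mxP k U m p (F : V -> 'M[R]_(m, p)) : open U ->
  (forall i j, Ck_on k U (fun x => F x i j)) <-> Ck_on k U F.
Proof.
move=> oU; elim: k F => [|k IH] F.
  split=> [CF|CF i j].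
    split=> // x Ux; apply/continuous_mxP => i j; exact: Ck_on_continuous Ux.
  by split=> // x Ux; move: i j; apply/continuous_mxP; exact: Ck_on_continuous CF _ Ux.
split=> [CF|CF i j].
  apply: Ck_on_intro => // [x Ux|v].
    apply/continuous_mxP => i j; exact: Ck_on_continuous Ux.
  exists (fun x => \matrix_(i, j) 'D_v (fun y => F y i j) x) => [x Ux|].
    have dF : derivable F x v.
      by apply/derivable_mxP => i j; case: (Ck_on_derivable v (CF i j) Ux).
    by split=> //; exact: derive_mx.
  apply/IH => i j; apply: Ck_on_eq (Ck_on_derive v (CF i j)) => // x Ux.
  by rewrite mxE.
apply: Ck_on_intro => // [x Ux|v].
  by move: i j; apply/continuous_mxP; exact: Ck_on_continuous CF _ Ux.
exists (fun x => 'D_v F x i j) => [x Ux|].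
  have [dF _] := Ck_on_derivable v CF Ux.
  split; first by move: i j; apply/derivable_mxP.
  by rewrite derive_mx// mxE.
by move: i j; apply/IH; exact: Ck_on_derive.
Qed.

Lemma Ck_on_mulmx k U m p q (F : V -> 'M[R]_(m, p)) (G : V -> 'M[R]_(p, q)) :
  open U -> Ck_on k U F -> Ck_on k U G -> Ck_on k U (fun x => F x *m G x).
Proof.
move=> oU /Ck_on_mxP CF /Ck_on_mxP CG; apply/Ck_on_mxP => // i j.
apply: (@Ck_on_eq _ _ _ (fun x => \sum_l F x i l * G x l j)) => // [x _|].
  by rewrite mxE.
by apply: Ck_on_sum => // l; apply: Ck_onM => //; [exact: CF|exact: CG].
Qed.

Lemma Ck_on_trmx k U m p (F : V -> 'M[R]_(m, p)) :
  open U -> Ck_on k U F -> Ck_on k U (fun x => (F x)^T).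
Proof.
move=> oU /Ck_on_mxP CF; apply/Ck_on_mxP => // i j.
apply: (@Ck_on_eq _ _ _ (fun x => F x j i)) => // [x _|]; first by rewrite mxE.
exact: CF.
Qed.

Lemma Ck_on_det k U m (F : V -> 'M[R]_m) :
  open U -> Ck_on k U F -> Ck_on k U (fun x => \det (F x)).
Proof.
move=> oU /Ck_on_mxP CF; rewrite /determinant; apply: Ck_on_sum => // s.
apply: Ck_onM => //; first exact: Ck_on_cst.
by apply: Ck_on_prod => // i; exact: CF.
Qed.

(** Cramer's rule: the entries are cofactors divided by the determinant. *)
Lemma Ck_on_invmx k U m (F : V -> 'M[R]_m) :
  open U -> (forall x, U x -> \det (F x) != 0) ->
  Ck_on k U F -> Ck_on k U (fun x => invmx (F x)).
Proof.
move=> oU F0 CF; apply/Ck_on_mxP => // i j.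
apply: (@Ck_on_eq _ _ _ (fun x => (\det (F x))^-1 * ((cst ((-1) ^+ (j + i)) x) *
   \det (row' j (col' i (F x)))))) => // [x Ux|].
  by rewrite /invmx unitmxE unitfE F0// !mxE.
apply: Ck_onM => //.
  by apply: Ck_onV => //; exact: Ck_on_det.
apply: Ck_onM => //; first exact: Ck_on_cst.
apply: Ck_on_det => //; apply/Ck_on_mxP => // a b.
move/Ck_on_mxP : CF => /(_ oU) CF.
apply: Ck_on_eq (CF (lift j a) (lift i b)) => // x _; by rewrite !mxE.
Qed.

End CkCalculus.

Lemma Ck_on_coord (R : realType) (V : normedModType R) k (U : set V) m p
    (F : V -> 'M[R]_(m, p)) i j :
  open U -> Ck_on k U F -> Ck_on k U (fun x => F x i j).
Proof. by move=> oU CF; exact: ((Ck_on_mxP k F oU).2 CF i j). Qed.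

(** * Mean values along lines and symmetry of second derivatives *)

Lemma dist_halves (R : realType) (b c d e : R) :
  `|c - b| < e / 2 -> `|d - b| < e / 2 -> `|c - d| <= e.
Proof. by move=> H1 H2; have := ler_distD b c d; rewrite (distrC b d); lra. Qed.

Section MeanValue.
Context {R : realType} {V : normedModType R}.

Lemma ball_distE (x y : V) (r : R) : ball x r y = (`|x - y| < r) :> Prop.
Proof. by rewrite -ball_normE. Qed.

Lemma ball_shiftE (x w : V) (r : R) : ball x r (w + x) = (`|w| < r) :> Prop.
Proof. by rewrite ball_distE opprD addrCA subrr addr0 normrN. Qed.

Lemma is_derive_on_line (f : V -> R) y v (t d : R) :
  is_derive (t *: v + y) v f d -> is_derive t 1 (fun s : R => f (s *: v + y)) d.
Proof.
have E : (fun h : R => h^-1 *: ((fun s : R => f (s *: v + y)) \o shift t) (h *: 1) -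
    h^-1 *: f (t *: v + y)) = (fun h : R => h^-1 *: (f \o shift (t *: v + y)) (h *: v) -
    h^-1 *: f (t *: v + y)).
  apply/funext => h /=; rewrite [h *: 1]mulr1 scalerDl addrA //.
move=> [df <-]; split.
  move: df; rewrite /derivable.
  by under eq_fun do rewrite scalerBr; rewrite -E; under eq_fun do rewrite -scalerBr.
rewrite /derive; congr (lim _).
by under eq_fun do rewrite scalerBr; rewrite E; under eq_fun do rewrite -scalerBr.
Qed.

Lemma is_derive_translate (f : V -> R) w y v d :
  is_derive (y + w) v f d -> is_derive y v (fun z => f (z + w)) d.
Proof.
have E : (fun h : R => h^-1 *: ((fun z => f (z + w)) \o shift y) (h *: v) -
    h^-1 *: f (y + w)) = (fun h : R => h^-1 *: (f \o shift (y + w)) (h *: v) -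
    h^-1 *: f (y + w)).
  by apply/funext => h /=; rewrite addrA.
move=> [df <-]; split.
  move: df; rewrite /derivable.
  by under eq_fun do rewrite scalerBr; rewrite -E; under eq_fun do rewrite -scalerBr.
rewrite /derive; congr (lim _).
by under eq_fun do rewrite scalerBr; rewrite E; under eq_fun do rewrite -scalerBr.
Qed.

Lemma mvt_line (f : V -> R) y v (s : R) (g : R -> R) : 0 <= s ->
  (forall t, 0 <= t <= s -> is_derive (t *: v + y) v f (g t)) ->
  exists2 c, 0 <= c <= s & f (s *: v + y) - f y = g c * s.
Proof.
move=> s0 df.
have dphi t : 0 <= t <= s -> is_derive t 1 (fun t : R => f (t *: v + y)) (g t).
  by move=> ts; apply: is_derive_on_line; exact: df.
have [||c] := @MVT_segment R (fun t : R => f (t *: v + y)) g 0 s s0.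
  move=> t; rewrite in_itv/= => /andP[t0 ts]; apply: dphi.
  by rewrite !ltW.
  apply: derivable_within_continuous => t; rewrite in_itv/= => ts.
  by case: (dphi t ts).
by rewrite in_itv/= scale0r add0r subr0 => cs E; exists c.
Qed.

(** The mean value theorem is used twice: along [u] for the increment [G] of [f] in direction [v],
    then along [v] for ['D_u f]. *)
Lemma second_difference (f : V -> R) (N : set V) x u v (s : R) : 0 <= s ->
  Ck_on 2 N f ->
  (forall a b, 0 <= a <= s -> 0 <= b <= s -> N (a *: u + (b *: v + x))) ->
  exists2 p, N p &
    f (s *: u + (s *: v + x)) - f (s *: v + x) - (f (s *: u + x) - f x) =
    s ^+ 2 * 'D_v ('D_u f) p.
Proof.
move=> s0 Cf Nx.
have s0s : 0 <= s <= s by rewrite s0 lexx.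
have z0s : 0 <= (0 : R) <= s by rewrite s0 lexx.
pose G z := f (z + s *: v) - f z.
have [c cs Gc] := @mvt_line G x u s
  (fun t => 'D_u f (t *: u + x + s *: v) - 'D_u f (t *: u + x)) s0 (fun t ts =>
    is_deriveB (is_derive_translate (Ck_on_derivable u (Ck_onS Cf) (
      eq_rect _ N (Nx t s ts s0s) _ (etrans (congr1 _ (addrC _ _)) (addrA _ _ _)))))
     (Ck_on_derivable u (Ck_onS Cf) (eq_rect _ N (Nx t 0 ts z0s) _
      (congr1 (fun z => t *: u + z) (etrans (congr1 (fun z => z + x) (scale0r v)) (add0r x)))))).
have [d ds Gd] := @mvt_line ('D_u f) (c *: u + x) v s
  (fun t => 'D_v ('D_u f) (t *: v + (c *: u + x))) s0 (fun t ts =>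
    Ck_on_derivable v (Ck_on_derive u Cf) (eq_rect _ N (Nx c t cs ts) _
       (addrCA _ _ _))).
exists (d *: v + (c *: u + x)); first by rewrite addrCA; exact: Nx.
have E1 : s *: u + (s *: v + x) = s *: u + x + s *: v.
  by rewrite -addrA [x + _]addrC.
move: Gc; rewrite /G [c *: u + x + _]addrC Gd [x + s *: v]addrC => Gc.
transitivity (f (s *: u + x + s *: v) - f (s *: u + x) - (f (s *: v + x) - f x)).
  by rewrite E1; ring.
by rewrite Gc; ring.
Qed.

(** The second difference is symmetric in [u] and [v], so the two mixed derivatives take a common
    value, each at its own point near [x]; continuity carries the equality to [x]. *)
Lemma schwarz (f : V -> R) (U : set V) x u v : open U -> U x -> Ck_on 2 U f ->
  'D_u ('D_v f) x = 'D_v ('D_u f) x.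
Proof.
move=> oU Ux Cf; apply/eqP; rewrite -subr_eq0 -normr_le0; apply/ler_addgt0Pr => e e0.
rewrite add0r.
have cont a b : {for x, continuous ('D_a ('D_b f))}.
  exact: Ck_on_continuous (Ck_on_derive a (Ck_on_derive b Cf)) _ Ux.
have e20 : 0 < e / 2 by rewrite divr_gt0.
have : \forall y \near x, [/\ U y, `|'D_u ('D_v f) x - 'D_u ('D_v f) y| < e / 2 &
    `|'D_v ('D_u f) x - 'D_v ('D_u f) y| < e / 2].
  have F1 : \forall y \near x, U y by exact: open_nbhs_nbhs.
  have F2 : \forall y \near x, `|'D_u ('D_v f) x - 'D_u ('D_v f) y| < e / 2.
    by move: (cont u v) => /cvgrPdist_lt /(_ _ e20).
  have F3 : \forall y \near x, `|'D_v ('D_u f) x - 'D_v ('D_u f) y| < e / 2.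
    by move: (cont v u) => /cvgrPdist_lt /(_ _ e20).
  by apply: filterS (filterI (filterI F1 F2) F3) => y [[]].
move=> /nbhs_ballP[r /= r0 Br].
pose N := ball x r.
pose s := r / 2 / (`|u| + `|v| + 1).
have K0 : 0 < `|u| + `|v| + 1 by rewrite ltr_wpDl// addr_ge0.
have s0 : 0 < s by rewrite !divr_gt0.
have Ns a b w z : `|w| + `|z| <= `|u| + `|v| -> 0 <= a <= s -> 0 <= b <= s ->
    N (a *: w + (b *: z + x)).
  move=> wz /andP[a0 as_] /andP[b0 bs].
  rewrite /N addrA ball_shiftE.
  rewrite (le_lt_trans (ler_normD _ _))// !normrZ !ger0_norm//.
  apply: (@le_lt_trans _ _ (s * (`|w| + `|z|))).
    by rewrite mulrDr lerD// ler_wpM2r.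
  apply: (@le_lt_trans _ _ (s * (`|u| + `|v| + 1))).
    by rewrite ler_pM2l// (le_trans wz)// lerDl.
  by rewrite /s mulfVK ?gt_eqF// ltr_pdivrMr// ltr_pMr// ltr1n.
have CN : Ck_on 2 N f by apply: Ck_on_sub Cf => y /Br[].
have [p Np Ep] := second_difference (ltW s0) CN (fun a b => Ns a b u v (lexx _)).
have vu : `|v| + `|u| <= `|u| + `|v| by rewrite addrC.
have [p' Np' Ep'] := second_difference (ltW s0) CN (fun a b => Ns a b v u vu).
have Epp : 'D_u ('D_v f) p' = 'D_v ('D_u f) p.
  apply: (@mulfI _ (s ^+ 2)); first by rewrite expf_eq0/= gt_eqF.
  apply: etrans (esym Ep') _; apply: etrans _ Ep.
  rewrite [s *: v + (s *: u + x)]addrCA.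
  move: (f (s *: u + (s *: v + x))) (f (s *: u + x)) (f (s *: v + x)) (f x).
  by move=> a b c d; ring.
have [_ + _] := Br _ Np'; have [_ _] := Br _ Np => H1 H2.
move: Epp H1 H2.
move: ('D_u ('D_v f) p') ('D_v ('D_u f) p) ('D_u ('D_v f) x) ('D_v ('D_u f) x).
by move=> a b c d -> H1 H2; apply: (dist_halves H2 H1).
Unshelve. all: by end_near. Qed.

End MeanValue.

(** * Differentiability and Jacobians of C^1 maps *)

Lemma rV_coord_le (R : realType) n (h : 'rV[R]_n) i : `|h 0 i| <= `|h|.
Proof.
rewrite [leRHS]/Num.Def.normr/= mx_normrE.
exact: (le_bigmax _ (fun ij => `|h ij.1 ij.2|) (0, i)).
Qed.

Lemma rV_norm_le (R : realType) n (h : 'rV[R]_n) (c : R) : 0 <= c -> (forall i, `|h 0 i| <= c) -> `|h| <= c.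
Proof.
move=> c0 hc; rewrite [leLHS]/Num.Def.normr/= mx_normrE.
by apply: bigmax_le => // -[i j] _ /=; rewrite ord1.
Qed.

Section Jacobian.
Context {R : realType} {n : nat}.
Implicit Types (U : set 'rV[R]_n) (f : 'rV[R]_n -> R).

Local Notation basis i := (delta_mx 0 i : 'rV[R]_n).

Lemma continuous_mulmxr m (A : 'M[R]_(n, m)) :
  continuous (fun v : 'rV[R]_n => v *m A).
Proof.
move=> h; apply/continuous_mxP => i j /=.
have -> : (fun y : 'rV[R]_n => (y *m A) i j) = (fun y => \sum_k y i k * A k j).
  by apply/funext => y; rewrite mxE.
apply: (@Ck_on_continuous _ _ _ 0 setT) => //; apply: Ck_on_sum => [|k]; first exact: openT.
apply: Ck_onM; [exact: openT | | exact: (Ck_on_cst _ _ (A k j))].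
by split=> // y _; exact: coord_continuous.
Qed.

(** The displacement is made one coordinate at a time, each step being controlled by the mean value
    theorem and the continuity of one partial derivative at [x]. *)
Lemma C1_increment U f x : open U -> U x -> Ck_on 1 U f -> forall e, 0 < e ->
  \forall h \near (0 : 'rV[R]_n),
    `|f (h + x) - f x - \sum_i h 0 i * 'D_(basis i) f x| <= e * `|h|.
Proof.
move=> oU Ux Cf e e0.
pose e' := e / n.+1%:R; have e'0 : 0 < e' by rewrite divr_gt0.
have : \forall y \near x, forall i : 'I_n, U y /\ `|'D_(basis i) f x - 'D_(basis i) f y| < e'.
  apply: (@filter_forall 'rV[R]_n 'I_n (fun i y => U y /\
    `|'D_(basis i) f x - 'D_(basis i) f y| < e') (nbhs x)) => i.
  apply: filterI; first exact: open_nbhs_nbhs.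
  have := Ck_on_continuous (Ck_on_derive (basis i) Cf) Ux.
  by move=> /cvgrPdist_lt /(_ _ e'0).
move=> /nbhs_ballP[r /= r0 Br]; have Fr : \forall h \near (0 : 'rV[R]_n), `|h| < r.
  by apply/nbhs_ballP; exists r => // z; rewrite ball_distE sub0r normrN.
near=> h; have hr : `|h| < r by near: h.
(* [t k] keeps the first [k] coordinates of [h], so that the increments telescope from 0 to [h]. *)
pose t k : 'rV[R]_n := \row_i (if (i < k)%N then h 0 i else 0).
have step (k : 'I_n) : `|f (t k.+1 + x) - f (t k + x) - h 0 k * 'D_(basis k) f x| <= e' * `|h|.
  have tk : t k.+1 = h 0 k *: basis k + t k.
    apply/rowP => i; rewrite !mxE eqxx ltnS leq_eqVlt /=.
    have [->|ik] := eqVneq i k; first by rewrite eqxx ltnn mulr1 addr0.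
    by rewrite (negbTE (_ : val i != val k))// mulr0 add0r.
  have inB a : `|a| <= `|h 0 k| -> ball x r (a *: basis k + (t k + x)).
    move=> ah; rewrite addrA ball_shiftE.
    apply: le_lt_trans hr; apply: rV_norm_le => // i; rewrite !mxE eqxx /=.
    have [->|ik] := eqVneq i k.
      by rewrite ltnn mulr1 addr0 (le_trans ah)// rV_coord_le.
    by rewrite mulr0 add0r; case: ifP => _; rewrite ?normr0// rV_coord_le.
  have [c ch Ec] : exists2 c, `|c| <= `|h 0 k| &
      f (t k.+1 + x) - f (t k + x) = h 0 k * 'D_(basis k) f (c *: basis k + (t k + x)).
    rewrite tk -addrA; have [hk0|hk0] := leP 0 (h 0 k).
      have [|c /andP[c0 ch] Ec] := @mvt_line _ _ f (t k + x) (basis k) (h 0 k)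
          (fun a => 'D_(basis k) f (a *: basis k + (t k + x))) hk0.
        move=> a /andP[a0 ah]; apply: (Ck_on_derivable _ Cf).
        by have [|//] := Br (a *: basis k + (t k + x)) _ k; apply: inB; rewrite !ger0_norm.
      by exists c; rewrite ?ger0_norm// Ec mulrC.
    (* For a negative coordinate the segment is run from its other endpoint, as [mvt_line] moves by
       a nonnegative length. *)
    have hk0' : 0 <= - h 0 k by rewrite oppr_ge0 ltW.
    have [|c /andP[c0 ch] Ec] := @mvt_line _ _ f (h 0 k *: basis k + (t k + x)) (basis k) (- h 0 k)
        (fun a => 'D_(basis k) f (a *: basis k + (h 0 k *: basis k + (t k + x)))) hk0'.
      move=> a /andP[a0 ah]; apply: (Ck_on_derivable _ Cf).
      have [|//] := Br (a *: basis k + (h 0 k *: basis k + (t k + x))) _ k.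
      rewrite addrA -scalerDl; apply: inB.
      by rewrite !ler0_norm ?(ltW hk0)//; lra.
    exists (c + h 0 k); first by rewrite !ler0_norm ?(ltW hk0)//; lra.
    move: Ec; rewrite !addrA -!scalerDl addNr scale0r add0r => Ec.
    by rewrite -[LHS]opprB Ec mulrN opprK mulrC -!addrA.
  rewrite Ec -mulrBr normrM mulrC ler_pM// ?rV_coord_le// distrC.
  by have [|_ /ltW] := Br (c *: basis k + (t k + x)) _ k; [exact: inB|].
have t0 : t 0%N = 0 by apply/rowP => i; rewrite !mxE.
have tn : t n = h by apply/rowP => i; rewrite !mxE ltn_ord.
have -> : f (h + x) - f x = \sum_(k < n) (f (t k.+1 + x) - f (t k + x)).
  by rewrite -(big_mkord xpredT (fun k => f (t k.+1 + x) - f (t k + x))) telescope_sumr// t0 tn add0r.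
rewrite -sumrB (le_trans (ler_norm_sum _ _ _))//.
apply: (@le_trans _ _ (\sum_(k < n) e' * `|h|)); first by apply: ler_sum => k _; exact: step.
rewrite sumr_const card_ord -mulr_natl mulrA ler_wpM2r//.
by rewrite /e' mulrCA -[leRHS]mulr1 ler_pM2l// ler_pdivrMr// mul1r ler_nat.
Unshelve. all: by end_near. Qed.

(** Differentiability is expressed through a chosen differential; any continuous linear first-order
    approximation is a witness for that choice. *)
Lemma differentiable_from_linear (V W : normedModType R) (f : V -> W)
    (df : {linear V -> W}) x :
  continuous df -> f \o shift x = cst (f x) + df +o_ 0 id -> differentiable f x.
Proof.
move=> dfc dxf.
have hdf : (df : V -> W) = f \o shift x - cst (f x) +o_ 0 id.
  apply: eqaddoE; rewrite dxf addrAC -!addrA addrC !addrA subrK.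
  rewrite -[LHS]addr0 -addrA; congr (_ + _).
  by apply/eqP; rewrite eq_sym addrC addr_eq0 oppo.
apply/diffP => /=.
apply: (@getPex _ (fun (df : {linear V -> W}) => continuous df /\
  forall y, f y = f (lim (nbhs x)) + df (y - lim (nbhs x))
                  +o_(y \near x) (y - lim (nbhs x)))).
exists df; split=> //; apply: eqaddoEx => z.
rewrite hdf !addrA lim_id // /(_ \o _) /= subrK [f _ + _]addrC addrK.
rewrite -addrA -[LHS]addr0; congr (_ + _).
apply/eqP; rewrite eq_sym addrC addr_eq0 oppox; apply/eqP.
rewrite [in LHS]littleo_center0 (comp_centerK x id).
by rewrite -[- _ in RHS](comp_centerK x).
Qed.

Lemma C1_differentiable m U (F : 'rV[R]_n -> 'rV[R]_m) x :
  open U -> U x -> Ck_on 1 U F -> differentiable F x.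
Proof.
move=> oU Ux CF.
pose A : 'M[R]_(n, m) := \matrix_(i, j) 'D_(basis i) (fun y => F y 0 j) x.
apply: (@differentiable_from_linear _ _ F (mulmxr A)).
  exact: continuous_mulmxr.
apply/eqaddoP => e e0.
have CFj j : Ck_on 1 U (fun y => F y 0 j) by exact: Ck_on_coord.
have : \forall h \near (0 : 'rV[R]_n), forall j : 'I_m,
   `|F (h + x) 0 j - F x 0 j - \sum_i h 0 i * 'D_(basis i) (fun y => F y 0 j) x| <= e * `|h|.
  apply: (@filter_forall 'rV[R]_n 'I_m (fun j h => `|F (h + x) 0 j - F x 0 j -
    \sum_i h 0 i * 'D_(basis i) (fun y => F y 0 j) x| <= e * `|h|)
    (nbhs (0 : 'rV[R]_n))) => j.
  exact: (C1_increment oU Ux (CFj j) e0).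
apply: filterS => h Hh; apply: rV_norm_le => [|j]; first by rewrite mulr_ge0// ltW.
have := Hh j; rewrite /= !mxE opprD addrA; congr (_ <= _).
by congr `| _ - _|; apply: eq_bigr => i _; rewrite mxE.
Qed.

(** Bridge between the Jacobian of the definitions, which is built from the differential, and
    partial derivatives, to which the calculus of [Ck_on] applies. *)
Lemma jacobianE m U (F : 'rV[R]_n -> 'rV[R]_m) x i j :
  open U -> U x -> Ck_on 1 U F ->
  ('J F x) i j = 'D_(basis i) (fun y => F y 0 j) x.
Proof.
move=> oU Ux CF; have dF := C1_differentiable oU Ux CF.
have dd : derivable F x (basis i) by exact: diff_derivable.
have := deriveEjacobian (basis i) dF; rewrite -rowE => E.
have := congr1 (fun M : 'rV_m => M 0 j) E; rewrite derive_mx// !mxE => <-.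
by [].
Qed.

Lemma jacobian_row m (F : 'rV[R]_n -> 'rV[R]_m) (x : 'rV[R]_n) i :
  differentiable F x -> row i ('J F x) = 'D_(basis i) F x.
Proof. by move=> dF; rewrite deriveEjacobian// rowE. Qed.

Lemma near_eq_jacobian m (F G : 'rV[R]_n -> 'rV[R]_m) (x : 'rV[R]_n) :
  (\forall y \near x, F y = G y) -> differentiable F x -> differentiable G x ->
  'J F x = 'J G x.
Proof.
move=> FG dF dG; apply/row_matrixP => i.
exact: etrans (jacobian_row i dF) (etrans (near_eq_derive _ FG) (esym (jacobian_row i dG))).
Qed.

End Jacobian.

Lemma jacobian_comp (R : realType) n m p (F : 'rV[R]_n -> 'rV[R]_m)
    (G : 'rV[R]_m -> 'rV[R]_p) (x : 'rV[R]_n) :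
  differentiable F x -> differentiable G (F x) ->
  'J (G \o F) x = 'J F x *m 'J G (F x).
Proof.
move=> dF dG.
have dGF : differentiable (G \o F) x by exact: differentiable_comp.
apply/row_matrixP => i.
have vJ (v : 'rV[R]_m) : v *m 'J G (F x) = 'd G (F x) v.
  by rewrite -deriveEjacobian// deriveE.
rewrite row_mul vJ (jacobian_row i dF) (jacobian_row i dGF) !deriveE//.
by rewrite diff_comp.
Qed.

(** * Lebesgue measure on R^n *)

Section BorelMeasurability.
Context {R : realType}.

Lemma open_measurable_borel (T : ptopologicalType) (U : set T) :
  open U -> measurable (U : set (borel T)).
Proof. by move=> oU; exact: sub_sigma_algebra. Qed.

Lemma closed_measurable_borel (T : ptopologicalType) (U : set T) :
  closed U -> measurable (U : set (borel T)).
Proof.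
move=> cU; rewrite -[U]setCK; apply: measurableC.
by apply: open_measurable_borel; exact: closed_openC.
Qed.

Lemma continuous_measurable_borel (T : ptopologicalType) (f : T -> R) :
  continuous f -> measurable_fun (T := borel T) (U := R) setT f.
Proof.
move=> cf; apply: (measurability _ (RGenOpens.measurableE R)).
move=> _ [_ [a [b ->] <-]]; rewrite setTI; apply: open_measurable_borel.
by move/continuousP : cf; apply; exact: interval_open.
Qed.

(** An open set is the union of the boxes with rational centre and radius [1/(k+1)] that it
    contains. They are countably many, and the preimage of each is a finite intersection of
    conditions on single coordinates. *)
Lemma measurable_fun_rV d (T : measurableType d) n (f : T -> 'rV[R]_n) :
  (forall i, measurable_fun setT (fun x => f x 0 i)) ->
  measurable_fun (U := borel 'rV[R]_n) setT f.
Proof.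
move=> mf; apply: (@measurability _ _ T (borel 'rV[R]_n) setT f (@open 'rV[R]_n) erefl).
move=> _ [U oU <-]; rewrite setTI.
pose box (ck : 'rV[rat]_n * nat) := [set v : 'rV[R]_n | forall i,
  v 0 i \in `]ratr (ck.1 0 i) - ck.2.+1%:R^-1, ratr (ck.1 0 i) + ck.2.+1%:R^-1[].
have -> : f @^-1` U = \bigcup_ck (if `[< box ck `<=` U >] then f @^-1` box ck else set0).
  apply/seteqP; split=> x /=.
    move=> Ufx; have /nbhs_ballP[r /= r0 Br] := open_nbhs_nbhs (conj oU Ufx).
    have [k kr] : exists k, k.+1%:R^-1 < r / 2.
      have := @near_infty_natSinv_lt R (PosNum (divr_gt0 r0 (ltr0n _ 2))).
      by move=> [k _ /(_ k (leqnn k))]; exists k.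
    have ci i : exists c : rat, ratr c \in `]f x 0 i - k.+1%:R^-1, f x 0 i + k.+1%:R^-1[.
      by apply: rat_in_itvoo; rewrite ltrBlDr -addrA ltrDl addr_gt0 ?invr_gt0.
    pose c : 'rV[rat]_n := \row_i sval (cid (ci i)).
    have cP i : ratr (c 0 i) \in `]f x 0 i - k.+1%:R^-1, f x 0 i + k.+1%:R^-1[.
      by rewrite mxE; exact: svalP (cid (ci i)).
    have bU : box (c, k) `<=` U.
      move=> v /= bv; apply: Br; rewrite ball_distE.
      apply: (@le_lt_trans _ _ (k.+1%:R^-1 + k.+1%:R^-1)); last by rewrite [ltRHS]splitr ltrD.
      apply: rV_norm_le => [|i]; first by rewrite addr_ge0.
      have := bv i; have := cP i; rewrite !in_itv/= !mxE => /andP[a1 a2] /andP[b1 b2].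
      move: a1 a2 b1 b2; move: (k.+1%:R^-1) (ratr _) => e q a1 a2 b1 b2.
      by rewrite ler_norml; apply/andP; split; lra.
    exists (c, k) => //; rewrite asboolT//= => i /=.
    have := cP i; rewrite !in_itv/= => /andP[].
    move: (k.+1%:R^-1) (ratr _) => e q a1 a2.
    by apply/andP; split; lra.
  by move=> [ck _]; case: asboolP => // bU /bU.
apply: countable_bigcupT_measurable => [|ck]; first exact: countableP.
case: asboolP => _; last exact: measurable0.
have -> : f @^-1` box ck = \bigcap_(i in [set: 'I_n]) ((fun x => f x 0 i) @^-1`
    `]ratr (ck.1 0 i) - ck.2.+1%:R^-1, ratr (ck.1 0 i) + ck.2.+1%:R^-1[).
  by apply/seteqP; split=> [x bx i _|x bx i] /=; [exact: bx|exact: (bx i I)].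
apply: fin_bigcap_measurable => // i _; rewrite -[X in measurable X]setTI.
exact: mf.
Qed.

Lemma measurable_coord n i :
  measurable_fun setT (fun v : borel 'rV[R]_n => (v : 'rV[R]_n) 0 i).
Proof. by apply: continuous_measurable_borel => v; exact: coord_continuous. Qed.

(** With [rV_uncons], the measurable isomorphism between R x R^n and R^(n+1) behind the recursion
    that defines [lebesgue_rV]. *)
Definition rV_cons n (z : measurableTypeR R * borel 'rV[R]_n) : borel 'rV[R]_n.+1 :=
  row_mx ((z.1 : R)%:M : 'M[R]_1) (z.2 : 'rV[R]_n).

Definition rV_uncons n (v : borel 'rV[R]_n.+1) : measurableTypeR R * borel 'rV[R]_n :=
  ((v : 'rV[R]_(1 + n)) 0 0, rsubmx (v : 'rV[R]_(1 + n))).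

Lemma rV_consK n : cancel (@rV_cons n) (@rV_uncons n).
Proof.
move=> [t v]; rewrite /rV_uncons /rV_cons /=; congr pair; last by rewrite row_mxKr.
have E : (t%:M : 'M[R]_1) 0 0 = t by rewrite mxE eqxx.
rewrite -[RHS]E -(row_mxEl (t%:M : 'M[R]_1) (v : 'rV[R]_n) 0 0).
by congr (row_mx _ _ _ _); exact: val_inj.
Qed.

Lemma rV_unconsK n : cancel (@rV_uncons n) (@rV_cons n).
Proof.
move=> v; rewrite /rV_uncons /rV_cons /=.
suff -> : ((v : 'rV[R]_(1 + n)) 0 0)%:M = lsubmx (v : 'rV[R]_(1 + n)).
  exact: (@hsubmxK R 1 1 n v).
apply/rowP => i; rewrite !ord1 !mxE eqxx mulr1n; congr (_ _ _); exact/val_inj.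
Qed.

Lemma measurable_rV_cons n : measurable_fun setT (@rV_cons n).
Proof.
apply: measurable_fun_rV => i.
case: (split_ordP (i : 'I_(1 + n))) => j ->.
  apply: (@eq_measurable_fun _ _ _ _ setT fst); last exact: measurable_fst.
  move=> z _ /=; transitivity (((z.1 : R)%:M : 'M[R]_1) 0 j); first by rewrite mxE ord1 eqxx.
  by symmetry; exact: row_mxEl.
apply: (@eq_measurable_fun _ _ _ _ setT (fun z : (measurableTypeR R * borel 'rV[R]_n)%type => (z.2 : 'rV[R]_n) 0 j)).
  by move=> z _ /=; symmetry; exact: row_mxEr.
exact: (measurableT_comp (@measurable_coord n j) measurable_snd).
Qed.

Lemma measurable_rV_uncons n : measurable_fun setT (@rV_uncons n).
Proof.
apply: measurable_fun_pair => /=; first exact: measurable_coord.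
apply: measurable_fun_rV => i.
apply: (@eq_measurable_fun _ _ _ _ setT (fun v : borel 'rV[R]_n.+1 => (v : 'rV[R]_(1 + n)) 0 (rshift 1 i))).
  by move=> z _; rewrite mxE.
exact: measurable_coord.
Qed.

End BorelMeasurability.

Section SigmaFiniteOf.
Context {R : realType} d (T : measurableType d) (m : {measure set T -> \bar R}).
Hypothesis sm : sigma_finite setT m.

Let m' : set T -> \bar R := m.
HB.instance Definition _ := Measure.on m'.
HB.instance Definition _ := Measure_isSigmaFinite.Build _ _ _ m' sm.

Lemma sigma_finite_measure_of :
  exists m' : {sigma_finite_measure set T -> \bar R}, m = m' :> (set T -> \bar R).
Proof. by exists m'. Qed.

End SigmaFiniteOf.

Section LebesgueMeasure.
Context {R : realType}.
Local Open Scope ereal_scope.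
Notation leb1 := (@lebesgue_measure R).

(** [lebesgue_rV] is a bare set function. Inductively it is the image of a product measure under
    [rV_cons]; sigma-finiteness is part of the induction because the product with the next factor
    requires it. *)
Lemma lebesgue_rV_exists n :
  exists m : {sigma_finite_measure set (borel 'rV[R]_n) -> \bar R},
    @lebesgue_rV R n = m :> (set _ -> \bar R).
Proof.
elim: n => [|n [m Em]].
  by exists (@dirac _ (borel 'rV[R]_0) 0%R R).
pose p := pushforward (leb1 \x m) (@rV_cons R n).
pose mf := isMeasurableFun.Build _ _ _ _ _ (@measurable_rV_cons R n).
have Ep : @lebesgue_rV R n.+1 = p.
  apply/funext => A /=; rewrite /p /pushforward /product_measure1; congr integral.
  apply/funext => t /=; rewrite Em; congr (m _).
  by apply/seteqP; split=> v /=; rewrite /xsection /= inE.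
pose phi : {mfun _ >-> _} := HB.pack (@rV_cons R n) mf.
have mphi : measurable_fun setT (@rV_cons R n) by exact: measurable_rV_cons.
have mpsi : measurable_fun setT (@rV_uncons R n) by exact: measurable_rV_uncons.
have psf : sigma_finite setT p.
  have /sigma_finiteP[F [FT ndF Ffin]] := sigma_finiteT leb1.
  have /sigma_finiteP[G [GT ndG Gfin]] := sigma_finiteT m.
  exists (fun k => (@rV_uncons R n) @^-1` (F k `*` G k)).
    apply/esym; rewrite -subTset => v _.
    have [i _ Fi] : (\bigcup_i F i) (rV_uncons v).1 by rewrite -FT.
    have [j _ Gj] : (\bigcup_i G i) (rV_uncons v).2 by rewrite -GT.
    exists (maxn i j) => //; split => /=.
    - by move: Fi; apply/subsetPset/ndF/leq_maxl.
    - by move: Gj; apply/subsetPset/ndG/leq_maxr.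
  move=> k; have [mF Fk] := Ffin k; have [mG Gk] := Gfin k.
  have mFG : measurable (F k `*` G k) by exact: measurableX.
  split; first by rewrite -[X in measurable X]setTI; exact: mpsi.
  rewrite /p /pushforward -comp_preimage.
  rewrite (_ : _ \o _ = id) ?preimage_id//.
  - by rewrite product_measure1E// lte_mul_pinfty// ge0_fin_numE.
  - by apply/funext => z /=; rewrite rV_consK.
rewrite Ep; exact: (sigma_finite_measure_of (m := pushforward (leb1 \x m) phi)).
Qed.

Definition leb n : {sigma_finite_measure set (borel 'rV[R]_n) -> \bar R} :=
  sval (cid (lebesgue_rV_exists n)).

Lemma lebE n : @lebesgue_rV R n = leb n :> (set _ -> \bar R).
Proof. exact: svalP (cid (lebesgue_rV_exists n)). Qed.

End LebesgueMeasure.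

Section FubiniRV.
Context {R : realType}.
Local Open Scope ereal_scope.
Local Notation leb1 := (@lebesgue_measure R).
Local Notation leb n := (@leb R n).

Lemma leb_consE n : leb n.+1 = pushforward (leb1 \x leb n) (@rV_cons R n) :> (set _ -> \bar R).
Proof.
rewrite -lebE; apply/funext => A /=; rewrite /pushforward /product_measure1.
congr integral; apply/funext => t /=; rewrite lebE; congr (leb n _).
by apply/seteqP; split=> v /=; rewrite /xsection /= inE.
Qed.

Lemma integral_leb_cons n (f : borel 'rV[R]_n.+1 -> \bar R) :
  \int[leb n.+1]_v f v = \int[pushforward (leb1 \x leb n) (@rV_cons R n)]_v f v.
Proof. by rewrite -leb_consE. Qed.

(** Both orders of integration are given, so that the variable of differentiation can always be
    integrated first. *)
Lemma fubini_leb n (f : borel 'rV[R]_n.+1 -> \bar R) :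
  (leb n.+1).-integrable setT f ->
  \int[leb n.+1]_v f v = \int[leb1]_t \int[leb n]_v f (rV_cons (t, v)) /\
  \int[leb n.+1]_v f v = \int[leb n]_v \int[leb1]_t f (rV_cons (t, v)).
Proof.
move=> intf; have mf := measurable_int _ intf.
have mphi := @measurable_rV_cons R n.
have intfp : (leb1 \x leb n).-integrable setT (f \o @rV_cons R n).
  apply/integrableP; split; first by apply: (measurableT_comp mf); exact: mphi.
  move/integrableP : intf => [_]; rewrite integral_leb_cons.
  rewrite ge0_integral_pushforward//; exact: measurableT_comp.
rewrite integral_leb_cons integral_pushforward// preimage_setT; split.
  by rewrite -(@integral12_prod_meas1 _ _ _ _ _ leb1 (leb n) _ intfp).
by rewrite -(@integral21_prod_meas1 _ _ _ _ _ leb1 (leb n) _ intfp).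
Qed.

Definition cube n (K : R) : set 'rV[R]_n := [set v | forall i, v 0%R i \in `[(- K)%R, K]].

Lemma compact_cube n K : compact (@cube n K).
Proof.
have -> : @cube n K = [set v : 'rV[R]_n | forall i : 'I_n, `[(- K)%R, K]%classic (v ord0 i)] by [].
by apply: (@rV_compact R n (fun=> `[(- K)%R, K]%classic)) => i; exact: segment_compact.
Qed.

Lemma closed_cube n K : closed (@cube n K).
Proof. by apply: compact_closed; [exact: norm_hausdorff|exact: compact_cube]. Qed.

Lemma measurable_cube n K : measurable (@cube n K : set (borel 'rV[R]_n)).
Proof. by apply: closed_measurable_borel; exact: closed_cube. Qed.

Lemma rV_consE0 n (t : R) (v : 'rV[R]_n) : rV_cons (t, v) (0%R : 'I_1) (0%R : 'I_n.+1) = t.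
Proof. by have /(congr1 fst) := rV_consK (t, v). Qed.

Lemma rV_consEr n (t : R) (v : 'rV[R]_n) j :
  rV_cons (t, v) (0%R : 'I_1) (rshift 1 j : 'I_n.+1) = v 0%R j.
Proof. exact: row_mxEr. Qed.

Lemma cube_rV_cons n K (t : R) (v : 'rV[R]_n) :
  @cube n.+1 K (rV_cons (t, v)) <-> (t \in `[(- K)%R, K] /\ @cube n K v).
Proof.
split=> [Ktv|[Kt Kv] i].
  by split=> [|i]; [rewrite -(rV_consE0 t v)|rewrite -(rV_consEr t v)]; exact: Ktv.
case: (split_ordP (i : 'I_(1 + n))) => j ->; last by rewrite rV_consEr.
by rewrite (_ : lshift n j = 0%R) ?rV_consE0//; apply: val_inj; rewrite /= ord1.
Qed.

Lemma cube_finite n K : leb n (@cube n K) < +oo.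
Proof.
elim: n => [|n IH].
  by rewrite -lebE /= ltry.
rewrite leb_consE /pushforward.
have -> : @rV_cons R n @^-1` @cube n.+1 K = `[(- K)%R, K]%classic `*` @cube n K.
  by apply/seteqP; split=> -[t v] /= /cube_rV_cons.
rewrite product_measure1E//; last exact: measurable_cube.
rewrite lte_mul_pinfty//.
by rewrite /= lebesgue_measure_itv/=; case: ifP.
Qed.

Lemma integrable_compact_support n (f : 'rV[R]_n -> R) K : continuous f ->
  (forall v, ~ cube K v -> f v = 0%R) -> (leb n).-integrable setT (EFin \o f).
Proof.
move=> cf f0.
suff /(integrable_mkcond (EFin \o (f : borel 'rV[R]_n -> R)) (@measurable_cube n K)) :
    (leb n).-integrable (cube K) (EFin \o f).
  apply: eq_integrable => // v _; rewrite patchE; case: ifPn => // /negP.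
  by rewrite inE => /f0 /= ->.
apply: measurable_bounded_integrable; [exact: measurable_cube|exact: cube_finite| |].
  by apply: measurable_funTS; exact: continuous_measurable_borel.
have : compact (f @` @cube n K).
  by apply: continuous_compact; [exact: continuous_subspaceT|exact: compact_cube].
move=> /compact_bounded [M [Mr HM]]; exists M; split => // x Mx v Kv.
by apply: (HM x Mx); exists v.
Qed.

Lemma integral_derivative_line (f f' : R -> R) (K : R) :
  (forall t : R, is_derive t (1%R : R) f (f' t)) -> continuous f' ->
  (forall t, t \notin `[(- K)%R, K] -> f t = 0%R) ->
  \int[leb1]_t (f' t)%:E = 0.
Proof.
move=> df cf' f0.
(* Strictly larger than [K]: [f] vanishes at both ends of [[-L, L]], [f'] vanishes outside, and the
   interval is nondegenerate whatever the sign of [K]. *)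
pose L := (`|K| + 1)%R.
have KL : (K < L)%R by rewrite /L ltr_pwDr// ler_norm.
have L0 : (0 < L)%R by rewrite /L ltr_wpDl.
have fL t : (L <= `|t|)%R -> f t = 0%R.
  move=> Lt; apply: f0; rewrite in_itv/= -ler_norml -ltNge.
  exact: lt_le_trans KL Lt.
have f'L t : (L < `|t|)%R -> f' t = 0%R.
  move=> Lt; have [_ <-] := df t.
  have E : \forall s \near t, f s = cst (0%R : R) s.
    have : \forall s \near t, (L < `|s|)%R.
      by apply: (cvgr_gt _ (@norm_continuous _ _ t)).
    by apply: filterS => s Ls; apply: fL; exact: ltW.
  by rewrite (near_eq_derive _ E) derive_cst.
have -> : \int[leb1]_t (f' t)%:E = \int[leb1]_(t in `[(- L)%R, L]) (f' t)%:E.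
  rewrite [RHS]integral_mkcond; apply: eq_integral => t _; rewrite patchE.
  case: ifPn => //; rewrite notin_setE /= in_itv/= -ler_norml => /negP.
  by rewrite -ltNge => /f'L ->.
have LL : (- L < L)%R by rewrite gtrN.
have cf : continuous f.
  by move=> t; have [d _] := df t; exact/differentiable_continuous/derivable1_diffP.
rewrite (@continuous_FTC2 _ f' f)//.
- by rewrite !fL ?normrN ?ger0_norm ?(ltW L0)// sube0.
- exact: continuous_subspaceT.
- split; first by move=> t _; have [] := df t.
  + exact/cvg_at_right_filter/cf.
  + exact/cvg_at_left_filter/cf.
- by move=> t _; rewrite derive1E; have [_ ->] := df t.
Qed.

End FubiniRV.

(** * Integrals of partial derivatives *)

Section PartialIntegral.
Context {R : realType}.

Lemma is_derive_comp_linear (V V' : normedModType R) (L : {linear V' -> V})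
    (a : V) (f : V -> R) (v w : V') (d : R) :
  is_derive (L v + a) (L w) f d -> is_derive v w (fun z => f (L z + a)) d.
Proof.
have E : (fun h : R => h^-1 *: ((fun z => f (L z + a)) \o shift v) (h *: w) -
    h^-1 *: f (L v + a)) = (fun h : R => h^-1 *: (f \o shift (L v + a)) (h *: L w) -
    h^-1 *: f (L v + a)).
  by apply/funext => h /=; rewrite linearD linearZ addrA.
move=> [df <-]; split.
  move: df; rewrite /derivable.
  by under eq_fun do rewrite scalerBr; rewrite -E; under eq_fun do rewrite -scalerBr.
rewrite /derive; congr (lim _).
by under eq_fun do rewrite scalerBr; rewrite E; under eq_fun do rewrite -scalerBr.
Qed.

Lemma C1_comp_affine n m (A : 'M[R]_(n, m)) (a : 'rV[R]_m) (f : 'rV[R]_m -> R) :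
  Ck_on 1 setT f -> Ck_on 1 setT (fun v : 'rV[R]_n => f (v *m A + a)).
Proof.
move=> Cf; have cA : continuous (fun v : 'rV[R]_n => v *m A + a).
  by move=> v; exact: (cvgD (@continuous_mulmxr R n m A v) (cvg_cst a)).
apply: Ck_on_intro => [|v _|w]; first exact: openT.
  by apply: (@continuous_comp _ _ _ (fun v : 'rV[R]_n => v *m A + a) f);
    [exact: cA|exact: Ck_on_continuous Cf _ _].
exists (fun v => 'D_(w *m A) f (v *m A + a)) => [v _|].
  by apply: (is_derive_comp_linear (L := mulmxr A)); exact: Ck_on_derivable Cf _.
split=> // v _.
apply: (@continuous_comp _ _ _ (fun v : 'rV[R]_n => v *m A + a) ('D_(w *m A) f)).
  exact: cA.
exact: Ck_on_continuous (Ck_on_derive _ Cf) _ _.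
Qed.

(** Induction on the dimension. A derivative in the first coordinate vanishes once that coordinate
    is integrated; for any other one, the slices at fixed first coordinate satisfy the induction
    hypothesis. In dimension 0 there is no index [i]. *)
Lemma integral_partial_eq0 n (f : 'rV[R]_n -> R) (K : R) i : Ck_on 1 setT f ->
  (forall v, ~ cube K v -> f v = 0) ->
  (\int[@leb R n]_v ('D_(delta_mx 0 i) f v)%:E = 0)%E.
Proof.
elim: n f i => [f [//]|n IH f i Cf f0].
set g := 'D_(delta_mx 0 i) f.
have cg : continuous g by move=> v; exact: Ck_on_continuous (Ck_on_derive _ Cf) _ _.
have g0 v : ~ cube K v -> g v = 0.
  move=> Kv; rewrite /g.
  have E : \forall s \near v, f s = cst (0 : R) s.
    apply: (@filterS _ _ _ (~` (@cube R n.+1 K))) => //.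
    by apply: open_nbhs_nbhs; split=> //; apply: closed_openC; exact: closed_cube.
  by rewrite (near_eq_derive _ E) derive_cst.
have [I1 I2] := fubini_leb (integrable_compact_support cg g0).
(* [rV_cons (t, v)] becomes the affine expression [t *: e0 + v *m A], to which the derivative lemmas
   for lines and for linear maps apply. *)
pose e0 : 'rV[R]_n.+1 := row_mx (1%:M : 'M[R]_1) (0 : 'rV[R]_n).
pose A : 'M[R]_(n, n.+1) := row_mx (0 : 'M[R]_(n, 1)) 1%:M.
have vA (w : 'rV[R]_n) : w *m A = row_mx (0 : 'M[R]_1) w.
  by apply: etrans (mul_mx_row w (0 : 'M[R]_(n, 1)) 1%:M) _; rewrite mulmx0 mulmx1.
have consE t v : rV_cons (t, v) = t *: e0 + v *m A.
  rewrite /rV_cons /e0 /A /= (scale_row_mx t (1%:M : 'M[R]_1)) vA.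
  have -> : row_mx (t *: 1%:M) (t *: 0) + row_mx 0 (v : 'rV[R]_n) =
      row_mx (t *: (1%:M : 'M[R]_1) + 0) (t *: (0 : 'rV[R]_n) + v) by exact: add_row_mx.
  by rewrite scaler0 add0r addr0 scalemx1.
case: (split_ordP (i : 'I_(1 + n))) => j ij.
  have ei : delta_mx 0 i = e0.
    rewrite ij (@delta_mx_lshift R 1 1 n 0 j) (_ : delta_mx 0 j = 1%:M)//.
    by apply/matrixP => a b; rewrite !mxE !ord1.
  rewrite I2 -[RHS](@integral0 _ _ _ (@leb R n) setT); apply: eq_integral => v _.
  transitivity (\int[@lebesgue_measure R]_t (g (t *: e0 + v *m A))%:E)%E.
    by apply: eq_integral => t _; rewrite /= consE.
  apply: (@integral_derivative_line _ (fun t => f (t *: e0 + v *m A)) _ K).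
  - by move=> t; apply: is_derive_on_line; rewrite /g ei; exact: Ck_on_derivable Cf _.
  - move=> t; apply: (@continuous_comp _ _ _ (fun t : R => t *: e0 + v *m A) g).
      by apply: cvgD; [exact: scalel_continuous|exact: cvg_cst].
    exact: cg.
  - by move=> t tK; rewrite -consE; apply: f0 => /cube_rV_cons [tK' _]; rewrite tK' in tK.
have ei : delta_mx 0 i = (delta_mx 0 j : 'rV[R]_n) *m A.
  by rewrite ij (@delta_mx_rshift R 1 1 n 0 j) vA.
rewrite I1 -[RHS](@integral0 _ _ _ (@lebesgue_measure R) setT).
apply: eq_integral => t _.
have Ct := C1_comp_affine A (t *: e0) Cf.
have Ct0 v : ~ cube K v -> f (v *m A + t *: e0) = 0.
  by move=> Kv; rewrite addrC -consE; apply: f0 => /cube_rV_cons [_].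
apply: etrans (IH _ j Ct Ct0).
apply: eq_integral => v _; congr (_%:E); rewrite /= consE addrC /g ei.
apply/esym; apply: derive_val.
by apply: (is_derive_comp_linear (L := mulmxr A)); exact: Ck_on_derivable Cf _.
Qed.

End PartialIntegral.

(** * Volumes of ellipsoids *)

Section PositiveDefinite.
Context {R : realType}.

Definition quad n (g : 'M[R]_n) (v : 'rV[R]_n) : R := (v *m g *m v^T) 0 0.

Definition posdef n (g : 'M[R]_n) : Prop :=
  g^T = g /\ forall v : 'rV[R]_n, v != 0 -> 0 < quad g v.

Lemma posdef_kernel n (g : 'M[R]_n) : posdef g -> g \in unitmx.
Proof.
move=> [_ pg]; rewrite -row_free_unit -kermx_eq0; apply/eqP/row_matrixP => i.
rewrite row0; apply/eqP; apply/negPn/negP => r0.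
have := pg _ r0; rewrite /quad.
have /sub_kermxP -> : (row i (kermx g) <= kermx g)%MS by exact: row_sub.
by rewrite mul0mx mxE ltxx.
Qed.

Section Schur.
Variables (n : nat) (g : 'M[R]_(1 + n)).
Hypothesis pg : posdef g.
Let alpha := ulsubmx g.
Let beta := ursubmx g.
Let gam := drsubmx g.

Lemma posdef_drsubmx : posdef gam.
Proof.
have [sg qg] := pg; split.
  by rewrite /gam -{1}sg trmx_drsub trmxK.
move=> w w0; have v0 : row_mx (0 : 'M[R]_1) w != 0.
  by apply: contra w0; rewrite row_mx_eq0 => /andP[].
have := qg _ v0; rewrite /quad -[g in X in 0 < X]submxK mul_row_block !mul0mx !add0r.
by rewrite tr_row_mx mul_row_col trmx0 mulmx0 add0r.
Qed.

Let ugam : gam \in unitmx. Proof. exact: posdef_kernel posdef_drsubmx. Qed.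
Let sgam : gam^T = gam. Proof. by have [] := posdef_drsubmx. Qed.

Lemma dlsubmx_sym : dlsubmx g = beta^T.
Proof. by have [sg _] := pg; rewrite /beta -{2}sg trmx_ursub trmxK. Qed.

Definition schur : R := (alpha - beta *m invmx gam *m beta^T) 0 0.

Lemma det_schur : \det g = schur * \det gam.
Proof.
have -> : g = block_mx 1%:M (beta *m invmx gam) 0 1%:M *m
    block_mx (alpha - beta *m invmx gam *m beta^T) 0 beta^T gam.
  rewrite mulmx_block !mul1mx !mul0mx !add0r.
  by rewrite -!mulmxA mulVmx// mulmx1 subrK -dlsubmx_sym submxK.
by rewrite det_mulmx det_ublock det_lblock !det1 !mul1r det_mx11.
Qed.

(** Completing the square in [w]: the slice of an ellipsoid at fixed first coordinate is a
    translated ellipsoid of one dimension less. *)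
Lemma quad_schur (t : R) (w : 'rV[R]_n) :
  quad g (row_mx t%:M w) = schur * t ^+ 2 + quad gam (w + t *: (beta *m invmx gam)).
Proof.
rewrite /quad -[g in LHS]submxK dlsubmx_sym -/alpha -/beta -/gam.
rewrite mul_row_block tr_row_mx mul_row_col /schur.
have -> : (w + t *: (beta *m invmx gam)) *m gam = w *m gam + t *: beta.
  by rewrite mulmxDl -scalemxAl -mulmxA mulVmx// mulmx1.
have -> : (w + t *: (beta *m invmx gam))^T = w^T + t *: (invmx gam *m beta^T).
  by rewrite linearD linearZ/= trmx_mul trmx_inv sgam.
have -> : (w *m gam + t *: beta) *m (w^T + t *: (invmx gam *m beta^T)) =
    w *m gam *m w^T + t *: (beta *m w^T) + (t *: (w *m beta^T) +
    t ^+ 2 *: (beta *m invmx gam *m beta^T)).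
  rewrite mulmxDr !mulmxDl -!scalemxAl -!scalemxAr scalerA -expr2; congr (_ + (_ + _)).
    by rewrite mulmxA -[w *m gam *m _]mulmxA mulmxV// mulmx1.
  by rewrite mulmxA.
rewrite tr_scalar_mx mul_mx_scalar !mul_scalar_mx mulmxDl -scalemxAl.
move: (w *m beta^T) (beta *m w^T) (w *m gam *m w^T) (beta *m invmx gam *m beta^T).
move: alpha => A B C D E; rewrite !mxE; ring.
Qed.

Lemma schur_gt0 : 0 < schur.
Proof.
have [_ qg] := pg.
(* This vector annihilates the completed square, leaving the value [schur]. *)
have v0 : row_mx (1%:M : 'M[R]_1) (- (beta *m invmx gam)) != 0.
  by rewrite row_mx_eq0 negb_and matrix_nonzero1.
have := qg _ v0; rewrite quad_schur scale1r addNr expr1n mulr1.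
by rewrite /quad !mul0mx mxE addr0.
Qed.

End Schur.

Lemma det_posdef_gt0 n (g : 'M[R]_n) : posdef g -> 0 < \det g.
Proof.
elim: n g => [g _|n IH g pg]; first by rewrite det_mx00.
rewrite (det_schur pg) mulr_gt0//; first exact: schur_gt0.
by apply: IH; exact: (@posdef_drsubmx n g pg).
Qed.

Lemma continuous_quad n (g : 'M[R]_n) (a : 'rV[R]_n) :
  continuous (fun v : 'rV[R]_n => quad g (v - a)).
Proof.
move=> v; apply: (@Ck_on_continuous _ _ _ 0 setT) => //.
apply: Ck_on_coord; first exact: openT.
have C : Ck_on 0 [set: 'rV[R]_n] (fun v : 'rV[R]_n => v - a).
  split=> // w _; apply: (@cvgB _ _ _ (nbhs w) _ id (cst a) w a).
    exact: cvg_id.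
  exact: cvg_cst.
apply: Ck_on_mulmx; [exact: openT| |by apply: Ck_on_trmx => //; exact: openT].
by apply: Ck_on_mulmx => //; [exact: openT|exact: Ck_on_cst].
Qed.

Definition ellipsoid n (g : 'M[R]_n) (a : 'rV[R]_n) (s : R) : set 'rV[R]_n :=
  [set v | quad g (v - a) < s ^+ 2].

Lemma open_ellipsoid n (g : 'M[R]_n) a s : open (ellipsoid g a s).
Proof.
have -> : ellipsoid g a s = (fun v => quad g (v - a)) @^-1` [set x | x < s ^+ 2] by [].
by move: (@continuous_quad n g a) => /continuousP; apply; exact: open_lt.
Qed.

(** Slicing along the first coordinate replaces a linear change of variables. For [|t - a0| < r] the
    term [d (t - a0)^2] uses at most [(s / 2)^2], so the slice contains an ellipsoid of [gam] of
    radius [s / 2]. Its centre moves with [t], whence the arbitrary centre in the statement; what is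
    lost depends on the dimension only. *)
Lemma ellipsoid_volume n : exists2 c : R, 0 < c &
  forall (g : 'M[R]_n) (a : 'rV[R]_n) (s : R), posdef g -> 0 < s ->
  ((c * s ^+ n)%:E <= (Num.sqrt (\det g))%:E * leb n (ellipsoid g a s))%E.
Proof.
elim: n => [|n [c c0 IH]].
  exists 1 => // g a s _ s0; rewrite det_mx00 sqrtr1 mul1e mulr1 -lebE /=.
  by rewrite indicE mem_set// /ellipsoid /= /quad mxE big_ord0 exprn_gt0.
(* The slices have volume at least [c (s / 2)^n / sqrt(det gam)] over an interval of length
   [2 r = s / sqrt d], and [det g = d det gam]. *)
exists (c / 2 ^+ n) => [|g a s pg s0]; first by rewrite divr_gt0 ?exprn_gt0.
pose g' : 'M[R]_(1 + n) := g.
pose gam := drsubmx g'; pose bg := ursubmx g' *m invmx gam.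
have pgam : posdef gam by exact: posdef_drsubmx.
have dgam : 0 < \det gam by exact: det_posdef_gt0.
pose d := schur g'; have d0 : 0 < d by exact: schur_gt0.
pose a0 := (rV_uncons (a : borel 'rV[R]_n.+1)).1 : R.
pose a1 := (rV_uncons (a : borel 'rV[R]_n.+1)).2 : 'rV[R]_n.
pose r := s / 2 / Num.sqrt d.
have sd0 : 0 < Num.sqrt d by rewrite sqrtr_gt0.
have r0 : 0 < r by rewrite !divr_gt0.
have sg0 : 0 < Num.sqrt (\det gam) by rewrite sqrtr_gt0.
have detg : \det g = d * \det gam by exact: (det_schur (g := g')).
pose K := c * (s / 2) ^+ n / Num.sqrt (\det gam).
have slice (t : R) : t \in `]a0 - r, a0 + r[ ->
    (K%:E <= leb n [set w | ellipsoid g a s (rV_cons (t, w))])%E.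
  rewrite in_itv/= => tI.
  have tr : `|t - a0| < r by rewrite ltr_distl.
  have s20 : 0 < s / 2 by rewrite divr_gt0.
  have := IH gam (a1 - (t - a0) *: bg) (s / 2) pgam s20.
  rewrite -lee_pdivrMl// -EFinM => H; apply: (le_trans _ (le_trans H _)).
    by rewrite lee_fin /K mulrC.
  apply: le_measure; rewrite ?inE.
  - by apply: open_measurable_borel; exact: open_ellipsoid.
  - rewrite (_ : [set _ | _] = (fun w => rV_cons (t, w)) @^-1` ellipsoid g a s)//.
    rewrite -[X in measurable X]setTI.
    have mcons : measurable_fun setT (fun w : borel 'rV[R]_n => rV_cons (t, w)).
      apply: (measurableT_comp (@measurable_rV_cons R n)).
      exact: pair1_measurable.
    apply: mcons => //; apply: open_measurable_borel; exact: open_ellipsoid.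
  move=> w /=; rewrite /ellipsoid /= => wq.
  have -> : rV_cons (t, w) - a = row_mx (t - a0)%:M (w - a1) :> 'rV[R]_(1 + n).
    have {1}-> : a = rV_cons (a0, a1) by exact: (esym (rV_unconsK (a : borel 'rV[R]_n.+1))).
    have E : (row_mx (t%:M : 'M[R]_1) (w : 'rV[R]_n) : 'rV[R]_(1 + n)) - row_mx a0%:M a1 =
        row_mx (t - a0)%:M ((w : 'rV[R]_n) - a1).
      by rewrite opp_row_mx add_row_mx -raddfB.
    exact: E.
  rewrite (quad_schur pg) -/d -/gam -/bg.
  have dt : d * (t - a0) ^+ 2 <= (s / 2) ^+ 2.
    rewrite -{1}(sqr_sqrtr (ltW d0)) -exprMn -real_normK ?num_real// normrM.
    rewrite lerXn2r ?nnegrE ?(ltW s20) ?mulr_ge0//.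
    by rewrite gtr0_norm// mulrC -ler_pdivlMr// ltW.
  have : quad gam (w - a1 + (t - a0) *: bg) < (s / 2) ^+ 2.
    by move: wq; rewrite opprB addrA addrAC.
  have s2 : 0 < s ^+ 2 by rewrite exprn_gt0.
  move: dt; rewrite !exprMn exprVn; move: (s ^+ 2) s2 (d * _) (quad _ _).
  by move=> x x0 y z; lra.
have mE : measurable (ellipsoid g a s : set (borel 'rV[R]_n.+1)).
  by apply: open_measurable_borel; exact: open_ellipsoid.
have H : ((K * (2 * r))%:E <= leb n.+1 (ellipsoid g a s))%E.
  rewrite leb_consE /pushforward /product_measure1.
  pose I : set (measurableTypeR R) := `]a0 - r, a0 + r[%classic.
  have mI : measurable I.
    exact: measurable_itv.
  have -> : (K * (2 * r))%:E = (\int[@lebesgue_measure R]_(t in I) (cst K%:E t))%E.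
    rewrite integral_cst//= lebesgue_measure_itv/= lte_fin.
    rewrite ifT; last by rewrite ltrD2l gtrN.
    by rewrite -EFinB -EFinM; congr (_%:E); ring.
  rewrite integral_mkcond; apply: ge0_le_integral => //.
  - move=> t _; rewrite patchE; case: ifP => // _ /=.
    by rewrite lee_fin /K !mulr_ge0 ?invr_ge0 ?exprn_ge0 ?divr_ge0 ?ltW.
  - apply/(measurable_restrictT _ _).1 => //; exact: measurable_cst.
  - apply: measurable_fun_xsection; rewrite -[X in measurable X]setTI.
    by apply: measurable_rV_cons.
  - move=> t _; rewrite patchE; case: ifPn => [/set_mem tI|_]; last exact: measure_ge0.
    apply: (le_trans (slice t tI)) => /=; rewrite le_eqVlt; apply/orP; left.
    apply/eqP; congr (leb n _).
    by apply/seteqP; split=> v /=; rewrite /xsection /= inE.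
apply: (le_trans _ (lee_wpmul2l _ H)); last by rewrite lee_fin sqrtr_ge0.
rewrite -EFinM lee_fin detg sqrtrM ?(ltW d0)// /K /r exprS expr_div_n.
rewrite le_eqVlt; apply/orP; left; apply/eqP; field.
by rewrite !gt_eqF ?exprn_gt0.
Qed.

End PositiveDefinite.

(** * Tangential projections *)

Section Dot.
Context {R : realType} {m : nat}.
Implicit Types v w : 'rV[R]_m.

Definition dot v w : R := (v *m w^T) 0 0.

Lemma dotE v w : dot v w = \sum_i v 0 i * w 0 i.
Proof. by rewrite /dot mxE; apply: eq_bigr => i _; rewrite mxE. Qed.

Lemma dotC v w : dot v w = dot w v.
Proof. by rewrite !dotE; apply: eq_bigr => i _; rewrite mulrC. Qed.

Lemma dotDl v v' w : dot (v + v') w = dot v w + dot v' w.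
Proof. by rewrite /dot mulmxDl mxE. Qed.

Lemma dotDr v v' w : dot w (v + v') = dot w v + dot w v'.
Proof. by rewrite !(dotC w) dotDl. Qed.

Lemma dotZl a v w : dot (a *: v) w = a * dot v w.
Proof. by rewrite /dot -scalemxAl mxE. Qed.

Lemma dotZr a v w : dot v (a *: w) = a * dot v w.
Proof. by rewrite !(dotC v) dotZl. Qed.

Lemma dotNl v w : dot (- v) w = - dot v w.
Proof. by rewrite -scaleN1r dotZl mulN1r. Qed.

Lemma dotBl v v' w : dot (v - v') w = dot v w - dot v' w.
Proof. by rewrite dotDl dotNl. Qed.

Lemma dot0l w : dot 0 w = 0.
Proof. by rewrite /dot mul0mx mxE. Qed.

Lemma dot_ge0 v : 0 <= dot v v.
Proof. by rewrite dotE sumr_ge0// => i _; rewrite -expr2 sqr_ge0. Qed.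

Lemma enormE v : enorm v = Num.sqrt (dot v v).
Proof. by rewrite /enorm dotE; congr Num.sqrt; apply: eq_bigr => i _; rewrite expr2. Qed.

Lemma enorm_ge0 v : 0 <= enorm v.
Proof. exact: sqrtr_ge0. Qed.

Lemma sqr_enorm v : enorm v ^+ 2 = dot v v.
Proof. by rewrite enormE sqr_sqrtr ?dot_ge0. Qed.

Lemma cauchy_schwarz v w : `|dot v w| <= enorm v * enorm w.
Proof.
have [w0|w0] := eqVneq (dot w w) 0.
  have -> : w = 0.
    apply/rowP => i; rewrite mxE; apply/eqP; rewrite -sqrf_eq0.
    move: w0; rewrite dotE; move/eqP; rewrite psumr_eq0.
      by move/allP/(_ i); rewrite mem_index_enum expr2 => /(_ isT).
    by move=> j _; rewrite -expr2 sqr_ge0.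
  by rewrite dotC dot0l normr0 mulr_ge0 ?enorm_ge0.
have ww : 0 < dot w w by rewrite lt_neqAle eq_sym w0 dot_ge0.
rewrite -(@ler_pXn2r _ 2)// ?nnegrE ?mulr_ge0 ?enorm_ge0//.
rewrite exprMn !sqr_enorm real_normK ?num_real//.
have := dot_ge0 (v - (dot v w / dot w w) *: w).
rewrite dotBl !(dotC _ (_ - _)) !dotBl !dotZl !dotZr (dotC w v) => H.
have {}H : 0 <= dot v v - dot v w ^+ 2 / dot w w.
  apply: le_trans H _; rewrite le_eqVlt; apply/orP; left; apply/eqP.
  by field; rewrite gt_eqF.
by move: H; rewrite subr_ge0 ler_pdivrMr.
Qed.

Lemma dot_eq0 v : dot v v = 0 -> v = 0.
Proof.
move=> v0; apply/rowP => i; rewrite mxE; apply/eqP; rewrite -sqrf_eq0.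
move: v0; rewrite dotE; move/eqP; rewrite psumr_eq0.
  by move/allP/(_ i); rewrite mem_index_enum expr2 => /(_ isT).
by move=> j _; rewrite -expr2 sqr_ge0.
Qed.

Lemma enormD v w : enorm (v + w) <= enorm v + enorm w.
Proof.
rewrite -(@ler_pXn2r _ 2)// ?nnegrE ?addr_ge0 ?enorm_ge0//.
rewrite sqrrD !sqr_enorm !dotDl !dotDr (dotC w v).
have := cauchy_schwarz v w; have := ler_norm (dot v w); lra.
Qed.

Lemma enormN v : enorm (- v) = enorm v.
Proof. by rewrite !enormE -scaleN1r dotZl dotZr mulN1r mulN1r opprK. Qed.

Lemma enorm_dist v w : `|enorm v - enorm w| <= enorm (v - w).
Proof.
rewrite ler_norml; apply/andP; split.
  have := enormD v (w - v); rewrite addrCA subrr addr0 -(enormN (w - v)) opprB; lra.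
have := enormD w (v - w); rewrite addrCA subrr addr0; lra.
Qed.

End Dot.

Section TangentProjection.
Context {R : realType} {n m : nat}.
Implicit Types (J : 'M[R]_(n, m)) (v : 'rV[R]_m).

Definition gram J : 'M[R]_n := J *m J^T.

(** Vectors are rows, acted on from the right. When the Gram matrix is invertible this is the
    orthogonal projection onto the row space of [J], that is, onto the tangent space if the rows are
    coordinate fields. *)
Definition tproj J : 'M[R]_m := J^T *m invmx (gram J) *m J.

Lemma gram_sym J : (gram J)^T = gram J.
Proof. by rewrite trmx_mul trmxK. Qed.

Lemma tproj_sym J : (tproj J)^T = tproj J.
Proof. by rewrite /tproj !trmx_mul trmxK trmx_inv gram_sym mulmxA. Qed.

Section Full.
Variable J : 'M[R]_(n, m).
Hypothesis uJ : gram J \in unitmx.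

Lemma mul_tproj : J *m tproj J = J.
Proof. by rewrite /tproj !mulmxA mulmxV// mul1mx. Qed.

Lemma tproj_idem : tproj J *m tproj J = tproj J.
Proof. by rewrite {1}/tproj -!mulmxA mul_tproj mulmxA. Qed.

Lemma tproj_trmx : tproj J *m J^T = J^T.
Proof. by rewrite -{1}(tproj_sym J) -trmx_mul mul_tproj. Qed.

Lemma quad_tproj v : quad (tproj J) v = dot (v *m tproj J) (v *m tproj J).
Proof.
by rewrite /quad /dot trmx_mul tproj_sym -{1}tproj_idem !mulmxA.
Qed.

Lemma dot_tproj v : dot v v = quad (tproj J) v +
  dot (v - v *m tproj J) (v - v *m tproj J).
Proof.
have vP : dot v (v *m tproj J) = quad (tproj J) v.
  by rewrite /dot trmx_mul tproj_sym mulmxA.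
rewrite dotBl [dot v (v - _)]dotC [dot (v *m _) (v - _)]dotC !dotBl -quad_tproj vP.
rewrite dotC vP; ring.
Qed.

Lemma quad_tproj_bounds v : 0 <= quad (tproj J) v <= dot v v.
Proof. by rewrite [X in _ <= _ <= X]dot_tproj lerDl dot_ge0 quad_tproj dot_ge0. Qed.

End Full.

(** The Gram matrix changes by congruence and the cyclicity of the trace cancels [T]. With [T] the
    Jacobian of a transition map, this makes the divergence independent of the chart. *)
Lemma trace_change_of_coordinates (J J' : 'M[R]_(n, m)) (T : 'M[R]_n) (D D' : 'M[R]_(n, m)) :
  gram J \in unitmx -> gram J' \in unitmx -> J = T *m J' -> D = T *m D' ->
  \tr (invmx (gram J) *m (D *m J^T)) = \tr (invmx (gram J') *m (D' *m J'^T)).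
Proof.
move=> uJ uJ' EJ ED.
have Eg : gram (T *m J') = T *m gram J' *m T^T by rewrite /gram trmx_mul !mulmxA.
have uT : T \in unitmx.
  by move: uJ; rewrite EJ Eg !unitmx_mul => /andP[/andP[]].
have uTt : T^T \in unitmx by rewrite unitmx_tr.
rewrite EJ in uJ; rewrite EJ ED trmx_mul.
move: Eg uJ uJ'; move: (gram (T *m J')) (gram J') => g g' Eg ug ug'.
have E : g *m (invmx T^T *m (invmx g' *m invmx T)) = 1%:M.
  by rewrite Eg -!mulmxA (mulKVmx uTt) (mulKVmx ug') mulmxV.
have -> : invmx g = invmx T^T *m (invmx g' *m invmx T).
  by rewrite -[RHS]mul1mx -(mulVmx ug) -mulmxA E mulmx1.
rewrite -!mulmxA (mulKmx uT) mxtrace_mulC -!mulmxA mulmxV// mulmx1.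
by rewrite !mulmxA.
Qed.

(** The row spaces agree, so each projection fixes the rows of the other matrix: [P P' = P] and
    [P' P = P']. Transposing the first identity, by symmetry, gives [P = P']. *)
Lemma tproj_change_of_coordinates (J J' : 'M[R]_(n, m)) (T : 'M[R]_n) :
  gram J \in unitmx -> gram J' \in unitmx -> J = T *m J' -> tproj J = tproj J'.
Proof.
move=> uJ uJ' EJ.
have Eg : gram J = T *m gram J' *m T^T by rewrite /gram EJ trmx_mul !mulmxA.
have uT : T \in unitmx by move: uJ; rewrite Eg !unitmx_mul => /andP[/andP[]].
have aux (A : 'M[R]_(m, n)) (K : 'M[R]_(n, m)) (P : 'M[R]_m) :
    K *m P = K -> A *m K *m P = A *m K by move=> E; rewrite -mulmxA E.
have JP : J *m tproj J' = J by rewrite EJ -mulmxA mul_tproj.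
have EJ' : J' = invmx T *m J by rewrite EJ mulKmx.
have JP' : J' *m tproj J = J'.
  by rewrite EJ' -mulmxA mul_tproj.
have H : tproj J *m tproj J' = tproj J by exact: aux.
have H' : tproj J' *m tproj J = tproj J' by exact: aux.
have E : tproj J = tproj J' *m tproj J.
  by rewrite -{1}(tproj_sym J) -{1}H trmx_mul !tproj_sym.
exact: etrans E H'.
Qed.

End TangentProjection.

Section Hyperplane.
Context {R : realType} {n : nat}.
Variable J : 'M[R]_(n, n.+1).
Hypothesis uJ : gram J \in unitmx.

Lemma rank_of_gram : \rank J = n.
Proof.
apply/eqP; rewrite eqn_leq rank_leq_row /=.
by rewrite -{1}(eqP (_ : \rank (gram J) == n)) ?mxrankM_maxl// -/(row_free _) row_free_unit.
Qed.

(** [J] has rank [n], so the normal space, which is the kernel of [J^T], is a line. *)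
Lemma normal_colinear (u v : 'rV[R]_n.+1) :
  u *m J^T = 0 -> dot u u = 1 -> v *m J^T = 0 -> v = dot v u *: u.
Proof.
move=> uJt uu vJt.
have u0 : u != 0 by apply/eqP => u0; move: uu; rewrite u0 dot0l => /eqP; rewrite eq_sym oner_eq0.
have rk : \rank (kermx J^T) = 1%N by rewrite mxrank_ker mxrank_tr rank_of_gram subSnn.
have uk : (u <= kermx J^T)%MS by exact/sub_kermxP.
have vk : (v <= kermx J^T)%MS by exact/sub_kermxP.
have ku : (kermx J^T <= u)%MS.
  by have := mxrank_leqif_sup uk; rewrite rk rank_rV u0 => -[_ <-].
have /sub_rVP[a Ea] := submx_trans vk ku.
by rewrite Ea dotZl uu mulr1.
Qed.

(** The projection has rank at most [n], so it cannot fix all [n + 1] coordinate vectors. *)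
Lemma exists_normal_basis : exists k, (delta_mx 0 k : 'rV[R]_n.+1) *m (1%:M - tproj J) != 0.
Proof.
apply: contrapT => H.
have : 1%:M - tproj J = 0.
  apply/row_matrixP => k; rewrite rowE row0; apply: contrapT => /eqP h.
  by apply: H; exists k.
move/eqP; rewrite subr_eq0 => /eqP E.
have : (\rank (1%:M : 'M[R]_n.+1) <= n)%N.
  by rewrite E /tproj (leq_trans (mxrankM_maxr _ _))// rank_leq_row.
by rewrite mxrank1 ltnn.
Qed.

End Hyperplane.

(** * The divergence identity in a chart *)

Section DeriveSums.
Context {R : realType} {V : normedModType R}.

Lemma is_derive_bigsum m (f : 'I_m -> V -> R) x v (df : 'I_m -> R) :
  (forall a, is_derive x v (f a) (df a)) ->
  is_derive x v (fun z => \sum_a f a z) (\sum_a df a).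
Proof.
move=> Df; have -> : (fun z => \sum_a f a z) = \sum_a f a.
  by apply/funext => z; rewrite fct_sumE.
exact: is_derive_sum.
Qed.

Lemma is_derive_mul (f g : V -> R) x v a b :
  is_derive x v f a -> is_derive x v g b ->
  is_derive x v (fun z => f z * g z) (f x * b + g x * a).
Proof. by move=> Df Dg; exact: is_deriveM. Qed.

Lemma is_derive_bigprod (I : eqType) (r : seq I) (f : I -> V -> R) x v (df : I -> R) :
  uniq r -> (forall i, is_derive x v (f i) (df i)) ->
  is_derive x v (fun z => \prod_(i <- r) f i z)
    (\sum_(k <- r) df k * \prod_(i <- r | i != k) f i x).
Proof.
move=> + Df; elim: r => [_|i r IH /= /andP[ir ur]].
  have -> : (fun z => \prod_(i <- [::]) f i z) = cst 1.
    by apply/funext => z; rewrite big_nil.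
  by rewrite big_nil; exact: is_derive_cst.
have -> : (fun z => \prod_(j <- i :: r) f j z) = (fun z => f i z * \prod_(j <- r) f j z).
  by apply/funext => z; rewrite big_cons.
apply: is_derive_eq; first exact: is_derive_mul (Df i) (IH ur).
rewrite big_cons big_cons eqxx /= addrC; congr (_ + _).
  rewrite mulrC; congr (_ * _); rewrite [RHS]big_seq_cond big_seq.
  by apply: eq_bigl => j; case: (boolP (j \in r)) => //= jr; apply/esym; apply: contraNneq ir => <-.
rewrite mulr_sumr; apply: eq_big_seq => k kr; rewrite big_cons ifT.
  by rewrite mulrCA.
by apply: contraNneq ir => ->.
Qed.

(** Jacobi's formula: in the Leibniz expansion each product is differentiated one factor at a time,
    that is, one row of the matrix at a time. *)
Lemma is_derive_det n (G : V -> 'M[R]_n) x v (dG : 'M[R]_n) :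
  (forall i j, is_derive x v (fun z => G z i j) (dG i j)) ->
  is_derive x v (fun z => \det (G z)) (\sum_i \sum_j dG i j * cofactor (G x) i j).
Proof.
move=> DG.
have -> : (fun z => \det (G z)) = \sum_(s : {perm 'I_n}) (fun z => (-1) ^+ s * \prod_i G z i (s i)).
  by apply/funext => z; rewrite fct_sumE.
(* [G x] with row [k] differentiated; expanding its determinant along that row leaves the cofactors
   of [G x]. *)
pose Rk k : 'M[R]_n := \matrix_(i, j) if i == k then dG i j else G x i j.
have E : \sum_i \sum_j dG i j * cofactor (G x) i j =
    \sum_(s : {perm 'I_n}) (-1) ^+ s * \sum_k dG k (s k) * \prod_(i | i != k) G x i (s i).
  transitivity (\sum_k \det (Rk k)).
    apply: eq_bigr => k _; rewrite (expand_det_row _ k); apply: eq_bigr => j _.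
    rewrite mxE eqxx /cofactor; congr (_ * (_ * _)); congr determinant.
    by apply/matrixP => a b; rewrite !mxE eq_sym (negbTE (neq_lift _ _)).
  rewrite /determinant exchange_big /=; apply: eq_bigr => s _.
  rewrite -mulr_sumr; congr (_ * _); apply: eq_bigr => k _.
  rewrite (bigD1 k) //= mxE eqxx; congr (_ * _); apply: eq_bigr => i ik.
  by rewrite mxE (negbTE ik).
have Ds (s : 'S_n) : is_derive x v (fun z => (-1) ^+ s * \prod_i G z i (s i))
    ((-1) ^+ s * \sum_k dG k (s k) * \prod_(i | i != k) G x i (s i)).
  have := is_derive_bigprod (index_enum_uniq _) (fun i => DG i (s i)).
  move=> /(is_derive_mul (is_derive_cst ((-1) ^+ s : R) x v)) H.
  by apply: is_derive_eq H _; rewrite mulr0 addr0.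
rewrite E.
have : forall (r : seq 'S_n), is_derive x v
  (\sum_(s <- r) (fun z => (-1) ^+ s * \prod_i G z i (s i)))
  (\sum_(s <- r) (-1) ^+ s * \sum_k dG k (s k) * \prod_(i | i != k) G x i (s i)).
  elim=> [|s r IHr]; first by rewrite !big_nil; exact: is_derive_cst.
  by rewrite !big_cons; exact: is_deriveD.
exact.
Qed.

End DeriveSums.

Section Jac.
Context {R : realType} {n m : nat}.
Implicit Types (F : 'rV[R]_n -> 'rV[R]_m) (U : set 'rV[R]_n).
Local Notation D i f x := ('D_(delta_mx 0 i : 'rV[R]_n) f x).

Definition jac F x : 'M[R]_(n, m) := \matrix_(i, a) D i (fun y => F y 0 a) x.

Lemma jacE U F x : open U -> U x -> Ck_on 1 U F -> 'J F x = jac F x.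
Proof. by move=> oU Ux CF; apply/matrixP => i a; rewrite (jacobianE _ _ oU Ux CF) mxE. Qed.

Lemma Ck_on_jac k U F : open U -> Ck_on k.+1 U F -> Ck_on k U (jac F).
Proof.
move=> oU CF; apply/Ck_on_mxP => // i a.
apply: (@Ck_on_eq _ _ _ _ _ (fun x => D i (fun y => F y 0 a) x)) => // [x _|].
  by rewrite mxE.
by apply: Ck_on_derive; exact: Ck_on_coord.
Qed.

Lemma is_derive_coord U F x i a : open U -> U x -> Ck_on 1 U F ->
  is_derive x (delta_mx 0 i : 'rV[R]_n) (fun y => F y 0 a) (jac F x i a).
Proof.
by move=> oU Ux CF; rewrite mxE; apply: Ck_on_derivable Ux; exact: Ck_on_coord CF.
Qed.

End Jac.

Section LocalDivergence.
Context {R : realType} {n m : nat}.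
Local Notation D i f x := ('D_(delta_mx 0 i : 'rV[R]_n) f x).
Variables (U : set 'rV[R]_n) (F : 'rV[R]_n -> 'rV[R]_m).
Hypotheses (oU : open U) (CF : forall k, Ck_on k U F)
  (pF : forall x, U x -> posdef (gram (jac F x))).

Definition vol_density x : R := Num.sqrt (\det (gram (jac F x))).

(** Row [k] is [sqrt(det g) g^{kl} d_l F]: the coordinate fields with index raised, weighted by the
    volume density. *)
Definition raised x : 'M[R]_(n, m) :=
  vol_density x *: (invmx (gram (jac F x)) *m jac F x).

(** The Laplace-Beltrami operator in divergence form, applied to each coordinate of [F]. For a
    hypersurface with unit normal [nu] it is [- n H nu]. *)
Definition lap x : 'rV[R]_m :=
  \row_a ((vol_density x)^-1 * \sum_k D k (fun z => raised z k a) x).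

Lemma Ck_on_gram k : Ck_on k U (fun x => gram (jac F x)).
Proof. by apply: Ck_on_mulmx => //; [|apply: Ck_on_trmx => //]; exact: Ck_on_jac. Qed.

Lemma vol_density_gt0 x : U x -> 0 < vol_density x.
Proof. by move=> Ux; rewrite sqrtr_gt0; apply: det_posdef_gt0; exact: pF. Qed.

Lemma Ck_on_vol_density k : Ck_on k U vol_density.
Proof.
apply: Ck_on_sqrt => // [x Ux|]; first by apply: det_posdef_gt0; exact: pF.
by apply: Ck_on_det => //; exact: Ck_on_gram.
Qed.

Lemma Ck_on_raised k : Ck_on k U raised.
Proof.
apply/Ck_on_mxP => // i a.
apply: (@Ck_on_eq _ _ _ _ _ (fun x => vol_density x * (invmx (gram (jac F x)) *m jac F x) i a)) => //.
  by move=> x _; rewrite [RHS]mxE.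
apply: Ck_onM => //; first exact: Ck_on_vol_density.
apply: Ck_on_coord => //; apply: Ck_on_mulmx => //; last exact: Ck_on_jac.
apply: Ck_on_invmx => // [x Ux|]; last exact: Ck_on_gram.
by rewrite gt_eqF// det_posdef_gt0//; exact: pF.
Qed.

Lemma raisedE x k a :
  raised x k a = vol_density x * (invmx (gram (jac F x)) *m jac F x) k a.
Proof. by rewrite mxE. Qed.

Lemma lapE x a :
  lap x 0 a = (vol_density x)^-1 * \sum_k D k (fun z => raised z k a) x.
Proof. by rewrite mxE. Qed.

Lemma Ck_on_raised_coord k i a : Ck_on k U (fun z => raised z i a).
Proof. exact: (@Ck_on_coord R _ k U n m raised i a oU (Ck_on_raised k)). Qed.

Lemma Ck_on_jac_coord k i a : Ck_on k U (fun z => jac F z i a).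
Proof. exact: (@Ck_on_coord R _ k U n m (jac F) i a oU (Ck_on_jac oU (CF k.+1))). Qed.

Lemma Ck_on_lap k : Ck_on k U lap.
Proof.
apply/Ck_on_mxP => // i a.
apply: (@Ck_on_eq _ _ _ _ _ (fun x => (vol_density x)^-1 * \sum_k D k (fun z => raised z k a) x)) => //.
  by move=> x _; rewrite ord1 lapE.
apply: Ck_onM => //.
  apply: Ck_onV => // [x Ux|]; last exact: Ck_on_vol_density.
  by rewrite gt_eqF// vol_density_gt0.
apply: Ck_on_sum => // j; exact: Ck_on_derive (Ck_on_raised_coord k.+1 j a).
Qed.

(** The left side is the coordinate form, weighted by the density, of the divergence of the
    tangential part of [y], which itself need not be tangent. By the product rule the derivatives of
    [y] give the trace and those of [raised] give the pairing with [lap]. *)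
Lemma divergence_identity (y : 'rV[R]_n -> 'rV[R]_m) x : U x -> Ck_on 1 U y ->
  \sum_k D k (fun z => \sum_a raised z k a * y z 0 a) x =
  vol_density x * (\tr (invmx (gram (jac F x)) *m (jac y x *m (jac F x)^T)) +
                   dot (y x) (lap x)).
Proof.
move=> Ux Cy.
have Dk k : D k (fun z => \sum_a raised z k a * y z 0 a) x =
    \sum_a (raised x k a * jac y x k a + y x 0 a * D k (fun z => raised z k a) x).
  apply: derive_val; apply: is_derive_bigsum => a; apply: is_derive_mul.
    exact: (Ck_on_derivable _ (Ck_on_raised_coord 1 k a) Ux).
  exact: is_derive_coord Cy.
under eq_bigr do rewrite Dk big_split /=.
rewrite big_split /= mulrDr; congr (_ + _).
  rewrite -mxtrace_tr !trmx_mul trmxK trmx_inv gram_sym mxtrace_mulC mulmxA /mxtrace mulr_sumr.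
  apply: eq_bigr => k _; rewrite mxE mulr_sumr; apply: eq_bigr => a _.
  by rewrite raisedE [(jac y x)^T a k]mxE mulrA.
rewrite dotE mulr_sumr exchange_big /=; apply: eq_bigr => a _.
rewrite lapE mulrCA mulVKf ?gt_eqF ?vol_density_gt0// mulr_sumr.
by [].
Qed.

(** Jacobi's formula for the determinant of [G = J J^T]. The two halves of the derivative of [G]
    contribute equally because [invmx G] is symmetric, and the resulting factor 2 cancels that of
    the square root. *)
Lemma derive_vol_density x l : U x ->
  D l vol_density x = vol_density x * \sum_k \sum_a
    (invmx (gram (jac F x)) *m jac F x) k a * D l (fun z => jac F z k a) x.
Proof.
move=> Ux.
pose G := gram (jac F x); pose J := jac F x.
have dJ k a : is_derive x (delta_mx 0 l : 'rV[R]_n) (fun z => jac F z k a) (D l (fun z => jac F z k a) x).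
  exact: (Ck_on_derivable _ (Ck_on_jac_coord 1 k a) Ux).
pose dG : 'M[R]_n := \matrix_(i, j) \sum_a (J i a * D l (fun z => jac F z j a) x +
   J j a * D l (fun z => jac F z i a) x).
have DG i j : is_derive x (delta_mx 0 l : 'rV[R]_n) (fun z => gram (jac F z) i j) (dG i j).
  have -> : (fun z => gram (jac F z) i j) = (fun z => \sum_a jac F z i a * jac F z j a).
    by apply/funext => z; rewrite mxE; apply: eq_bigr => a _; rewrite [X in _ * X]mxE.
  by rewrite mxE; apply: is_derive_bigsum => a; exact: is_derive_mul.
have dG0 : 0 < \det G by apply: det_posdef_gt0; exact: pF.
have uG : G \in unitmx by apply: posdef_kernel; exact: pF.
have cofE i j : cofactor G i j = \det G * invmx G j i.
  rewrite /invmx uG mxE mulrA mulfV ?mul1r ?gt_eqF//.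
  by rewrite mxE.
have Gs i j : invmx G i j = invmx G j i.
  by rewrite -{1}(gram_sym J : G^T = G) -trmx_inv mxE.
rewrite (@derive_val _ _ _ _ _ _ _ (is_derive_compR (is_derive_det DG) (is_derive1_sqrt dG0))).
rewrite -/(vol_density x).
have -> : \sum_i \sum_j dG i j * cofactor (gram (jac F x)) i j = \det G * (2 *
    \sum_k \sum_a (invmx G *m J) k a * D l (fun z => jac F z k a) x).
  rewrite -/G; under eq_bigr do under eq_bigr do rewrite cofE mxE mulrCA big_split /=.
  under eq_bigr do rewrite -mulr_sumr.
  rewrite -mulr_sumr; congr (_ * _).
  pose S := \sum_k \sum_j \sum_a invmx G k j * J j a * D l (fun z => jac F z k a) x.
  have SE : S = \sum_k \sum_a (invmx G *m J) k a * D l (fun z => jac F z k a) x.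
    apply: eq_bigr => k _; rewrite exchange_big /=; apply: eq_bigr => a _.
    by rewrite [in RHS]mxE mulr_suml.
  rewrite -SE mulr_natl mulr2n.
  transitivity (\sum_i \sum_j (\sum_a invmx G j i * J i a * D l (fun z => jac F z j a) x +
      \sum_a invmx G i j * J j a * D l (fun z => jac F z i a) x)).
    apply: eq_bigr => i _; apply: eq_bigr => j _; rewrite mulrDl !mulr_suml; congr (_ + _).
      by apply: eq_bigr => a _; rewrite mulrC mulrA.
    by apply: eq_bigr => a _; rewrite mulrC mulrA Gs.
  under eq_bigr do rewrite big_split /=.
  rewrite big_split /=; congr (_ + _); exact: exchange_big.
rewrite -{1}[\det G]sqr_sqrtr ?(ltW dG0)// -/(vol_density x) expr2.
by field; rewrite gt_eqF// vol_density_gt0.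
Qed.

(* The second derivatives of [F] cancel, by symmetry and [derive_vol_density]. *)
Lemma lap_normal x : U x -> lap x *m (jac F x)^T = 0.
Proof.
move=> Ux; apply/rowP => l; rewrite [RHS]mxE [LHS]mxE.
pose J := jac F x.
have s0 : vol_density x != 0 by rewrite gt_eqF// vol_density_gt0.
have CJ := Ck_on_jac_coord 1; have CA := Ck_on_raised_coord 1.
(* Product rule for the identity [raised *m J^T = vol_density *: 1]. *)
have H k : \sum_a (raised x k a * D k (fun z => jac F z l a) x +
    J l a * D k (fun z => raised z k a) x) = (k == l)%:R * D k vol_density x.
  have E1 : is_derive x (delta_mx 0 k : 'rV[R]_n) (fun z => \sum_a raised z k a * jac F z l a)
      (\sum_a (raised x k a * D k (fun z => jac F z l a) x + J l a * D k (fun z => raised z k a) x)).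
    apply: is_derive_bigsum => a; apply: is_derive_mul.
      exact: (Ck_on_derivable _ (CA k a) Ux).
    exact: (Ck_on_derivable _ (CJ l a) Ux).
  have E2 : \forall z \near x, \sum_a raised z k a * jac F z l a = (k == l)%:R * vol_density z.
    apply: (open_near_eq oU Ux) => z Uz.
    have uG : gram (jac F z) \in unitmx by apply: posdef_kernel; exact: pF.
    transitivity ((raised z *m (jac F z)^T) k l).
      by rewrite [RHS]mxE; apply: eq_bigr => a _; rewrite [(jac F z)^T _ _]mxE.
    by rewrite /raised -scalemxAl -mulmxA mulVmx// mxE mxE mulrC.
  rewrite -(@derive_val _ _ _ _ _ _ _ E1) (near_eq_derive _ E2).
  rewrite deriveMl//.
  by have [] := Ck_on_derivable (delta_mx 0 k) (Ck_on_vol_density 1) Ux.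
apply: (mulfI s0); rewrite mulr0.
have -> : vol_density x * (\sum_j lap x 0 j * (jac F x)^T j l) =
    \sum_k \sum_a J l a * D k (fun z => raised z k a) x.
  rewrite mulr_sumr exchange_big /=; apply: eq_bigr => a _.
  rewrite lapE mulrA mulVKf// [(jac F x)^T _ _]mxE mulr_suml; apply: eq_bigr => k _.
  by rewrite mulrC.
have -> : \sum_k \sum_a J l a * D k (fun z => raised z k a) x =
   \sum_k ((k == l)%:R * D k vol_density x - \sum_a raised x k a * D k (fun z => jac F z l a) x).
  by apply: eq_bigr => k _; rewrite -H big_split /= [X in X - _]addrC addrK.
rewrite sumrB (bigD1 l)//= eqxx mul1r [X in _ + X - _]big1 ?addr0; last first.
  by move=> k /negbTE ->; rewrite mul0r.
rewrite derive_vol_density// mulr_sumr; apply/eqP; rewrite subr_eq0; apply/eqP.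
apply: eq_bigr => k _; rewrite mulr_sumr; apply: eq_bigr => a _.
rewrite mulrA -raisedE; congr (_ * _).
have Ca : Ck_on 2 U (fun z => F z 0 a) := Ck_on_coord 0 a oU (CF 2).
have -> : (fun z => jac F z k a) = 'D_(delta_mx 0 k) (fun z => F z 0 a).
  by apply/funext => z; rewrite mxE.
have -> : (fun z => jac F z l a) = 'D_(delta_mx 0 l) (fun z => F z 0 a).
  by apply/funext => z; rewrite mxE.
exact: schwarz oU Ux Ca.
Qed.

End LocalDivergence.

(** * Charts of an immersed hypersurface *)

(* [vector.coord] shadows the chart coordinates. *)
Local Notation coord := Defs.coord.

Section ChartGeometry.
Context {R : realType} {n : nat} {M : ptopologicalType}.
Variables (A : set (chart R n M)) (g : chart R n M -> 'rV[R]_n -> 'M[R]_n)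
  (X : M -> 'rV[R]_n.+1).
Hypotheses (atlasA : smooth_atlas A) (metric_g : riemannian_metric A g)
  (immX : isometric_immersion A g X).
Implicit Types (c : chart R n M) (p q : M) (O : set M).

Lemma open_dom c : open (dom c).
Proof. exact: dom_open. Qed.

Lemma open_img c : open (img c).
Proof. exact: img_open. Qed.

Arguments open_dom : clear implicits.
Arguments open_img : clear implicits.

Lemma open_chart_preimage c (W : set M) : open W -> open (dom c `&` par c @^-1` W).
Proof.
move=> oO; rewrite openE => x [dx Ox]; apply: filterI.
  by apply: open_nbhs_nbhs; split=> //; exact: dom_open.
by apply: (par_cont dx); exact: open_nbhs_nbhs.
Qed.

Arguments open_chart_preimage c [W] _.

Definition chart_at p : chart R n M := sval (cid2 (atlasA.1 p)).

Lemma chart_at_A p : A (chart_at p).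
Proof. exact: s2valP (cid2 (atlasA.1 p)). Qed.

Lemma chart_at_img p : img (chart_at p) p.
Proof. exact: s2valP' (cid2 (atlasA.1 p)). Qed.

Definition C1_map (W : normedModType R) O (f : M -> W) : Prop :=
  forall c, A c -> Ck_on 1 (dom c `&` par c @^-1` O) (f \o par c).

Lemma smooth_C1_map m O (f : M -> 'rV[R]_m) : smooth_map A O f -> C1_map O f.
Proof. by move=> sf c Ac; exact: sf. Qed.

Lemma smooth_X c k : A c -> Ck_on k (dom c) (X \o par c).
Proof. by move=> Ac; have := immX.1 c Ac k; apply: Ck_on_sub => x dx; split. Qed.

Lemma gram_metric c x : A c -> dom c x -> g c x = gram (jac (X \o par c) x).
Proof.
by move=> Ac dx; rewrite (immX.2 c x Ac dx) (jacE (open_dom c) dx (smooth_X 1 Ac)).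
Qed.

Lemma posdef_gram c x : A c -> dom c x -> posdef (gram (jac (X \o par c) x)).
Proof.
move=> Ac dx; rewrite -gram_metric//; have [_ /(_ c x Ac dx)[gT gpos] _] := metric_g.
by split.
Qed.

Lemma unit_gram c x : A c -> dom c x -> gram (jac (X \o par c) x) \in unitmx.
Proof. by move=> Ac dx; apply: posdef_kernel; exact: posdef_gram. Qed.

Definition cjac m c (Z : M -> 'rV[R]_m) p : 'M[R]_(n, m) :=
  jac (Z \o par c) (coord c p).

Lemma unit_gram_cjac c p : A c -> img c p -> gram (cjac c X p) \in unitmx.
Proof. by move=> Ac cp; apply: unit_gram => //; exact: (coordP cp).1. Qed.

Lemma cjac_change m c c' O (Z : M -> 'rV[R]_m) p :
  A c -> A c' -> open O -> O p -> img c p -> img c' p -> C1_map O Z ->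
  cjac c Z p = 'J (coord c' \o par c) (coord c p) *m cjac c' Z p.
Proof.
move=> Ac Ac' oO Op cp c'p CZ.
have [dx px] := coordP cp; have [dx' px'] := coordP c'p.
pose V := dom c `&` par c @^-1` img c'.
have oV : open V by apply: open_chart_preimage; exact: img_open.
have Vx : V (coord c p) by split=> //=; rewrite px.
have dtau : differentiable (coord c' \o par c) (coord c p).
  exact: (C1_differentiable oV Vx (atlasA.2 c c' Ac Ac' 1%N)).
have tx : (coord c' \o par c) (coord c p) = coord c' p by rewrite /= px.
have oU' := open_chart_preimage c' oO.
have Ux' : (dom c' `&` par c' @^-1` O) (coord c' p) by split=> //=; rewrite px'.
have dZ' : differentiable (Z \o par c') ((coord c' \o par c) (coord c p)).
  by rewrite tx; exact: (C1_differentiable oU' Ux' (CZ c' Ac')).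
have oU := open_chart_preimage c oO.
have Ux : (dom c `&` par c @^-1` O) (coord c p) by split=> //=; rewrite px.
have dZ : differentiable (Z \o par c) (coord c p).
  exact: (C1_differentiable oU Ux (CZ c Ac)).
have E : \forall y \near coord c p, (Z \o par c) y = ((Z \o par c') \o (coord c' \o par c)) y.
  apply: filterS (open_nbhs_nbhs (conj oV Vx)) => y [_ /= c'y].
  by have [_ ->] := coordP c'y.
have E1 : 'J (Z \o par c) (coord c p) = cjac c Z p := jacE oU Ux (CZ c Ac).
have E2 : 'J (Z \o par c') (coord c' p) = cjac c' Z p := jacE oU' Ux' (CZ c' Ac').
have E3 := near_eq_jacobian E dZ (differentiable_comp dtau dZ').
have E4 := jacobian_comp dtau dZ'.
have E5 : 'J (Z \o par c') ((coord c' \o par c) (coord c p)) = cjac c' Z p.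
  by rewrite tx; exact: E2.
exact: etrans (esym E1) (etrans E3 (etrans E4 (congr1 (mulmx _) E5))).
Qed.

Lemma C1_map_X : C1_map setT X.
Proof. by move=> c Ac; apply: Ck_on_sub (smooth_X 1 Ac) => x []. Qed.

Definition div m c (Z : M -> 'rV[R]_m) p (Y : 'M[R]_(n, m)) : R :=
  \tr (invmx (gram (cjac c X p)) *m (cjac c Z p *m Y^T)).

Definition divX c (Z : M -> 'rV[R]_n.+1) p : R := div c Z p (cjac c X p).

Lemma divX_change c c' O Z p :
  A c -> A c' -> open O -> O p -> img c p -> img c' p -> C1_map O Z ->
  divX c Z p = divX c' Z p.
Proof.
move=> Ac Ac' oO Op cp c'p CZ; rewrite /divX /div.
apply: trace_change_of_coordinates; [exact: unit_gram_cjac|exact: unit_gram_cjac| |].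
- exact: (cjac_change Ac Ac' openT I cp c'p C1_map_X).
- exact: (cjac_change Ac Ac' oO Op cp c'p CZ).
Qed.

Lemma tproj_change c c' p : A c -> A c' -> img c p -> img c' p ->
  tproj (cjac c X p) = tproj (cjac c' X p).
Proof.
move=> Ac Ac' cp c'p.
apply: tproj_change_of_coordinates; [exact: unit_gram_cjac|exact: unit_gram_cjac|].
exact: (cjac_change Ac Ac' openT I cp c'p C1_map_X).
Qed.

Definition tan_proj p : 'M[R]_n.+1 := tproj (cjac (chart_at p) X p).

Lemma tan_projE c p : A c -> img c p -> tan_proj p = tproj (cjac c X p).
Proof. by move=> Ac cp; apply: tproj_change => //; [exact: chart_at_A|exact: chart_at_img]. Qed.

Lemma Ck_on_tproj c k : A c -> Ck_on k (dom c) (fun x => tproj (jac (X \o par c) x)).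
Proof.
move=> Ac; have oc := open_dom c.
have CJ : Ck_on k (dom c) (jac (X \o par c)) by exact: (Ck_on_jac oc (smooth_X k.+1 Ac)).
have CJt : Ck_on k (dom c) (fun x => (jac (X \o par c) x)^T) by exact: Ck_on_trmx.
apply: Ck_on_mulmx => //; apply: Ck_on_mulmx => //.
apply: Ck_on_invmx => // [x dx|]; last exact: Ck_on_mulmx.
by rewrite gt_eqF// det_posdef_gt0//; exact: posdef_gram.
Qed.

Section NormalField.
Variable k : 'I_n.+1.

(** Where the normal component of a fixed coordinate vector does not vanish, normalizing it yields a
    smooth unit normal field, with no orientation involved; around each point some [k] works. *)
Definition normal_part p : 'rV[R]_n.+1 := delta_mx 0 k *m (1%:M - tan_proj p).

Lemma normal_part_par c x : A c -> dom c x ->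
  normal_part (par c x) = delta_mx 0 k *m (1%:M - tproj (jac (X \o par c) x)).
Proof.
move=> Ac dx; have [cp xp] := parP dx.
by rewrite /normal_part (tan_projE Ac cp) /cjac xp.
Qed.

Lemma Ck_on_normal_part c j : A c -> Ck_on j (dom c) (normal_part \o par c).
Proof.
move=> Ac; have oc := open_dom c.
apply: (@Ck_on_eq _ _ _ _ _ (fun x => (delta_mx 0 k : 'rV[R]_n.+1) *m (1%:M - tproj (jac (X \o par c) x)))) => [|x dx|].
- exact: oc.
- exact: esym (normal_part_par Ac dx).
apply: Ck_on_mulmx; [exact: oc|exact: Ck_on_cst|].
apply/Ck_on_mxP => [|a b]; first exact: oc.
apply: (@Ck_on_eq _ _ _ _ _ (fun x => (1%:M : 'M[R]_n.+1) a b - tproj (jac (X \o par c) x) a b)) => [|x _|].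
- exact: oc.
- by rewrite [RHS]mxE [X in _ = _ + X]mxE.
apply: Ck_onB; [exact: oc|exact: Ck_on_cst|].
exact: (Ck_on_coord a b oc (Ck_on_tproj j Ac)).
Qed.

Definition normal_dom : set M := [set p | normal_part p != 0].

Definition normal_field p : 'rV[R]_n.+1 := (enorm (normal_part p))^-1 *: normal_part p.

Lemma enorm_gt0 (v : 'rV[R]_n.+1) : v != 0 -> 0 < enorm v.
Proof.
move=> v0; rewrite lt_neqAle enorm_ge0 andbT; apply/eqP => e0.
by move/eqP: v0; apply; apply: dot_eq0; rewrite -sqr_enorm -e0 expr0n.
Qed.

Lemma open_normal_dom : open normal_dom.
Proof.
rewrite openE => p /= p0; pose c := chart_at p.
have Ac : A c by exact: chart_at_A.
have cp : img c p by exact: chart_at_img.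
have [dx px] := coordP cp.
have : \forall q \near p, (normal_part \o par c) (coord c q) != 0.
  have cont : {for p, continuous ((normal_part \o par c) \o coord c)}.
    apply: continuous_comp; first exact: coord_cont.
    exact: (Ck_on_continuous (Ck_on_normal_part 0 Ac)).
  by apply: (cvgr_neq0 _ cont); rewrite /= px.
move=> H; apply: filterS (filterI H (open_nbhs_nbhs (conj (open_img c) cp))) => q [+ cq].
by rewrite /normal_dom /=; have [_ ->] := coordP cq.
Qed.

Lemma normal_field_unit : unit_normal_field A X normal_dom normal_field.
Proof.
have wJ c x : A c -> dom c x -> normal_part (par c x) *m (jac (X \o par c) x)^T = 0.
  move=> Ac dx; rewrite normal_part_par// -mulmxA mulmxBl mul1mx tproj_trmx ?subrr ?mulmx0//.
  exact: unit_gram.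
split; first exact: open_normal_dom.
- move=> c Ac j; have oV := open_chart_preimage c open_normal_dom.
  have CV : Ck_on j (dom c `&` par c @^-1` normal_dom) (normal_part \o par c).
    by apply: Ck_on_sub (Ck_on_normal_part j Ac) => x [].
  apply/Ck_on_mxP => // a b.
  apply: (@Ck_on_eq _ _ _ _ _ (fun x => (Num.sqrt (\sum_i normal_part (par c x) 0 i ^+ 2))^-1 *
     normal_part (par c x) a b)) => [|x _|].
  + exact: oV.
  + by rewrite [RHS]mxE.
  apply: Ck_onM => //; last exact: (Ck_on_coord a b oV CV).
  apply: Ck_onV => // [x [_ /= xO]|].
    by rewrite gt_eqF//; exact: enorm_gt0.
  apply: Ck_on_sqrt => // [x [_ /= xO]|].
    by have := enorm_gt0 xO; rewrite /enorm sqrtr_gt0.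
  apply: Ck_on_sum => // i.
  by apply: Ck_onM => //; exact: (Ck_on_coord 0 i oV CV).
- move=> p Op; have e0 := enorm_gt0 Op.
  rewrite enormE /normal_field dotZl dotZr -sqr_enorm expr2 mulKf ?gt_eqF//.
  by rewrite mulVf ?gt_eqF// sqrtr1.
- move=> c x Ac dx Ox; rewrite (jacE (open_dom c) dx (smooth_X 1 Ac)).
  by rewrite /normal_field -scalemxAl wJ// scaler0.
Qed.

End NormalField.

Lemma normal_field_exists p : exists O nu, O p /\ unit_normal_field A X O nu.
Proof.
have [k k0] := @exists_normal_basis R n (cjac (chart_at p) X p).
by exists (normal_dom k), (normal_field k); split=> //; exact: normal_field_unit.
Qed.

Definition clap c p : 'rV[R]_n.+1 := lap (X \o par c) (coord c p).

(* The divergence identity applied to the normal field [nu], which has no flux,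
   gives [<nu, lap>]; this is where the mean curvature enters. *)
Lemma clap_normal c O nu p : A c -> img c p -> O p -> unit_normal_field A X O nu ->
  clap c p = - divX c nu p *: nu p.
Proof.
move=> Ac cp Op [oO snu unu nnu].
have [dx px] := coordP cp.
pose U := dom c `&` par c @^-1` O.
have oU : open U by exact: open_chart_preimage.
have Ux : U (coord c p) by split=> //=; rewrite px.
have CFU k : Ck_on k U (X \o par c) by apply: Ck_on_sub (smooth_X k Ac) => x [].
have pFU x : U x -> posdef (gram (jac (X \o par c) x)) by move=> [dx' _]; exact: posdef_gram.
have nuJ x : U x -> nu (par c x) *m (jac (X \o par c) x)^T = 0.
  by move=> [dx' Ox]; rewrite -(jacE (open_dom c) dx' (smooth_X 1 Ac)) nnu.
have := divergence_identity oU CFU pFU Ux (snu c Ac 1%N).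
rewrite big1; last first.
  move=> k _; rewrite (@near_eq_derive _ _ _ _ (cst 0)) ?derive_cst//.
  apply: (open_near_eq oU Ux) => z Uz /=.
  transitivity ((raised (X \o par c) z *m (nu (par c z))^T) k 0).
    by rewrite [RHS]mxE; apply: eq_bigr => a _; rewrite [(nu (par c z))^T _ _]mxE.
  have -> : raised (X \o par c) z *m (nu (par c z))^T = 0; last by rewrite mxE.
  rewrite /raised -scalemxAl -mulmxA.
  have -> : jac (X \o par c) z *m (nu (par c z))^T = (nu (par c z) *m (jac (X \o par c) z)^T)^T.
    by rewrite trmx_mul trmxK.
  by rewrite nuJ// trmx0 mulmx0 scaler0.
move/esym/eqP; rewrite mulf_eq0 gt_eqF ?(vol_density_gt0 pFU Ux)//=.
rewrite /= px addrC addr_eq0 => /eqP E.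
have ln := lap_normal oU CFU pFU Ux.
have uu : dot (nu p) (nu p) = 1 by rewrite -sqr_enorm unu// expr1n.
have nJ : nu p *m (cjac c X p)^T = 0 by rewrite -{1}px; exact: nuJ.
have := normal_colinear (unit_gram_cjac Ac cp) nJ uu ln.
by rewrite dotC E.
Qed.

(** Invariance comes through [clap_normal]: in both charts the vector is [- divX nu *: nu] for one
    common normal field, and [divX] does not depend on the chart. *)
Lemma clap_change c c' p : A c -> A c' -> img c p -> img c' p -> clap c p = clap c' p.
Proof.
move=> Ac Ac' cp c'p; have [W [nu [Wp nuP]]] := normal_field_exists p.
rewrite (clap_normal Ac cp Wp nuP) (clap_normal Ac' c'p Wp nuP).
have [oW /smooth_C1_map Cnu _ _] := nuP.
by rewrite (divX_change Ac Ac' oW Wp cp c'p Cnu).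
Qed.

(** [mean_curvature] selects one value among those of all charts and local normals. Each is
    [divX nu] divided by [n], and [clap] is [- divX nu *: nu] in every chart, so the absolute value
    is determined. *)
Lemma mean_curvature_clap c p : A c -> img c p -> (0 < n)%N ->
  n%:R * `|mean_curvature A g X p| = enorm (clap c p).
Proof.
move=> Ac cp n0; rewrite /mean_curvature; set S := [set h | _].
(* The set of candidates is inhabited, so the default value 0 of [xget] does not occur. *)
have /(xgetPex 0) : exists h, S h.
  have [W [nu [Wp nuP]]] := normal_field_exists p.
  by eexists; exists c, W, nu; split=> //; reflexivity.
move=> [c' [W [nu [Ac' c'p Wp nuP ->]]]].
have [dx' px'] := coordP c'p.
have [oW snu unu nnu] := nuP.
have Cnu := smooth_C1_map snu.
have oU := open_chart_preimage c' oW.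
have Ux : (dom c' `&` par c' @^-1` W) (coord c' p) by split=> //=; rewrite px'.
have -> : \tr (invmx (g c' (coord c' p)) *m second_fundamental_form X nu c' p) = divX c' nu p.
  rewrite /second_fundamental_form (gram_metric Ac' dx').
  by rewrite (jacE oU Ux (Cnu c' Ac')) (jacE (open_dom c') dx' (smooth_X 1 Ac')).
rewrite (clap_change Ac Ac' cp c'p) (clap_normal Ac' c'p Wp nuP).
rewrite normrM normfV normr_nat mulrA mulfV ?mul1r ?pnatr_eq0 -?lt0n//.
rewrite enormE dotZl dotZr -[dot _ _]sqr_enorm unu// expr1n mulr1 -expr2 sqrtr_sqr.
by rewrite normrN.
Qed.

End ChartGeometry.

(** * Integration against the volume measure *)

Section DensityTransfer.
Local Open Scope ereal_scope.
Context d1 d2 (S : measurableType d1) (Y : measurableType d2) (R : realType).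
Variables (mu : {measure set S -> \bar R}) (nu : {measure set Y -> \bar R})
  (phi : S -> Y) (w : S -> R) (D : set Y).
Hypotheses (mphi : measurable_fun setT phi) (mw : measurable_fun setT w)
  (w0 : forall x, (0 <= w x)%R) (mD : measurable D)
  (nuE : forall B, measurable B -> B `<=` D ->
     nu B = \int[mu]_(x in phi @^-1` B) (w x)%:E).

Import HBNNSimple.

Let mphiB B : measurable B -> measurable (phi @^-1` B).
Proof. by move=> mB; rewrite -[X in measurable X]setTI; exact: mphi. Qed.

(** [nuE] is the case of indicators of subsets of [D]; summing over the values of [h] gives simple
    functions, from which monotone convergence and the splitting into positive and negative parts
    reach all measurable functions. *)
Lemma integral_density_nnsfun (h : {nnsfun Y >-> R}) :
  \int[nu]_(y in D) (h y)%:E = \int[mu]_(x in phi @^-1` D) (h (phi x) * w x)%:E.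
Proof.
have mk k : measurable (h @^-1` [set k]) by exact: measurable_funPTI.
transitivity (\sum_(k \in range h)
    \int[mu]_(x in phi @^-1` D) (k * \1_(phi @^-1` (h @^-1` [set k])) x * w x)%:E).
  under eq_integral do rewrite fimfunE -fsumEFin//.
  rewrite ge0_integral_fsum//; last 2 first.
  - by move=> y; exact/measurable_EFinP/measurable_funM.
  - by move=> y x _; rewrite nnfun_muleindic_ge0.
  apply: eq_fsbigr => k /set_mem [y _ hy].
  have k0 : (0 <= k)%R by rewrite -hy.
  rewrite integralZl_indic_nnsfun// integral_indic//= nuE; last 2 first.
  - exact: measurableI.
  - by move=> z [].
  rewrite -ge0_integralZl//; last 3 first.
  - by apply: mphiB; exact: measurableI.
  - by apply/measurable_EFinP; exact: measurable_funTS.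
  - by move=> x _; rewrite lee_fin.
  rewrite integral_mkcond [RHS]integral_mkcond; apply: eq_integral => x _.
  rewrite !patchE; case: (boolP (x \in phi @^-1` D)) => [|xD].
    rewrite inE /= => xD; case: ifPn.
      by rewrite inE /= => -[hx _]; rewrite indicE mem_set// mulr1.
    rewrite notin_setE /= => hx; rewrite indicE memNset ?mulr0 ?mul0r//.
    by move=> /= hxk; apply: hx.
  rewrite ifN//; apply: contra xD; rewrite !inE /=.
  by move=> [].
rewrite -ge0_integral_fsum//.
- apply: eq_integral => x _; rewrite fsumEFin//; congr (_%:E).
  by rewrite -mulr_fsuml//; congr (_ * _)%R; rewrite [RHS]fimfunE.
- exact: mphiB.
- move=> k; apply/measurable_EFinP; apply: measurable_funTS.
  apply: measurable_funM => //; apply: measurable_funM => //.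
  by apply: measurable_indic; exact: mphiB.
- move=> k x _; rewrite lee_fin mulr_ge0//.
  by have := nnfun_muleindic_ge0 h k (phi x); rewrite lee_fin.
Qed.

Lemma ge0_integral_density (f : Y -> R) :
  measurable_fun setT f -> (forall y, (0 <= f y)%R) ->
  \int[nu]_(y in D) (f y)%:E = \int[mu]_(x in phi @^-1` D) (f (phi x) * w x)%:E.
Proof.
move=> mf f0.
have mfD : measurable_fun D (EFin \o f) by apply/measurable_EFinP; exact: measurable_funTS.
pose f_ := nnsfun_approx mD mfD.
transitivity (limn (fun n => \int[nu]_(y in D) (f_ n y)%:E)).
  rewrite -monotone_convergence//.
  - apply: eq_integral => y /[!inE] yD; apply/esym/cvg_lim => //.
    by apply: cvg_nnsfun_approx => // z _; rewrite lee_fin.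
  - by move=> n; exact/measurable_EFinP/measurable_funP.
  - by move=> n y _; rewrite lee_fin.
  - by move=> y _ m n mn; rewrite lee_fin; exact/lefP/nd_nnsfun_approx.
have -> : (fun n => \int[nu]_(y in D) (f_ n y)%:E) =
    (fun n => \int[mu]_(x in phi @^-1` D) (f_ n (phi x) * w x)%:E).
  by apply/funext => n; exact: integral_density_nnsfun.
rewrite -monotone_convergence//.
- apply: eq_integral => x /[!inE] /= xD; apply/cvg_lim => //.
  under eq_fun do rewrite EFinM.
  rewrite EFinM; apply: cvgeZr => //.
  by apply: cvg_nnsfun_approx => // z _; rewrite lee_fin.
- exact: mphiB.
- move=> n; apply/measurable_EFinP; apply: measurable_funTS.
  by apply: measurable_funM => //; apply: measurableT_comp.
- by move=> n x _; rewrite lee_fin mulr_ge0.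
- move=> x _ m n mn; rewrite lee_fin ler_wpM2r//.
  by have /lefP := nd_nnsfun_approx mD mfD mn; exact.
Qed.

Lemma integral_density (f : Y -> R) : measurable_fun setT f ->
  \int[nu]_(y in D) (f y)%:E = \int[mu]_(x in phi @^-1` D) (f (phi x) * w x)%:E.
Proof.
move=> mf; rewrite integralE [RHS]integralE.
have Ep (T : Type) (h : T -> R) y : (fun x => (h x)%:E)^\+ y = (Num.max (h y) 0)%:E.
  by rewrite funeposE EFin_max.
have En (T : Type) (h : T -> R) y : (fun x => (h x)%:E)^\- y = (Num.max (- h y) 0)%:E.
  by rewrite funenegE EFin_max.
congr (_ - _).
- under eq_integral do rewrite Ep.
  rewrite ge0_integral_density.
  + apply: eq_integral => x _; rewrite Ep; congr (_%:E).
    by rewrite maxr_pMl// mul0r.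
  + exact: measurable_funrpos.
  + by move=> y; rewrite le_max lexx orbT.
- under eq_integral do rewrite En.
  rewrite ge0_integral_density.
  + apply: eq_integral => x _; rewrite En; congr (_%:E).
    by rewrite maxr_pMl// mul0r mulNr.
  + exact: measurable_funrneg.
  + by move=> y; rewrite le_max lexx orbT.
Qed.

End DensityTransfer.

(** * Finite covers, quadratic remainders and the squared positive part *)

Lemma compact_finite_cover (T : ptopologicalType) (W : T -> set T) :
  compact [set: T] -> (forall p, open (W p)) -> (forall p, W p p) ->
  exists s : seq T, forall q, exists2 p, p \in s & W p q.
Proof.
rewrite compact_cover => cT oW Wp.
have [|D _ cD] := cT T setT W (fun p _ => oW p); first by move=> p _; exists p.
exists (finmap.enum_fset D) => q; have [p Dp Wpq] := cD q I.
by exists p.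
Qed.

(** A quadratic remainder bound survives integration over a finite measure, so this criterion
    differentiates under the integral sign without dominated convergence. *)
Lemma is_derive_quadratic (R : realType) (f : R -> R) (t d C : R) :
  (forall h, `|f (h + t) - f t - d * h| <= C * h ^+ 2) -> is_derive t 1 f d.
Proof.
move=> Hf.
have C0 : 0 <= C by have := le_trans (normr_ge0 _) (Hf 1); rewrite expr1n mulr1.
have H : (fun h : R => h^-1 *: ((f \o shift t) (h *: 1) - f t)) @ 0^' --> d.
  apply/cvgrPdist_le => e e0; near=> h.
  have h0 : h != 0 by near: h; exact: nbhs_dnbhs_neq.
  rewrite /= -[X in X - _](mulKf h0) -[h^-1 *: _]/(h^-1 * _) -mulrBr normrM normfV.
  rewrite ler_pdivrMl ?normr_gt0// distrC [h *: 1]mulr1 [h * d]mulrC.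
  apply: le_trans (Hf h) _.
  rewrite -real_normK ?num_real// expr2 mulrA [X in _ <= X]mulrC ler_wpM2r//.
  apply: (@le_trans _ _ ((1 + C) * `|h|)); first by rewrite ler_wpM2r// lerDr.
  rewrite mulrC -ler_pdivlMr; last by rewrite ltr_pwDl.
  by near: h; apply: dnbhs0_le; rewrite divr_gt0// ltr_pwDl.
split; first by apply/cvg_ex; exists d.
exact/cvg_lim.
Unshelve. all: by end_near. Qed.

Section SquaredPositivePart.
Context {R : realType}.

(** C^1 with Taylor remainder at most [h ^ 2], uniformly in [t]. It serves both as the radial
    cut-off and in the bump functions that localize fields to charts. *)
Definition relu2 (t : R) : R := Num.max t 0 ^+ 2.

Lemma relu2_ge0 t : 0 <= relu2 t.
Proof. exact: sqr_ge0. Qed.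

Lemma relu2_le0 t : t <= 0 -> relu2 t = 0.
Proof. by move=> t0; rewrite /relu2 max_r// expr0n. Qed.

Lemma relu2_gt0 t : 0 < t -> 0 < relu2 t.
Proof. by move=> t0; rewrite /relu2 max_l ?exprn_gt0// ltW. Qed.

Lemma relu2_increment t h : `|relu2 (h + t) - relu2 t - 2 * Num.max t 0 * h| <= h ^+ 2.
Proof.
rewrite /relu2; have [t0|t0] := leP t 0; have [ht|ht] := leP (h + t) 0.
- by rewrite !mulr0 !mul0r expr0n !subr0 normr0 sqr_ge0.
- by rewrite mulr0 mul0r expr0n /= !subr0 ger0_norm ?sqr_ge0//; nra.
- by rewrite expr0n /= sub0r ler_norml; apply/andP; split; nra.
- by rewrite ler_norml; apply/andP; split; nra.
Qed.

Lemma is_derive_relu2 (t : R) : is_derive t 1 relu2 (2 * Num.max t 0).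
Proof.
by apply: (@is_derive_quadratic _ _ _ _ 1) => h; rewrite mul1r; exact: relu2_increment.
Qed.

Lemma continuous_relu2' : continuous (fun t : R => 2 * Num.max t 0).
Proof.
move=> t; apply: cvgMl_tmp.
have c1 : {for t, continuous (fun x : R => x)} by exact: cvg_id.
have c2 : {for t, continuous (cst (0 : R))} by exact: cvg_cst.
exact: (@continuous_max R R (fun x : R => x) (cst 0) t c1 c2).
Qed.

Lemma continuous_one_subM (t : R) : continuous (fun x : R => 1 - t * x).
Proof.
by move=> x; apply: cvgB; [exact: cvg_cst|apply: cvgM; [exact: cvg_cst|exact: cvg_id]].
Qed.

End SquaredPositivePart.

Section ExtendByConstant.

(** Chart maps take arbitrary values outside their open domains; replacing these by a constant
    restores Borel measurability on the whole space. *)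
Lemma measurable_extend (S T : ptopologicalType) (U : set S) (f : S -> T) (y : T) :
  open U -> (forall x, U x -> {for x, continuous f}) ->
  measurable_fun (T := borel S) (U := borel T) setT
    (fun x => if x \in U then f x else y).
Proof.
move=> oU cf; apply: (@measurability _ _ (borel S) (borel T) setT _ (@open T) erefl).
move=> _ [V oV <-]; rewrite setTI.
have oUV : open (U `&` f @^-1` V).
  rewrite openE => x [Ux Vfx]; apply: filterI; first exact: open_nbhs_nbhs.
  by apply: (cf x Ux); exact: open_nbhs_nbhs.
have -> : (fun x => if x \in U then f x else y) @^-1` V =
    (U `&` f @^-1` V) `|` (~` U `&` [set x | V y]).
  apply/seteqP; split=> x /=.
    by case: (boolP (x \in U)); rewrite ?inE ?notin_setE; [left|right].
  by move=> [[Ux Vx]|[Ux Vx]]; [rewrite mem_set|rewrite memNset].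
apply: measurableU; first exact: open_measurable_borel.
apply: measurableI; first by apply: measurableC; exact: open_measurable_borel.
have [Vy|Vy] := pselect (V y).
  by rewrite (_ : [set _ | _] = setT)//; apply/seteqP; split.
by rewrite (_ : [set _ | _] = set0)//; apply/seteqP; split.
Qed.

Lemma measurable_extend_real (R : realType) (S : ptopologicalType) (U : set S) (f : S -> R) (y : R) :
  open U -> (forall x, U x -> {for x, continuous f}) ->
  measurable_fun (T := borel S) (U := R) setT (fun x => if x \in U then f x else y).
Proof.
move=> oU cf.
have mid : measurable_fun (T := borel R) (U := R) setT (fun x => x).
  by apply: continuous_measurable_borel => x.
exact: (measurableT_comp mid (measurable_extend y oU cf)).
Qed.

End ExtendByConstant.

Section VolumeMeasure.
Context {R : realType} {n : nat} {M : ptopologicalType}.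
Variables (A : set (chart R n M)) (g : chart R n M -> 'rV[R]_n -> 'M[R]_n)
  (X : M -> 'rV[R]_n.+1) (dv : {measure set (borel M) -> \bar R}).
Hypotheses (closedM : closed_manifold A) (metric_g : riemannian_metric A g)
  (volM : volume_measure A g dv) (immX : isometric_immersion A g X).

Lemma atlas_closed : smooth_atlas A.
Proof. by case: closedM. Qed.

Let atlasA := atlas_closed.

Lemma open_img_preimage (c : chart R n M) (V : set 'rV[R]_n) :
  open V -> open (img c `&` coord c @^-1` V).
Proof.
move=> oV; rewrite openE => p [cp Vp]; apply: filterI.
  by apply: open_nbhs_nbhs; split=> //; exact: img_open.
by apply: (coord_cont cp); exact: open_nbhs_nbhs.
Qed.

(* On [img c], [dv] is the image under [chart_map c] of [chart_density c] dx. *)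
Definition chart_map (c : chart R n M) (x : 'rV[R]_n) : M :=
  if x \in dom c then par c x else point.

Definition chart_density (c : chart R n M) (x : 'rV[R]_n) : R :=
  if x \in dom c then vol_density (X \o par c) x else 0.

Lemma measurable_chart_map c :
  measurable_fun (T := borel 'rV[R]_n) (U := borel M) setT (chart_map c).
Proof. by apply: measurable_extend; [exact: dom_open|exact: par_cont]. Qed.

Lemma cont_vol_density c x : A c -> dom c x ->
  {for x, continuous (vol_density (X \o par c))}.
Proof.
move=> Ac dx.
have := @Ck_on_vol_density R n n.+1 (dom c) (X \o par c) (@dom_open _ _ _ c)
  (fun k => smooth_X immX k Ac) (fun x dx => posdef_gram metric_g immX Ac dx) 0.
by move=> /Ck_on_continuous; apply.
Qed.

Lemma measurable_chart_density c : A c ->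
  measurable_fun (T := borel 'rV[R]_n) (U := R) setT (chart_density c).
Proof.
move=> Ac; apply: measurable_extend_real; first exact: dom_open.
by move=> x; exact: cont_vol_density.
Qed.

Lemma chart_density_ge0 c x : 0 <= chart_density c x.
Proof. by rewrite /chart_density; case: ifP => // _; exact: sqrtr_ge0. Qed.

Lemma dv_chart c (B : set (borel M)) : A c -> measurable B -> B `<=` img c ->
  dv B = (\int[leb n]_(x in chart_map c @^-1` B) (chart_density c x)%:E)%E.
Proof.
move=> Ac mB Bc; rewrite (volM Ac mB Bc) lebE integral_mkcond [RHS]integral_mkcond.
apply: eq_integral => x _; rewrite !patchE /chart_density.
have [dx|dx] := boolP (x \in dom c); last first.
  rewrite ifN; first by case: ifP.
  by apply: contra dx; rewrite !inE => -[].
have -> : (x \in dom c `&` par c @^-1` B) = (x \in chart_map c @^-1` B).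
  apply/idP/idP; rewrite !inE /= /chart_map dx; first by case.
  by move=> Bx; split=> //; move: dx; rewrite inE.
by rewrite (gram_metric immX Ac)//; move: dx; rewrite inE.
Qed.

Lemma integral_chart c (f : M -> R) : A c ->
  measurable_fun (T := borel M) (U := R) setT f ->
  (\int[dv]_(p in img c) (f p)%:E =
   \int[leb n]_x (f (chart_map c x) * chart_density c x)%:E)%E.
Proof.
move=> Ac mf.
rewrite (@integral_density _ _ _ _ R (leb n) dv (chart_map c) (chart_density c)) => //.
- rewrite integral_mkcond; apply: eq_integral => x _; rewrite patchE.
  case: ifPn => // cx; rewrite /chart_density ifN ?mulr0//.
  apply: contra cx; rewrite !inE /= => dx; rewrite /chart_map mem_set//.
  exact: (parP dx).1.
- exact: measurable_chart_map.
- exact: measurable_chart_density.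
- exact: chart_density_ge0.
- by apply: open_measurable_borel; exact: img_open.
- by move=> B mB Bc; exact: dv_chart.
Qed.

(** Around each point the density is at most [v + 1] on a bounded coordinate ball, which lies in a
    cube of finite measure; compactness extracts a finite cover. *)
Lemma dv_finite : (dv setT < +oo)%E.
Proof.
have [_ cM _] := closedM.
have H (p : M) : exists W : set M, [/\ open W, W p & (dv W < +oo)%E].
  pose c := chart_at atlasA p.
  have Ac : A c by exact: chart_at_A.
  have cp : img c p by exact: chart_at_img.
  have [dx px] := coordP cp; pose x0 := coord c p; pose v := vol_density (X \o par c) x0.
  have : nbhs x0 (dom c `&` [set x | vol_density (X \o par c) x <= v + 1]).
    apply: filterI; first by apply: open_nbhs_nbhs; split=> //; exact: dom_open.
    have cv : vol_density (X \o par c) x @[x --> x0] --> v := cont_vol_density Ac dx.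
    by apply: (cvgr_le v cv); rewrite ltrDl.
  rewrite -nbhs_ballE => -[r /= r0 rU].
  exists (img c `&` coord c @^-1` (ball x0 r)); split.
  - by apply: open_img_preimage; exact: ball_open.
  - by split=> //; exact: ballxx.
  have mW : measurable ((img c `&` coord c @^-1` (ball x0 r)) : set (borel M)).
    by apply: open_measurable_borel; apply: open_img_preimage; exact: ball_open.
  rewrite (dv_chart Ac mW); last by move=> q [].
  have mP : measurable (chart_map c @^-1` (img c `&` coord c @^-1` (ball x0 r)) : set (borel 'rV[R]_n)).
    rewrite -[X in measurable X]setTI; exact: measurable_chart_map.
  have mC : measurable (cube (`|x0| + r) : set (borel 'rV[R]_n)) by exact: measurable_cube.
  have v0 : 0 <= v + 1 by rewrite addr_ge0// sqrtr_ge0.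
  apply: (@le_lt_trans _ _ (\int[leb n]_(x in cube (`|x0| + r)) (v + 1)%:E)%E); last first.
    by rewrite integral_cst// lte_mul_pinfty ?lee_fin//; exact: cube_finite.
  rewrite integral_mkcond [leRHS]integral_mkcond; apply: ge0_le_integral => //.
  - by move=> x _; rewrite patchE; case: ifP => // _; rewrite lee_fin chart_density_ge0.
  - apply/(measurable_restrictT _ mP); apply: measurable_funTS.
    by apply/measurable_EFinP; exact: measurable_chart_density.
  - by apply/(measurable_restrictT _ mC).
  move=> x _; rewrite !patchE.
  have [|_] := boolP (x \in chart_map _ @^-1` _); last first.
    by case: ifP => // _; rewrite lee_fin.
  rewrite inE /= /chart_map /chart_density.
  case: (boolP (x \in dom c)) => [|_ _]; last by case: ifP => // _; rewrite lee_fin.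
  rewrite inE => dx' [_]; rewrite (parP dx').2 => bx.
  rewrite mem_set; first by rewrite lee_fin; exact: (rU x bx).2.
  move=> i; rewrite in_itv /= -ler_norml.
  apply: le_trans (rV_coord_le x i) _.
  rewrite -[x](subrK x0) addrC (le_trans (ler_normD _ _))// lerD2l.
  by move: bx; rewrite ball_distE distrC => /ltW.
pose W p := sval (cid (H p)).
have WP p : [/\ open (W p), W p p & (dv (W p) < +oo)%E] by exact: svalP (cid (H p)).
have [s sP] : exists s : seq M, forall q, exists2 p, p \in s & W p q.
  by apply: compact_finite_cover => // p; have [] := WP p.
have {}sP : [set: M] `<=` \big[setU/set0]_(p <- s) W p.
  move=> q _; have [p ps Wq] := sP q; rewrite -bigcup_seq; by exists p.
have mW p : measurable (W p : set (borel M)).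
  by apply: open_measurable_borel; have [] := WP p.
have mB : measurable (\big[setU/set0]_(p <- s) W p : set (borel M)).
  by apply: bigsetU_measurable => p _; exact: mW.
apply: (@le_lt_trans _ _ (dv (\big[setU/set0]_(p <- s) W p))).
  by apply: le_measure; rewrite ?inE.
elim: s {sP mB} => [|p s IH]; first by rewrite big_nil measure0.
rewrite big_cons; apply: (le_lt_trans (measureU2 _ _ _)).
- exact: mW.
- by apply: bigsetU_measurable => ? _; exact: mW.
- by rewrite lte_add_pinfty//; have [] := WP p.
Qed.

End VolumeMeasure.

(** * Cut-off functions supported in charts *)

Lemma Ck_on_setU (R : realType) (V W : normedModType R) k (U U' : set V) (f : V -> W) :
  Ck_on k U f -> Ck_on k U' f -> Ck_on k (U `|` U') f.
Proof.
elim: k f => [|k IH] f [cf df] [cf' df']; split=> //; try by move=> x [|]; auto.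
move=> v; have [d1 d2] := df v; have [d1' d2'] := df' v.
by split; [move=> x []; auto|exact: IH].
Qed.

Section SquaredDistance.
Context {R : realType} {n : nat}.
Implicit Types (x : 'rV[R]_n).

(** Polynomial in the coordinates, hence smooth, unlike the sup norm that gives the topology. *)
Definition sqdist x0 x : R := \sum_i (x 0 i - x0 0 i) ^+ 2.

Lemma sqdistxx x : sqdist x x = 0.
Proof. by rewrite /sqdist big1// => i _; rewrite subrr expr0n. Qed.

Lemma Ck_on_sqdist (V : normedModType R) k (U : set V) (F : V -> 'rV[R]_n) x0 :
  open U -> Ck_on k U F -> Ck_on k U (fun v => sqdist x0 (F v)).
Proof.
move=> oU CF; apply: Ck_on_sum => // i.
have Ci : Ck_on k U (fun v => F v 0 i - cst (x0 0 i) v).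
  by apply: Ck_onB => //; [exact: Ck_on_coord|exact: Ck_on_cst].
exact: Ck_onM.
Qed.

Lemma sqdist_le_norm x0 x (r : R) : 0 <= r -> sqdist x0 x <= r ^+ 2 -> `|x - x0| <= r.
Proof.
move=> r0 xr; apply: rV_norm_le => // i.
rewrite -(@ler_pXn2r _ 2)// ?nnegrE// real_normK ?num_real//.
apply: le_trans xr; rewrite /sqdist (bigD1 i)//= 2!mxE lerDl.
by apply: sumr_ge0 => j _; exact: sqr_ge0.
Qed.

Lemma closed_sqdist x0 (r : R) : closed [set x | sqdist x0 x <= r].
Proof.
have cs : continuous (fun x => sqdist x0 x).
  move=> x; apply: (@Ck_on_continuous _ _ _ 0 setT) => //.
  by apply: Ck_on_sqdist => //; [exact: openT|split=> // y _; exact: cvg_id].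
have -> : [set x | sqdist x0 x <= r] = sqdist x0 @^-1` [set t | t <= r] by [].
by move: cs => /continuous_closedP; apply; exact: closed_le.
Qed.

Lemma cube_norm x0 (r : R) : [set x | `|x - x0| <= r] `<=` cube (`|x0| + r).
Proof.
move=> x xr i; rewrite in_itv /= -ler_norml.
apply: le_trans (rV_coord_le x i) _.
by rewrite -[x](subrK x0) addrC (le_trans (ler_normD _ _))// lerD2l.
Qed.

Lemma compact_sqdist x0 (r : R) : 0 <= r -> compact [set x | sqdist x0 x <= r ^+ 2].
Proof.
move=> r0; apply: (subclosed_compact _ (@compact_cube R n (`|x0| + r))).
  exact: closed_sqdist.
by move=> x /= xr; apply: cube_norm; exact: sqdist_le_norm.
Qed.

End SquaredDistance.

Section MapsOnManifold.
Context {R : realType} {n : nat} {M : ptopologicalType}.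
Variable (A : set (chart R n M)).
Hypothesis (atlasA : smooth_atlas A).

Lemma chart_continuous (T : topologicalType) (f : M -> T) :
  (forall c x, A c -> dom c x -> {for x, continuous (f \o par c)}) -> continuous f.
Proof.
move=> cf p; pose c := chart_at atlasA p.
have Ac : A c by exact: chart_at_A.
have cp : img c p by exact: chart_at_img.
have [dx px] := coordP cp.
have H : {for p, continuous ((f \o par c) \o coord c)}.
  by apply: continuous_comp; [exact: coord_cont|exact: cf].
have E : \forall q \near p, ((f \o par c) \o coord c) q = f q.
  apply: filterS (open_nbhs_nbhs (conj (@img_open _ _ _ c) cp)) => q cq.
  by rewrite /=; have [_ ->] := coordP cq.
have fE : ((f \o par c) \o coord c) p = f p by rewrite /= px.
rewrite /prop_for /continuous_at -fE.
apply: cvg_trans H; apply: near_eq_cvg.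
by apply: filterS E => q ->.
Qed.

Lemma C1_map_continuous (W : normedModType R) (f : M -> W) : C1_map A setT f -> continuous f.
Proof.
move=> Cf; apply: chart_continuous => c x Ac dx.
by apply: (Ck_on_continuous (Cf c Ac)).
Qed.

Lemma C1_map_dom (W : normedModType R) (f : M -> W) c :
  C1_map A setT f -> A c -> Ck_on 1 (dom c) (f \o par c).
Proof. by move=> Cf Ac; apply: Ck_on_sub (Cf c Ac) => x. Qed.

Lemma C1_mapI (W : normedModType R) (f : M -> W) :
  (forall c, A c -> Ck_on 1 (dom c) (f \o par c)) -> C1_map A setT f.
Proof. by move=> Cf c Ac; apply: Ck_on_sub (Cf c Ac) => x []. Qed.

Lemma C1_mapZ m (psi : M -> R) (Z : M -> 'rV[R]_m) :
  C1_map A setT psi -> C1_map A setT Z -> C1_map A setT (fun p => psi p *: Z p).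
Proof.
move=> Cp CZ; apply: C1_mapI => c Ac; have oc := @dom_open _ _ _ c.
apply/Ck_on_mxP => // i j.
apply: (@Ck_on_eq _ _ _ _ _ (fun x => psi (par c x) * Z (par c x) i j)) => // [x _|].
  by rewrite /= mxE.
apply: Ck_onM => //; first exact: (C1_map_dom Cp Ac).
exact: (Ck_on_coord i j oc (C1_map_dom CZ Ac)).
Qed.

Lemma C1_mapV (psi : M -> R) : (forall p, psi p != 0) ->
  C1_map A setT psi -> C1_map A setT (fun p => (psi p)^-1).
Proof.
move=> p0 Cp; apply: C1_mapI => c Ac.
by apply: Ck_onV; [exact: dom_open|move=> x _; exact: p0|exact: (C1_map_dom Cp Ac)].
Qed.

Lemma C1_map_sum (I : Type) (W : normedModType R) (s : seq I) (f : I -> M -> W) :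
  (forall i, C1_map A setT (f i)) -> C1_map A setT (fun p => \sum_(i <- s) f i p).
Proof.
move=> Cf; apply: C1_mapI => c Ac; apply: Ck_on_sum; first exact: dom_open.
by move=> i; exact: (C1_map_dom (Cf i) Ac).
Qed.

Hypothesis hM : hausdorff_space M.

(** A compact subset of a Hausdorff space. Closedness is what lets functions supported in [K] be
    extended by zero across the edge of the chart without losing regularity. *)
Lemma closed_chart_image (c : chart R n M) (K : set 'rV[R]_n) : compact K -> K `<=` dom c ->
  closed [set q | img c q /\ K (coord c q)].
Proof.
move=> cK Kc; have -> : [set q | img c q /\ K (coord c q)] = par c @` K.
  apply/seteqP; split=> [q [cq Kq]|_ [x Kx <-]].
    by exists (coord c q) => //; have [] := coordP cq.
  by have [ix xx] := parP (Kc x Kx); split=> //=; rewrite xx.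
apply: compact_closed => //; apply: continuous_compact => //.
by apply: continuous_in_subspaceT => x /[!inE] /Kc; exact: par_cont.
Qed.

(** [psi] is [relu2] of a quadratic function of the coordinates of [c]. In another chart its
    regularity is checked on two open sets: where [c] is defined, and off the closed image of [K],
    where [psi] vanishes. *)
Lemma bump_exists p : exists (psi : M -> R) (c : chart R n M) (K : set 'rV[R]_n) (r : R),
  [/\ A c, compact K, K `<=` dom c & K `<=` cube r] /\
  [/\ forall q, ~ (img c q /\ K (coord c q)) -> psi q = 0, forall q, 0 <= psi q,
      0 < psi p & C1_map A setT psi].
Proof.
pose c := chart_at atlasA p.
have Ac : A c by exact: chart_at_A.
have cp : img c p by exact: chart_at_img.
have [dx px] := coordP cp; pose x0 := coord c p.
have : nbhs x0 (dom c) by apply: open_nbhs_nbhs; split=> //; exact: dom_open.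
rewrite -nbhs_ballE => -[r /= r0 rU].
have r20 : 0 < r / 2 by rewrite divr_gt0.
pose K := [set x | sqdist x0 x <= (r / 2) ^+ 2].
have cK : compact K by apply: compact_sqdist; exact: ltW.
have Kc : K `<=` dom c.
  move=> x /= /(sqdist_le_norm (ltW r20)) xr; apply: rU; rewrite ball_distE distrC.
  by apply: le_lt_trans xr _; rewrite ltr_pdivrMr// ltr_pMr// ltrDl.
pose psi q := if q \in img c then relu2 ((r / 2) ^+ 2 - sqdist x0 (coord c q)) else 0.
have psi0 q : ~ (img c q /\ K (coord c q)) -> psi q = 0.
  move=> H; rewrite /psi; case: ifPn => // /[!inE] cq; apply: relu2_le0.
  by rewrite subr_le0 leNgt; apply/negP => /ltW Kq; apply: H.
exists psi, c, K, (`|x0| + r / 2); split; split=> //.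
- by move=> x /= /(sqdist_le_norm (ltW r20)); exact: cube_norm.
- by move=> q; rewrite /psi; case: ifP => // _; exact: relu2_ge0.
- by rewrite /psi mem_set// sqdistxx subr0 relu2_gt0// exprn_gt0.
apply: C1_mapI => c' Ac'.
pose V1 := dom c' `&` par c' @^-1` img c.
pose V2 := dom c' `&` par c' @^-1` (~` [set q | img c q /\ K (coord c q)]).
have oV1 : open V1 by apply: open_chart_preimage; exact: img_open.
have oV2 : open V2.
  by apply: open_chart_preimage; apply: closed_openC; exact: closed_chart_image.
have -> : dom c' = V1 `|` V2.
  apply/seteqP; split=> [x dx'|x [[]|[]]//].
  by have [ix|ix] := pselect (img c (par c' x)); [left|right; split=> // -[]].
apply: Ck_on_setU.
  apply: (@Ck_on_eq _ _ _ _ _ (relu2 \o (fun x => cst ((r / 2) ^+ 2) x - sqdist x0 ((coord c \o par c') x)))) => //.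
    by move=> x [_ /= cx]; rewrite /psi mem_set.
  apply: Ck_on_comp1 => //; [exact: is_derive_relu2|exact: continuous_relu2'|].
  apply: Ck_onB => //; first exact: Ck_on_cst.
  by apply: Ck_on_sqdist => //; exact: atlasA.2.
apply: (@Ck_on_eq _ _ _ _ _ (cst 0)) => //; last exact: Ck_on_cst.
by move=> x [_ /= Kx]; rewrite psi0.
Qed.

End MapsOnManifold.

(** * The divergence theorem and the first variation *)

Lemma jacD (R : realType) (n m : nat) (U : set 'rV[R]_n) (F G : 'rV[R]_n -> 'rV[R]_m) x :
  open U -> U x -> Ck_on 1 U F -> Ck_on 1 U G ->
  jac (fun y => F y + G y) x = jac F x + jac G x.
Proof.
move=> oU Ux CF CG; apply/matrixP => i a; rewrite [LHS]mxE [RHS]mxE.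
have dF := is_derive_coord i a oU Ux CF; have dG := is_derive_coord i a oU Ux CG.
have -> : (fun y => (F y + G y) 0 a) = (fun y => F y 0 a) + (fun y => G y 0 a).
  by apply/funext => y; rewrite mxE.
by rewrite (@derive_val _ _ _ _ _ _ _ (is_deriveD dF dG)).
Qed.

Section DivergenceTheorem.
Context {R : realType} {n : nat} {M : ptopologicalType}.
Variables (A : set (chart R n M)) (g : chart R n M -> 'rV[R]_n -> 'M[R]_n)
  (X : M -> 'rV[R]_n.+1) (dv : {measure set (borel M) -> \bar R}).
Hypotheses (closedM : closed_manifold A) (metric_g : riemannian_metric A g)
  (volM : volume_measure A g dv) (immX : isometric_immersion A g X).

Let atlasA := atlas_closed closedM.

Local Notation D i f := ('D_(delta_mx 0 i : 'rV[R]_n) f).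

Lemma continuous_bounded (f : M -> R) : continuous f -> exists K, forall p, `|f p| <= K.
Proof.
move=> cf; have [_ cM _] := closedM.
have [|p _ pP] := @compact_EVT_max _ R (fun q => `|f q|) setT (ex_intro _ point I) cM.
- apply: continuous_subspaceT => q.
  by apply: continuous_comp; [exact: cf|exact: norm_continuous].
by exists `|f p| => q; apply: pP; rewrite inE.
Qed.

Lemma continuous_integrable (f : M -> R) : continuous f ->
  dv.-integrable setT (EFin \o f).
Proof.
move=> cf; apply: measurable_bounded_integrable => //.
- exact: dv_finite closedM metric_g volM immX.
- exact: continuous_measurable_borel.
have [K fK] := continuous_bounded cf.
exists K; split=> [|x Kx p _]; first exact: num_real.
by apply: le_trans (fK p) _; exact: ltW.
Qed.

(** The divergence of the tangential part of [Y], in the form given by [divergence_identity]; the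
    choice of a chart at [p] is immaterial for C^1 fields by [tangential_divE]. *)
Definition tangential_div (Y : M -> 'rV[R]_n.+1) p : R :=
  divX X (chart_at atlasA p) Y p + dot (Y p) (clap X (chart_at atlasA p) p).

Lemma tangential_divE c (Y : M -> 'rV[R]_n.+1) p : A c -> img c p -> C1_map A setT Y ->
  tangential_div Y p = divX X c Y p + dot (Y p) (clap X c p).
Proof.
move=> Ac cp CY; rewrite /tangential_div.
have Acp := chart_at_A atlasA p; have icp := chart_at_img atlasA p.
by rewrite (divX_change atlasA metric_g immX Acp Ac openT I icp cp CY)
  (clap_change atlasA metric_g immX Acp Ac icp cp).
Qed.

Definition flux (c : chart R n M) (Y : M -> 'rV[R]_n.+1) k x : R :=
  \sum_a raised (X \o par c) x k a * Y (par c x) 0 a.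

Lemma Ck_on_flux (c : chart R n M) (Y : M -> 'rV[R]_n.+1) k : A c -> C1_map A setT Y ->
  Ck_on 1 (dom c) (flux c Y k).
Proof.
move=> Ac CY; have oc := @dom_open _ _ _ c.
apply: Ck_on_sum => // a; apply: Ck_onM => //.
  apply: Ck_on_raised_coord => //; first by move=> j; exact: (smooth_X immX).
  by move=> x dx; exact: (posdef_gram metric_g immX).
exact: (Ck_on_coord 0 a oc (C1_map_dom CY Ac)).
Qed.

Lemma sum_derive_flux (c : chart R n M) (Y : M -> 'rV[R]_n.+1) x : A c -> dom c x -> C1_map A setT Y ->
  \sum_k D k (flux c Y k) x = vol_density (X \o par c) x * tangential_div Y (par c x).
Proof.
move=> Ac dx CY; have [cx px] := parP dx.
rewrite (tangential_divE Ac cx CY) /divX /div /cjac /clap px.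
exact: (divergence_identity (@dom_open _ _ _ c) (fun k => smooth_X immX k Ac)
  (fun y dy => posdef_gram metric_g immX Ac dy) dx (C1_map_dom CY Ac)).
Qed.

Lemma continuous_tangential_div (Y : M -> 'rV[R]_n.+1) : C1_map A setT Y ->
  continuous (tangential_div Y).
Proof.
move=> CY; apply: (chart_continuous atlasA) => c x Ac dx.
have oc := @dom_open _ _ _ c.
have pd y (dy : dom c y) := posdef_gram metric_g immX Ac dy.
have CX k := smooth_X immX k Ac.
apply: (@Ck_on_continuous _ _ _ 0 (dom c)) => //.
apply: (@Ck_on_eq _ _ _ _ _ (fun y => (vol_density (X \o par c) y)^-1 * \sum_k D k (flux c Y k) y)) => //.
  move=> y dy /=; rewrite sum_derive_flux// mulKf//.
  by rewrite gt_eqF// (vol_density_gt0 pd dy).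
apply: Ck_onM => //.
  apply: Ck_onV => //; last exact: (Ck_on_vol_density oc CX pd).
  by move=> y dy; rewrite gt_eqF// (vol_density_gt0 pd dy).
by apply: Ck_on_sum => // k; apply: Ck_on_derive; exact: Ck_on_flux.
Qed.

Lemma tangential_div0 (Y : M -> 'rV[R]_n.+1) (W : set M) p :
  open W -> W p -> (forall q, W q -> Y q = 0) -> tangential_div Y p = 0.
Proof.
move=> oW Wp Y0; rewrite /tangential_div Y0// dot0l addr0 /divX /div.
suff -> : cjac (chart_at atlasA p) Y p = 0 by rewrite mul0mx mulmx0 mxtrace0.
set c := chart_at _ _; have cp : img c p by exact: chart_at_img.
have [dx px] := coordP cp.
have oU := open_chart_preimage (c := c) oW.
have Ux : (dom c `&` par c @^-1` W) (coord c p) by split=> //=; rewrite px.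
apply/matrixP => i a; rewrite [LHS]mxE [RHS]mxE.
rewrite (@near_eq_derive _ _ _ _ (cst 0)) ?derive_cst//.
by apply: (open_near_eq oU Ux) => y [_ /= Wy]; rewrite Y0// mxE.
Qed.

Lemma tangential_divD (Y Z : M -> 'rV[R]_n.+1) p : C1_map A setT Y -> C1_map A setT Z ->
  tangential_div (fun q => Y q + Z q) p = tangential_div Y p + tangential_div Z p.
Proof.
move=> CY CZ; rewrite /tangential_div /divX /div dotDl.
set c := chart_at _ _.
have Ac : A c by exact: chart_at_A.
have cp : img c p by exact: chart_at_img.
have [dx px] := coordP cp.
have -> : cjac c (fun q => Y q + Z q) p = cjac c Y p + cjac c Z p.
  exact: (jacD (@dom_open _ _ _ c) dx (C1_map_dom CY Ac) (C1_map_dom CZ Ac)).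
by rewrite mulmxDl mulmxDr mxtraceD addrACA.
Qed.

(** In the chart [c], density times divergence is a sum of partial derivatives of the components of
    the flux; these have compact support, so each term integrates to 0. *)
Lemma integral_div_bump c (K : set 'rV[R]_n) (r : R) (Y : M -> 'rV[R]_n.+1) :
  A c -> compact K -> K `<=` dom c -> K `<=` cube r -> C1_map A setT Y ->
  (forall q, ~ (img c q /\ K (coord c q)) -> Y q = 0) ->
  (\int[dv]_p (tangential_div Y p)%:E = 0)%E.
Proof.
move=> Ac cK Kc Kr CY Y0.
have hM : hausdorff_space M by case: closedM.
pose N := ~` [set q | img c q /\ K (coord c q)].
have oN : open N by apply: closed_openC; exact: (closed_chart_image hM cK Kc).
have oK : open (~` K).
  by apply: closed_openC; apply: compact_closed => //; exact: norm_hausdorff.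
(* The flux extended by zero: of class C^1 on R^n, since [dom c] and the complement of [K] form an
   open cover. *)
pose W k x : R := if x \in dom c then flux c Y k x else 0.
have W0 k x : ~ K x -> W k x = 0.
  move=> Kx; rewrite /W; case: ifPn => // /[!inE] dx.
  have [cx px] := parP dx.
  rewrite /flux big1// => a _; rewrite Y0 ?mxE ?mulr0//.
  by rewrite px => -[_].
have CW k : Ck_on 1 setT (W k).
  have -> : [set: 'rV[R]_n] = dom c `|` ~` K.
    apply/seteqP; split=> // x _.
    by have [Kx|Kx] := pselect (K x); [left; exact: Kc|right].
  apply: Ck_on_setU.
    apply: (@Ck_on_eq _ _ _ _ _ (flux c Y k)); first exact: dom_open.
      by move=> x dx; rewrite /W mem_set.
    exact: Ck_on_flux.
  apply: (@Ck_on_eq _ _ _ _ _ (cst 0)) => //; last exact: Ck_on_cst.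
  by move=> x Kx; rewrite W0.
have DW0 k x : ~ K x -> D k (W k) x = 0.
  move=> Kx; rewrite (@near_eq_derive _ _ _ _ (cst 0)) ?derive_cst//.
  by apply: (open_near_eq oK Kx) => y; exact: W0.
transitivity (\int[dv]_(p in img c) (tangential_div Y p)%:E)%E.
  rewrite [RHS]integral_mkcond; apply: eq_integral => p _; rewrite patchE.
  case: ifPn => //; rewrite notin_setE => cp.
  by rewrite (@tangential_div0 _ N)// => -[].
rewrite (integral_chart metric_g volM immX Ac); last first.
  by apply: continuous_measurable_borel; exact: continuous_tangential_div.
transitivity (\int[leb n]_x (\sum_k (D k (W k) x)%:E))%E.
  apply: eq_integral => x _; rewrite sumEFin; congr (_%:E).
  rewrite /chart_map /chart_density; case: ifPn => [/[!inE] dx|].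
    rewrite mulrC -sum_derive_flux//; apply: eq_bigr => k _.
    apply: near_eq_derive; apply: (open_near_eq (@dom_open _ _ _ c) dx) => y dy.
    by rewrite /W mem_set.
  rewrite notin_setE mulr0 => dx; rewrite big1// => k _.
  by apply: DW0 => /Kc.
rewrite integral_sum//.
  by rewrite big1// => k _; apply: (@integral_partial_eq0 _ _ _ r) => // x xr; apply: W0 => /Kr.
move=> k; apply: (@integrable_compact_support _ _ _ r).
  by move=> x; apply: (Ck_on_continuous (Ck_on_derive _ (CW k))).
by move=> x xr; apply: DW0 => /Kr.
Qed.

(** Compactness gives finitely many bumps with positive sum [Psi], and the localization then needs
    only the additivity of the divergence in the field. *)
Lemma integral_tangential_div (Y : M -> 'rV[R]_n.+1) : C1_map A setT Y ->
  (\int[dv]_p (tangential_div Y p)%:E = 0)%E.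
Proof.
move=> CY; have [hM cM _] := closedM.
pose psi p := sval (cid (bump_exists atlasA hM p)).
have psiP p := svalP (cid (bump_exists atlasA hM p)).
rewrite -/(psi _) in psiP.
have cpsi p : continuous (psi p).
  have [? [? [? [_ [_ _ _ CP]]]]] := psiP p.
  exact: (C1_map_continuous atlasA CP).
have Cpsi p : C1_map A setT (psi p) by have [? [? [? [_ []]]]] := psiP p.
have psi0 p q : 0 <= psi p q by have [? [? [? [_ [_ H _ _]]]]] := psiP p; exact: H.
have [s sP] : exists s : seq M, forall q, exists2 p, p \in s & 0 < psi p q.
  apply: (@compact_finite_cover M (fun p => [set q | 0 < psi p q])) => // [p|p].
    have -> : [set q | 0 < psi p q] = psi p @^-1` [set t | 0 < t] by [].
    by move: (cpsi p) => /continuousP; apply; exact: open_gt.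
  by have [? [? [? [_ []]]]] := psiP p.
pose Psi q := \sum_(p <- s) psi p q.
have Psi0 q : Psi q != 0.
  have [p ps pq] := sP q; rewrite gt_eqF//; apply: lt_le_trans pq _.
  rewrite /Psi (big_rem p)//= lerDl; exact: sumr_ge0.
have H Z t : C1_map A setT Z ->
    (\int[dv]_p (tangential_div (fun q => \sum_(p <- t) psi p q *: Z q) p)%:E = 0)%E.
  move=> CZ; elim: t => [|p t IH].
    rewrite -[RHS](integral0 dv setT); apply: eq_integral => q _.
    by rewrite (@tangential_div0 _ setT)//; [exact: openT|move=> x _; rewrite big_nil].
  have C1 : C1_map A setT (fun q => psi p q *: Z q) by exact: C1_mapZ.
  have C2 : C1_map A setT (fun q => \sum_(p <- t) psi p q *: Z q).
    by apply: C1_map_sum => p'; exact: C1_mapZ.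
  have -> : (fun q => \sum_(p <- p :: t) psi p q *: Z q) =
      (fun q => psi p q *: Z q + \sum_(p <- t) psi p q *: Z q).
    by apply/funext => q; rewrite big_cons.
  under eq_integral do rewrite tangential_divD// EFinD.
  rewrite integralD//; try by apply: continuous_integrable; exact: continuous_tangential_div.
  rewrite IH adde0.
  have [c [K [r [[Ac cK Kc Kr] [p0 _ _ _]]]]] := psiP p.
  apply: (integral_div_bump Ac cK Kc Kr C1) => q Kq.
  by rewrite /psi p0// scale0r.
(* Y is the sum of the fields psi_p (Y / Psi), each supported in a chart. *)
have CZ : C1_map A setT (fun q => (Psi q)^-1 *: Y q).
  by apply: C1_mapZ => //; apply: C1_mapV => //; exact: C1_map_sum.
rewrite -(H _ s CZ); apply: eq_integral => p _; congr (tangential_div _ p)%:E.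
by apply/funext => q; rewrite -scaler_suml -/(Psi q) scalerA (mulfV (Psi0 q)) scale1r.
Qed.

End DivergenceTheorem.

Lemma enorm_le_coord (R : realType) m (v : 'rV[R]_m) (c : R) :
  0 <= c -> (forall i, `|v 0 i| <= c) -> enorm v <= m%:R * c.
Proof.
case: m v => [v c0 _|m v c0 vc]; first by rewrite /enorm big_ord0 sqrtr0 mul0r.
have mc0 : 0 <= m.+1%:R * c by rewrite mulr_ge0.
rewrite -(@ler_pXn2r _ 2)// ?nnegrE ?enorm_ge0// sqr_enorm dotE.
apply: (@le_trans _ _ (\sum_(i < m.+1) c ^+ 2)).
  apply: ler_sum => i _; rewrite -expr2 -real_normK ?num_real//.
  by rewrite ler_pXn2r// ?nnegrE.
rewrite sumr_const card_ord -[leLHS]mulr_natl [leRHS]exprMn ler_wpM2r ?sqr_ge0// expr2.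
by rewrite ler_peMl// ler1n.
Qed.

Lemma continuous_enorm (R : realType) m : continuous (@enorm R m).
Proof.
move=> v; apply: continuous_comp; last exact: sqrt_continuous.
apply: (@Ck_on_continuous _ _ _ 0 setT) => //.
apply: Ck_on_sum => [|i]; first exact: openT.
have Ci : Ck_on 0 setT (fun z : 'rV[R]_m => z 0 i).
  by split=> // z _; exact: coord_continuous.
exact: (@Ck_onM _ _ 0 setT _ _ openT Ci Ci).
Qed.

Section FirstVariation.
Context {R : realType} {n : nat} {M : ptopologicalType}.
Variables (A : set (chart R n M)) (g : chart R n M -> 'rV[R]_n -> 'M[R]_n)
  (X : M -> 'rV[R]_n.+1) (dv : {measure set (borel M) -> \bar R}).
Hypotheses (closedM : closed_manifold A) (metric_g : riemannian_metric A g)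
  (volM : volume_measure A g dv) (immX : isometric_immersion A g X) (n0 : (0 < n)%N).

Let atlasA := atlas_closed closedM.

Lemma continuous_X : continuous X.
Proof. exact: (C1_map_continuous atlasA (C1_map_X immX)). Qed.

Lemma measurable_extrinsic_ball p0 (s : R) :
  measurable ([set p | enorm (X p - X p0) < s] : set (borel M)).
Proof.
apply: open_measurable_borel.
have -> : [set p | enorm (X p - X p0) < s] = (fun p => enorm (X p - X p0)) @^-1` [set t | t < s] by [].
have : continuous (fun p => enorm (X p - X p0)).
  move=> p; apply: (@continuous_comp _ _ _ (fun p => X p - X p0) (@enorm R n.+1)).
    by apply: cvgB; [exact: continuous_X|exact: cvg_cst].
  exact: continuous_enorm.
by move=> /continuousP; apply; exact: open_lt.
Qed.

Definition curv p : R := `|mean_curvature A g X p|.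

Lemma continuous_curv : continuous curv.
Proof.
apply: (chart_continuous atlasA) => c x Ac dx.
have oc := @dom_open _ _ _ c.
have pd y (dy : dom c y) := posdef_gram metric_g immX Ac dy.
have CX k := smooth_X immX k Ac.
apply: (@Ck_on_continuous _ _ _ 0 (dom c)) => //.
apply: (@Ck_on_eq _ _ _ _ _ (fun y => n%:R^-1 * enorm (lap (X \o par c) y))) => //.
  move=> y dy /=; have [cy py] := parP dy.
  have := mean_curvature_clap atlasA metric_g immX Ac cy n0.
  rewrite /clap py => <-; rewrite mulKf// pnatr_eq0 -lt0n//.
have Clap : forall y, dom c y -> {for y, continuous (lap (X \o par c))}.
  exact: (Ck_on_continuous (Ck_on_lap oc CX pd 0)).
split=> // y dy.
have H : {for y, continuous (enorm (m := n.+1) \o lap (X \o par c))}.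
  by apply: continuous_comp; [exact: Clap|exact: continuous_enorm].
exact: cvgMl_tmp H.
Qed.

Section Centre.
Variable b : 'rV[R]_n.+1.

Definition sqr_radius p : R := dot (X p - b) (X p - b).

(** The squared length of the tangential part of [X - b], as the projection is symmetric and
    idempotent. *)
Definition sqr_tangential p : R := quad (tan_proj X atlasA p) (X p - b).

Lemma sqr_radius_ge0 p : 0 <= sqr_radius p.
Proof. exact: dot_ge0. Qed.

Lemma sqr_tangential_bounds p : 0 <= sqr_tangential p <= sqr_radius p.
Proof.
apply: quad_tproj_bounds; apply: (unit_gram_cjac metric_g immX).
  exact: chart_at_A.
exact: chart_at_img.
Qed.

Lemma C1_map_position : C1_map A setT (fun p => X p - b).
Proof.
apply: C1_mapI => c Ac; apply: Ck_onD; first exact: dom_open.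
  exact: (smooth_X immX).
exact: Ck_on_cst.
Qed.

Lemma C1_map_sqr_radius : C1_map A setT sqr_radius.
Proof.
apply: C1_mapI => c Ac; have oc := @dom_open _ _ _ c.
apply: (@Ck_on_eq _ _ _ _ _ (fun x => \sum_i (X (par c x) - b) 0 i * (X (par c x) - b) 0 i)) => //.
  by move=> x _; rewrite /= /sqr_radius dotE.
apply: Ck_on_sum => // i.
have Ci := Ck_on_coord 0 i oc (C1_map_dom C1_map_position Ac).
exact: (Ck_onM oc Ci Ci).
Qed.

Lemma continuous_sqr_radius : continuous sqr_radius.
Proof. exact: (C1_map_continuous atlasA C1_map_sqr_radius). Qed.

Lemma continuous_sqr_tangential : continuous sqr_tangential.
Proof.
apply: (chart_continuous atlasA) => c x Ac dx.
have oc := @dom_open _ _ _ c.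
have CX : Ck_on 0 (dom c) (fun y => X (par c y) - b).
  exact: Ck_onS (C1_map_dom C1_map_position Ac).
have CT : Ck_on 0 (dom c) (fun y => (X (par c y) - b) *m tproj (jac (X \o par c) y)).
  apply: Ck_on_mulmx; [exact: oc|exact: CX|].
  exact: (Ck_on_tproj metric_g immX).
have CQ := Ck_on_coord 0 0 oc (Ck_on_mulmx oc CT (Ck_on_trmx oc CX)).
apply: (Ck_on_continuous (Ck_on_eq oc _ CQ) dx).
move=> y dy; rewrite /= /sqr_tangential /quad; have [cy py] := parP dy.
by rewrite (tan_projE atlasA metric_g immX Ac cy) /cjac py.
Qed.

Section Field.
Variables (h h1 : R -> R).
Hypotheses (dh : forall t : R, is_derive t 1 h (h1 t)) (ch1 : continuous h1)
  (h0 : forall t, 0 <= h t).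

Lemma derive_continuous : continuous h.
Proof.
move=> t; apply: differentiable_continuous; apply/derivable1_diffP.
exact: (@ex_derive _ _ _ _ _ _ _ (dh t)).
Qed.

Definition radial_field p := h (sqr_radius p) *: (X p - b).

Lemma C1_map_radial_field : C1_map A setT radial_field.
Proof.
apply: C1_mapZ C1_map_position; apply: C1_mapI => c Ac.
exact: (Ck_on_comp1 (@dom_open _ _ _ c) dh ch1 (C1_map_dom C1_map_sqr_radius Ac)).
Qed.

Lemma cjac_radial_field c p : A c -> img c p ->
  cjac c radial_field p = h (sqr_radius p) *: cjac c X p +
    (2 * h1 (sqr_radius p)) *: (cjac c X p *m (X p - b)^T *m (X p - b)).
Proof.
move=> Ac cp; have [dx px] := coordP cp; have oc := @dom_open _ _ _ c.
set x := coord c p in dx px *.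
apply/matrixP => i a; rewrite [LHS]mxE [RHS]mxE [X in X + _]mxE [X in _ + X]mxE.
set J := cjac c X p.
have dX k : is_derive x (delta_mx 0 i : 'rV[R]_n) (fun y => (X (par c y) - b) 0 k) (J i k).
  have H := is_derive_coord i k oc dx (smooth_X immX 1 Ac).
  have E : (fun y => (X (par c y) - b) 0 k) = (fun y => (X \o par c) y 0 k) - cst (b 0 k).
    by apply/funext => y; rewrite [LHS]mxE [X in _ + X]mxE.
  rewrite E -[X in is_derive _ _ _ X]subr0.
  by apply: is_deriveB.
have dsq : is_derive x (delta_mx 0 i : 'rV[R]_n) (sqr_radius \o par c)
    (2 * (J *m (X p - b)^T) i 0).
  have -> : sqr_radius \o par c = (fun y => \sum_k (X (par c y) - b) 0 k * (X (par c y) - b) 0 k).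
    by apply/funext => y; rewrite /= /sqr_radius dotE.
  have -> : 2 * (J *m (X p - b)^T) i 0 = \sum_k ((X (par c x) - b) 0 k * J i k + (X (par c x) - b) 0 k * J i k).
    rewrite [X in 2 * X]mxE mulr_sumr; apply: eq_bigr => k _.
    by rewrite px [(X p - b)^T _ _]mxE; ring.
  by apply: is_derive_bigsum => k; exact: is_derive_mul.
have dhsq := is_derive_compR dsq (dh ((sqr_radius \o par c) x)).
have := is_derive_mul dhsq (dX a).
have -> : (fun z => (h \o (sqr_radius \o par c)) z * (X (par c z) - b) 0 a) =
    (fun y => (radial_field \o par c) y 0 a).
  by apply/funext => y; rewrite /= /radial_field [RHS]mxE.
move=> [_ ->]; rewrite /= px; congr (_ + _).
rewrite [X in _ = _ * X]mxE big_ord1.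
by ring.
Qed.

(** The differential of the field is [h] times that of [X], of trace [n h], plus a rank-one term.
    The latter sees only tangential components, since the gradient of [|X - b|^2] along [M] is twice
    the tangential part of [X - b]. *)
Lemma divX_radial_field c p : A c -> img c p ->
  divX X c radial_field p = n%:R * h (sqr_radius p) +
    2 * h1 (sqr_radius p) * sqr_tangential p.
Proof.
move=> Ac cp; rewrite /divX /div cjac_radial_field//.
have uG := unit_gram_cjac metric_g immX Ac cp.
rewrite /sqr_tangential (tan_projE atlasA metric_g immX Ac cp).
set J := cjac c X p in uG *; set v := X p - b.
rewrite mulmxDl mulmxDr mxtraceD -!scalemxAl -!scalemxAr !mxtraceZ.
congr (_ + _).
  by rewrite -/(gram J) mulVmx// mxtrace1 mulrC.
congr (_ * _); rewrite /tproj /quad.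
have -> : invmx (gram J) *m (J *m v^T *m v *m J^T) = (invmx (gram J) *m (J *m v^T)) *m (v *m J^T).
  by rewrite !mulmxA.
rewrite mxtrace_mulC.
by rewrite /mxtrace big_ord1 !mulmxA.
Qed.

Lemma dot_radial_field c p : A c -> img c p ->
  - (n%:R * curv p * Num.sqrt (sqr_radius p) * h (sqr_radius p)) <=
  dot (radial_field p) (clap X c p).
Proof.
move=> Ac cp; rewrite /radial_field dotZl.
rewrite (mean_curvature_clap atlasA metric_g immX Ac cp n0).
have := cauchy_schwarz (X p - b) (clap X c p); rewrite ler_norml => /andP[H _].
rewrite -[Num.sqrt _]enormE [X in - X]mulrC -mulrN.
by apply: ler_wpM2l => //; rewrite mulrC.
Qed.

(** The integrals differ by the normal term of the divergence, which is at least minus the right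
    integrand by Cauchy-Schwarz, [clap] having norm [n |H|]. Only [|H|] appears, so the sign of the
    normal is irrelevant. *)
Lemma first_variation :
  \int[dv]_p (n%:R * h (sqr_radius p) + 2 * h1 (sqr_radius p) * sqr_tangential p) <=
  \int[dv]_p (n%:R * curv p * Num.sqrt (sqr_radius p) * h (sqr_radius p)).
Proof.
have csq := continuous_sqr_radius.
have ci f (cf : continuous f) := continuous_integrable closedM metric_g volM immX cf.
have chs : continuous (fun p => h (sqr_radius p)).
  by move=> p; apply: continuous_comp; [exact: csq|exact: derive_continuous].
have i1 : dv.-integrable setT (EFin \o (fun p => n%:R * h (sqr_radius p) +
    2 * h1 (sqr_radius p) * sqr_tangential p)).
  apply: ci => p; apply: cvgD; first exact: cvgMl_tmp (chs p).
  apply: cvgM; last exact: continuous_sqr_tangential.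
  by apply: cvgMl_tmp; apply: continuous_comp; [exact: csq|exact: ch1].
have i2 : dv.-integrable setT (EFin \o (fun p => n%:R * curv p * Num.sqrt (sqr_radius p) *
    h (sqr_radius p))).
  apply: ci => p; apply: cvgM; last exact: chs.
  have c1 : {for p, continuous (fun p => n%:R * curv p)}.
    apply: cvgM; first exact: cvg_cst.
    exact: continuous_curv.
  have c2 : {for p, continuous (Num.sqrt \o sqr_radius)}.
    by apply: continuous_comp; [exact: csq|exact: sqrt_continuous].
  exact: cvgM c1 c2.
have i3 := ci _ (continuous_tangential_div (closedM := closedM) metric_g immX C1_map_radial_field).
rewrite -subr_le0 -RintegralB//.
have -> : 0 = \int[dv]_p tangential_div X closedM radial_field p :> R.
  by rewrite /Rintegral (integral_tangential_div closedM metric_g volM immX C1_map_radial_field).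
apply: le_Rintegral => //.
  by have := integrableB measurableT i1 i2; apply: eq_integrable.
move=> p _; rewrite /tangential_div.
have Ac : A (chart_at atlasA p) by exact: chart_at_A.
have cp : img (chart_at atlasA p) p by exact: chart_at_img.
rewrite (divX_radial_field Ac cp).
by apply: lerD => //; exact: dot_radial_field.
Qed.

End Field.
End Centre.

(** To first order [X] displaces [x0 + h] by [h J], and [|h J|^2] is the quadratic form of [G].
    Hence the ellipsoid of radius [s / 2] is sent into the extrinsic ball of radius [s], the other
    half of [s] absorbing the remainder; the density is at least half its value at [x0], whence
    [c0 / 2]. Only the threshold [s1] depends on the point. *)
Lemma small_ball_volume (c0 : R) p0 : 0 < c0 ->
  (forall (G : 'M[R]_n) (a : 'rV[R]_n) (s : R), posdef G -> 0 < s ->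
    ((c0 * s ^+ n)%:E <= (Num.sqrt (\det G))%:E * leb n (ellipsoid G a s))%E) ->
  exists2 s1, 0 < s1 & forall s, 0 < s < s1 ->
    ((c0 / 2 * (s / 2) ^+ n)%:E <= dv [set p | (enorm (X p - X p0) < s)%R])%E.
Proof.
move=> c00 ell.
pose c := chart_at atlasA p0.
have Ac : A c by exact: chart_at_A.
have cp : img c p0 by exact: chart_at_img.
have [dx px] := coordP cp; have oc := @dom_open _ _ _ c.
set x0 := coord c p0 in dx px *.
set F := X \o par c; have CF : Ck_on 1 (dom c) F by exact: (smooth_X immX).
set J := jac F x0; set G := gram J.
have pG : posdef G by exact: (posdef_gram metric_g immX).
have uG : G \in unitmx by exact: posdef_kernel.
pose v := vol_density F x0.
have v0 : 0 < v by rewrite sqrtr_gt0; exact: det_posdef_gt0.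
pose B : 'M[R]_(n, n.+1) := (J^T *m invmx G)^T.
pose K := 1 + \sum_i enorm (row i B).
have K0 : 0 < K by rewrite ltr_pwDl// sumr_ge0// => i _; exact: enorm_ge0.
(* Coercivity: h = (h J) J^T G^-1 recovers the coordinates of h from its image. *)
have hK (h : 'rV[R]_n) : `|h| <= K * enorm (h *m J).
  have KJ : 0 <= K * enorm (h *m J) by rewrite mulr_ge0 ?enorm_ge0// ltW.
  apply: rV_norm_le => // i.
  have -> : h 0 i = dot (h *m J) (row i B).
    have {1}-> : h = h *m J *m B^T.
      by rewrite /B trmxK mulmxA -(mulmxA h) -/(gram J) -mulmxA mulmxV// mulmx1.
    by rewrite [LHS]mxE dotE; apply: eq_bigr => k _; rewrite !mxE.
  apply: le_trans (cauchy_schwarz _ _) _; rewrite mulrC ler_wpM2r ?enorm_ge0//.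
  rewrite /K (bigD1 i)//= addrCA lerDl addr_ge0// sumr_ge0// => j _.
  exact: enorm_ge0.
(* Each of the [n + 1] coordinate errors is at most [e |h| <= e K s / 2]; together they amount to at
   most [s / 2]. *)
pose e := (n.+1%:R * K)^-1.
have e0 : 0 < e by rewrite invr_gt0 mulr_gt0.
have : \forall h \near (0 : 'rV[R]_n), [/\ dom c (h + x0),
    (forall a, `|F (h + x0) 0 a - F x0 0 a - \sum_i h 0 i * J i a| <= e * `|h|) &
    v / 2 <= vol_density F (h + x0)].
  have cs : (fun h : 'rV[R]_n => h + x0) @ (0 : 'rV[R]_n) --> x0.
    move=> U; rewrite /= -!nbhs_ballE => -[r r0 rU]; exists r => // h.
    by rewrite ball_distE sub0r normrN => hr; apply: rU; rewrite ball_shiftE.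
  have n1 : \forall h \near (0 : 'rV[R]_n), dom c (h + x0).
    exact: (cs _ (open_nbhs_nbhs (conj oc dx))).
  have n2 : \forall h \near (0 : 'rV[R]_n),
      forall a, `|F (h + x0) 0 a - F x0 0 a - \sum_i h 0 i * J i a| <= e * `|h|.
    have H a : \forall h \near (0 : 'rV[R]_n),
        `|F (h + x0) 0 a - F x0 0 a - \sum_i h 0 i * J i a| <= e * `|h|.
      have := C1_increment oc dx (Ck_on_coord 0 a oc CF) e0.
      by apply: filterS => h; congr (`|_ - _ - _| <= _); apply: eq_bigr => i _; rewrite mxE.
    exact: (filter_forall _ H).
  have n3 : \forall x \near x0, v / 2 <= vol_density F x.
    have cv : vol_density F x @[x --> x0] --> v by exact: (cont_vol_density metric_g immX Ac dx).
    by apply: (cvgr_ge v cv); rewrite ltr_pdivrMr// ltr_pMr// ltrDl.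
  apply: filterS (filterI n1 (filterI n2 (cs _ n3))) => h [? [? ?]].
  by split.
move=> /nbhs_ballP[r /= r0 rP].
(* Below this threshold [|h| <= K s / 2 < r] on the ellipsoid. *)
exists (r / K); first by rewrite divr_gt0.
move=> s /andP[s0 sr].
have s20 : 0 < s / 2 by rewrite divr_gt0.
have inell x : ellipsoid G x0 (s / 2) x -> [/\ dom c x, enorm (F x - F x0) < s & v / 2 <= vol_density F x].
  move=> Ex; pose h := x - x0.
  have hJ : enorm (h *m J) < s / 2.
    rewrite -(@ltr_pXn2r _ 2)// ?nnegrE ?enorm_ge0// ?ltW// sqr_enorm.
    by move: Ex; rewrite /ellipsoid /= /quad /G /gram -/h /dot trmx_mul !mulmxA.
  have hs : `|h| <= K * (s / 2).
    by apply: le_trans (hK h) _; rewrite ler_wpM2l// ltW.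
  have hr : ball (0 : 'rV[R]_n) r h.
    rewrite ball_distE sub0r normrN; apply: le_lt_trans hs _.
    move: sr; rewrite ltr_pdivlMr// => sr; apply: le_lt_trans sr.
    by rewrite mulrC ler_wpM2r ?(ltW K0)// ler_pdivrMr// ler_peMr ?(ltW s0)// ler1n.
  have := rP h hr; rewrite /h subrK => -[dx' Fx vx]; split=> //.
  have -> : F x - F x0 = (F x - F x0 - h *m J) + h *m J by rewrite subrK.
  apply: le_lt_trans (enormD _ _) _.
  have -> : s = s / 2 + s / 2 by rewrite -splitr.
  apply: ler_ltD => //.
  apply: (@le_trans _ _ (n.+1%:R * (e * `|h|))).
    apply: enorm_le_coord => [|a]; first by rewrite mulr_ge0// ltW.
    have := Fx a; congr (`|_| <= _).
    transitivity (F x 0 a - F x0 0 a - (h *m J) 0 a); last by rewrite !mxE.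
    by congr (_ - _); rewrite [RHS]mxE.
  apply: (@le_trans _ _ (n.+1%:R * (e * (K * (s / 2))))).
    by rewrite ler_wpM2l// ler_wpM2l// ltW.
  suff -> : n.+1%:R * (e * (K * (s / 2))) = s / 2 by [].
  transitivity ((n.+1%:R * K) * e * (s / 2)); first by rewrite !mulrA [_ * e * K]mulrAC.
  by rewrite /e mulfV ?mul1r// gt_eqF// mulr_gt0.
pose E := img c `&` coord c @^-1` (ellipsoid G x0 (s / 2)).
have mE : measurable (E : set (borel M)).
  by apply: open_measurable_borel; apply: open_img_preimage; exact: open_ellipsoid.
have mS := measurable_extrinsic_ball p0 s.
apply: (@le_trans _ _ (dv E)); last first.
  apply: le_measure; rewrite ?inE//.
  move=> p [cp' Ep] /=; have [_ + _] := inell _ Ep.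
  by rewrite /F /= px; have [_ ->] := coordP cp'.
rewrite (dv_chart volM immX Ac mE); last by move=> p [].
apply: (@le_trans _ _ (\int[leb n]_(x in ellipsoid G x0 (s / 2)) (v / 2)%:E)%E).
  rewrite integral_cst; last by apply: open_measurable_borel; exact: open_ellipsoid.
  have := ell G x0 (s / 2) pG s20; rewrite -/v => H.
  apply: (@le_trans _ _ ((2^-1)%:E * (c0 * (s / 2) ^+ n)%:E)%E).
    by rewrite -EFinM lee_fin mulrA [2^-1 * _]mulrC.
  have -> : (v / 2)%:E = ((2^-1)%:E * v%:E)%E by rewrite -EFinM mulrC.
  by rewrite -muleA; apply: lee_wpmul2l => //; rewrite lee_fin invr_ge0.
have mL : measurable (ellipsoid G x0 (s / 2) : set (borel 'rV[R]_n)).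
  by apply: open_measurable_borel; exact: open_ellipsoid.
have mP : measurable (chart_map c @^-1` E : set (borel 'rV[R]_n)).
  rewrite -[X in measurable X]setTI; exact: measurable_chart_map.
rewrite integral_mkcond [leRHS]integral_mkcond; apply: ge0_le_integral => //.
- by move=> x _; rewrite patchE; case: ifP => // _; rewrite lee_fin divr_ge0// ltW.
- by apply/(measurable_restrictT _ mL).
- apply/(measurable_restrictT _ mP).
  by apply: measurable_funTS; apply/measurable_EFinP; exact: (measurable_chart_density metric_g immX).
move=> x _; rewrite !patchE; case: ifPn => [/[!inE] Ex|_]; last first.
  by case: ifP => // _; rewrite lee_fin chart_density_ge0.
have [dx' _ vx] := inell x Ex; have [ix xx] := parP dx'.
rewrite mem_set; last by rewrite /E /chart_map /= mem_set//=; split=> //=; rewrite xx.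
by rewrite lee_fin /chart_density mem_set.
Qed.

End FirstVariation.

(** * Volumes of extrinsic balls *)

Section FiniteMeasureIntegral.
Context d (T : measurableType d) (R : realType) (mu : {measure set T -> \bar R}).
Hypothesis fin_mu : (mu setT < +oo)%E.

Lemma bounded_integrable (f : T -> R) (K : R) : measurable_fun setT f ->
  (forall x, `|f x| <= K) -> mu.-integrable setT (EFin \o f).
Proof.
move=> mf fK; apply: measurable_bounded_integrable => //.
exists K; split=> [|x Kx p _]; first exact: num_real.
by apply: le_trans (fK p) _; exact: ltW.
Qed.

Lemma powR_integrable (f : T -> R) (p K : R) : 0 <= p -> measurable_fun setT f ->
  (forall x, 0 <= f x <= K) -> mu.-integrable setT (EFin \o (fun x => f x `^ p)).
Proof.
move=> p0 mf fK; apply: (@bounded_integrable _ (K `^ p)).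
  exact: measurableT_comp (measurable_powR p) mf.
move=> x; have /andP[fx0 fxK] := fK x.
rewrite ger0_norm ?powR_ge0// ge0_ler_powR// nnegrE.
exact: le_trans fxK.
Qed.

Lemma Rintegral_hoelder (f g : T -> R) (p q K : R) :
  measurable_fun setT f -> measurable_fun setT g ->
  (forall x, 0 <= f x <= K) -> (forall x, 0 <= g x <= K) ->
  0 < p -> 0 < q -> p^-1 + q^-1 = 1 ->
  \int[mu]_x (f x * g x) <=
  (\int[mu]_x (f x `^ p)) `^ p^-1 * (\int[mu]_x (g x `^ q)) `^ q^-1.
Proof.
move=> mf mg fK gK p0 q0 pq.
have f0 x : 0 <= f x by have /andP[] := fK x.
have g0 x : 0 <= g x by have /andP[] := gK x.
have ifp := powR_integrable (ltW p0) mf fK.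
have igq := powR_integrable (ltW q0) mg gK.
have ifg : mu.-integrable setT (EFin \o (fun x => f x * g x)).
  apply: (@bounded_integrable _ (K * K)); first exact: measurable_funM.
  move=> x; have /andP[_ fxK] := fK x; have /andP[_ gxK] := gK x.
  by rewrite ger0_norm ?mulr_ge0// ler_pM.
have LE h r : (forall x, 0 <= h x) -> 0 < r ->
    mu.-integrable setT (EFin \o (fun x => h x `^ r)) ->
    Lnorm mu r%:E (EFin \o h) = ((\int[mu]_x (h x `^ r)) `^ r^-1)%:E.
  move=> h0 r0 ih; rewrite unlock -poweR_EFin; congr (_ `^ _)%E.
  rewrite /Rintegral fineK; last exact: integrable_fin_num.
  by apply: eq_integral => x _; rewrite /= ger0_norm// poweR_EFin.
have := hoelder mu mf mg p0 q0 pq.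
rewrite (LE f p)// (LE g q)// Lnorm1 -EFinM.
suff -> : (\int[mu]_x `|(EFin \o (f \* g)%R) x| = (\int[mu]_x (f x * g x)%R)%R%:E)%E.
  by rewrite lee_fin.
rewrite /Rintegral fineK; last exact: integrable_fin_num.
by apply: eq_integral => x _; rewrite /= ger0_norm// mulr_ge0.
Qed.

End FiniteMeasureIntegral.

Section DifferentialInequality.
Context {R : realType}.
Variables (n q L c1 T0 : R) (K K1 : R -> R).
Hypotheses (n0 : 0 < n) (nq : n < q) (L0 : 0 <= L).
Hypotheses (Kgt0 : forall t, 0 < t -> 0 < K t)
  (dK : forall t : R, 0 < t -> is_derive t 1 K (K1 t))
  (ineqK : forall t, 0 < t ->
    n * K t + 2 * t * K1 t <= n * t `^ (- 2^-1) * L * K t `^ (1 - q^-1))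
  (limK : forall t, T0 < t -> c1 <= t `^ (n / (2 * q)) * K t `^ q^-1).

Let alpha := (1 - n / q) / 2.
Let D := n * L / (q - n).
Let beta := n / (2 * q).

(** The factor [t^(beta - 1) K^(1/q - 1) / (2 q)] turns the left side of [ineqK] into the derivative
    of [t^beta K^(1/q)] and removes [K] from the right side, leaving a pure power of [t] with
    primitive [- D t^(-alpha)]. *)
Lemma differential_inequality t : 0 < t ->
  c1 - D * t `^ (- alpha) <= t `^ beta * K t `^ q^-1.
Proof.
move=> t0.
have q0 : 0 < q by exact: lt_trans nq.
(* [Phi] is nonincreasing. *)
pose Phi s := s `^ beta * K s `^ q^-1 + D * s `^ (- alpha).
pose dPhi s := (s `^ beta * (K1 s * (q^-1 * K s `^ (q^-1 - 1))) +
   K s `^ q^-1 * (beta * s `^ (beta - 1))) + D * (- alpha * s `^ (- alpha - 1)).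
have dP (s : R) : 0 < s -> is_derive s 1 Phi (dPhi s).
  move=> s0.
  have d1 := @is_derive1_powR R beta s s0.
  have d2 := is_derive_compR (dK s0) (@is_derive1_powR R q^-1 (K s) (Kgt0 s0)).
  have d3 := is_derive_mul d1 d2.
  have d4 := is_derive_mul (is_derive_cst D s 1) (@is_derive1_powR R (- alpha) s s0).
  have := is_deriveD d3 d4; rewrite mulr0 addr0 /dPhi.
  by rewrite [K1 s * _]mulrC.
have dP0 s : 0 < s -> dPhi s <= 0.
  move=> s0; have k0 := Kgt0 s0.
  have powS (x a : R) : 0 < x -> x `^ a = x * x `^ (a - 1).
    move=> x0; have H : x `^ (1 + (a - 1)) = x `^ 1 * x `^ (a - 1).
      by apply: powRD; rewrite (gt_eqF x0) implybT.
    by move: H; rewrite powRr1 ?ltW// addrC subrK.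
  have E1 := powS s beta s0; have E2 := powS (K s) q^-1 k0.
  have E3 : s `^ (- alpha - 1) = s `^ (beta - 1) * s `^ (- 2^-1).
    rewrite -powRD ?(gt_eqF s0) ?implybT//; congr (_ `^ _).
    by rewrite /alpha /beta; field; rewrite gt_eqF.
  have E4 : K s `^ (q^-1 - 1) * K s `^ (1 - q^-1) = 1.
    by rewrite -powRD ?(gt_eqF k0) ?implybT// (_ : q^-1 - 1 + (1 - q^-1) = 0) ?powRr0//; ring.
  have Da : D * alpha = n * L / (2 * q).
    by rewrite /D /alpha; field; rewrite subr_eq0 gt_eqF// gt_eqF.
  have -> : dPhi s = s `^ (beta - 1) * K s `^ (q^-1 - 1) / (2 * q) *
      (n * K s + 2 * s * K1 s) - n * L / (2 * q) * (s `^ (beta - 1) * s `^ (- 2^-1)).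
    rewrite /dPhi E1 E2 E3 -Da /beta; move: (s `^ _) (K s `^ _) => ? ?.
    by field; rewrite gt_eqF.
  rewrite subr_le0.
  have P0 : 0 <= s `^ (beta - 1) * K s `^ (q^-1 - 1) / (2 * q).
    by rewrite divr_ge0 ?mulr_ge0 ?powR_ge0// ltW.
  apply: (le_trans (ler_wpM2l P0 (ineqK s0))).
  rewrite [leLHS](_ : _ = n * L / (2 * q) * (s `^ (beta - 1) * s `^ (- 2^-1)) *
    (K s `^ (q^-1 - 1) * K s `^ (1 - q^-1))); last by ring.
  by rewrite E4 mulr1.
(* A parameter beyond both [t] and [T0]: there [limK] bounds [Phi] from below, and monotonicity
   brings the bound back to [t]. *)
pose T := Num.max t T0 + 1.
have tT : t < T by rewrite /T ltr_pwDr// le_max lexx.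
have T0T : T0 < T by rewrite /T ltr_pwDr// le_max lexx orbT.
have TT : 0 < T by exact: lt_trans tT.
have sT : 0 <= T - t by rewrite subr_ge0 ltW.
have [|c /andP[c0 cs]] := @mvt_line R R Phi t 1 (T - t) (fun s => dPhi (s *: 1 + t)) sT.
  move=> s /andP[s0 _]; apply: dP.
  by rewrite -[s *: 1]/(s * 1) mulr1 ltr_wpDl.
rewrite -[(T - t) *: 1]/((T - t) * 1) -[c *: 1]/(c * 1) !mulr1 subrK => E.
have ct : 0 < c + t by rewrite ltr_wpDl.
have : Phi T <= Phi t.
  by rewrite -subr_le0 E mulr_le0_ge0//; exact: dP0.
have := limK T0T; rewrite /Phi -/beta.
have D0 : 0 <= D * T `^ (- alpha).
  by rewrite mulr_ge0 ?powR_ge0// /D divr_ge0 ?mulr_ge0// ltW// subr_gt0.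
by move: D0; set x := D * _; set y := T `^ _ * _; set z := D * _; lra.
Qed.

End DifferentialInequality.

Section MassBounds.
Context d (T : measurableType d) (R : realType) (mu : {measure set T -> \bar R}).
Hypothesis fin_mu : (mu setT < +oo)%E.

Lemma measure_fine (S : set T) : measurable S -> mu S = (fine (mu S))%:E.
Proof.
move=> mS; rewrite fineK// ge0_fin_numE//.
by apply: le_lt_trans fin_mu; apply: le_measure; rewrite ?inE.
Qed.

Lemma indic_integrable (S : set T) : measurable S -> mu.-integrable setT (EFin \o \1_S).
Proof.
move=> mS; apply: (@bounded_integrable _ T R mu fin_mu _ 1); first exact: measurable_indic.
by move=> x; rewrite ger0_norm indicE ?ler0n// lern1 leq_b1.
Qed.

Lemma Rintegral_indic (S : set T) : measurable S -> \int[mu]_x \1_S x = fine (mu S).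
Proof. by move=> mS; rewrite /Rintegral integral_indic// setIT. Qed.

Lemma mass_le_Rintegral (S : set T) (f : T -> R) (c : R) : measurable S ->
  mu.-integrable setT (EFin \o f) -> (forall x, 0 <= f x) -> (forall x, S x -> c <= f x) ->
  c * fine (mu S) <= \int[mu]_x f x.
Proof.
move=> mS mf f0 fc; rewrite -Rintegral_indic// -RintegralZl//; last exact: indic_integrable.
apply: le_Rintegral => //.
  have := integrableZl measurableT c (indic_integrable mS).
  by apply: eq_integrable.
move=> x _; rewrite indicE; have [Sx|Sx] := pselect (S x).
  by rewrite mem_set// mulr1; exact: fc.
by rewrite memNset// mulr0.
Qed.

Lemma Rintegral_le_mass (S : set T) (f : T -> R) : measurable S ->
  mu.-integrable setT (EFin \o f) -> (forall x, f x <= \1_S x) ->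
  \int[mu]_x f x <= fine (mu S).
Proof.
move=> mS mf fS; rewrite -Rintegral_indic//; apply: le_Rintegral => //.
exact: indic_integrable.
Qed.

End MassBounds.

Section DensityBound.
Context {R : realType} {n : nat} {M : ptopologicalType}.
Variables (A : set (chart R n M)) (g : chart R n M -> 'rV[R]_n -> 'M[R]_n)
  (X : M -> 'rV[R]_n.+1) (dv : {measure set (borel M) -> \bar R}).
Hypotheses (closedM : closed_manifold A) (metric_g : riemannian_metric A g)
  (volM : volume_measure A g dv) (immX : isometric_immersion A g X) (n0 : (0 < n)%N).
Variable q : R.
Hypothesis nq : n%:R < q.

Let H := curv A g X.
Let ci f (cf : continuous f) := continuous_integrable closedM metric_g volM immX cf.
Let fin_dv := dv_finite closedM metric_g volM immX.

Definition curv_norm : R := (\int[dv]_p H p `^ q) `^ q^-1.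

Section AtPoint.
Variable p0 : M.

Let u p : R := sqr_radius X (X p0) p.
Let cu : continuous u.
Proof. exact: (continuous_sqr_radius closedM immX). Qed.

Let u0 p : 0 <= u p.
Proof. exact: sqr_radius_ge0. Qed.

Definition bump_mass t : R := \int[dv]_p relu2 (1 - t * u p).

Definition bump_mass' t : R := \int[dv]_p (- (u p * (2 * Num.max (1 - t * u p) 0))).

Let crelu t : continuous (fun p => relu2 (1 - t * u p)).
Proof.
have c2 : continuous (@relu2 R) := derive_continuous (@is_derive_relu2 R).
have c1 := @continuous_one_subM R t.
move=> p; apply: (@continuous_comp _ _ _ u (fun x => relu2 (1 - t * x))); first exact: cu.
exact: (@continuous_comp _ _ _ (fun x : R => 1 - t * x) (@relu2 R) _ (c1 (u p)) (c2 _)).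
Qed.

Let crelu' t : continuous (fun p => - (u p * (2 * Num.max (1 - t * u p) 0))).
Proof.
have c1 := @continuous_one_subM R t.
move=> p; apply: cvgN; apply: cvgM; first exact: cu.
apply: (@continuous_comp _ _ _ u (fun x => 2 * Num.max (1 - t * x) 0)); first exact: cu.
exact: (@continuous_comp _ _ _ (fun x : R => 1 - t * x) (fun x => 2 * Num.max x 0) _ (c1 (u p)) (@continuous_relu2' R _)).
Qed.

(** Pointwise the remainder is at most [C^2 h^2], with [C] a bound for [u] on the compact [M];
    integration over a finite volume keeps it quadratic. *)
Lemma is_derive_bump_mass (t : R) : is_derive t 1 bump_mass (bump_mass' t).
Proof.
have [C uC] := continuous_bounded closedM cu.
apply: (@is_derive_quadratic _ _ _ _ (C ^+ 2 * fine (dv setT))) => h.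
have i1 := ci (crelu (t := h + t)); have i2 := ci (crelu (t := t)).
have i3 := ci (crelu' (t := t)).
rewrite /bump_mass /bump_mass' -RintegralB// mulrC -RintegralZl//.
have i12 : dv.-integrable setT (EFin \o (fun p => relu2 (1 - (h + t) * u p) - relu2 (1 - t * u p))).
  by have := integrableB measurableT i1 i2; apply: eq_integrable.
have ih : dv.-integrable setT (EFin \o (fun p => h * - (u p * (2 * Num.max (1 - t * u p) 0)))).
  by have := integrableZl measurableT h i3; apply: eq_integrable.
have i123 : dv.-integrable setT (EFin \o (fun p => relu2 (1 - (h + t) * u p) - relu2 (1 - t * u p) -
    h * - (u p * (2 * Num.max (1 - t * u p) 0)))).
  by have := integrableB measurableT i12 ih; apply: eq_integrable.
rewrite -RintegralB//; apply: le_trans (le_normr_Rintegral _ i123) _ => //.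
have -> : C ^+ 2 * fine (dv setT) * h ^+ 2 = \int[dv]_p (C ^+ 2 * h ^+ 2).
  by rewrite Rintegral_cst// mulrAC.
apply: le_Rintegral => //.
- by have := integrable_abse i123; apply: eq_integrable.
- exact: (ci (f := cst (C ^+ 2 * h ^+ 2)) (@cst_continuous _ _ _)).
move=> p _; have := relu2_increment (1 - t * u p) (- (h * u p)).
have -> : - (h * u p) + (1 - t * u p) = 1 - (h + t) * u p by ring.
have -> : 2 * Num.max (1 - t * u p) 0 * - (h * u p) = h * - (u p * (2 * Num.max (1 - t * u p) 0)) by ring.
move=> /le_trans; apply; rewrite sqrrN exprMn mulrC ler_wpM2r ?sqr_ge0//.
by rewrite -ler_sqrt ?sqr_ge0// !sqrtr_sqr; have := uC p; move=> /le_trans; apply; exact: ler_norm.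
Qed.

Lemma ler_sqrt_inv (t x : R) : 0 < t -> 0 <= x -> t * x <= 1 -> Num.sqrt x <= t `^ (- 2^-1).
Proof.
move=> t0 x0 tx; rewrite powRN powR12_sqrt; last exact: ltW.
rewrite -[leRHS]mul1r ler_pdivlMr ?sqrtr_gt0//.
by rewrite -sqrtrM// -[leRHS]sqrtr1 ler_sqrt// mulrC.
Qed.

Let q0 : 0 < q.
Proof. by apply: lt_trans nq; rewrite ltr0n. Qed.

Let q1 : 1 < q.
Proof. by apply: le_lt_trans nq; rewrite ler1n. Qed.

Lemma bump_mass_inequality t : 0 < t ->
  n%:R * bump_mass t + 2 * t * bump_mass' t <=
  n%:R * t `^ (- 2^-1) * curv_norm * bump_mass t `^ (1 - q^-1).
Proof.
move=> t0.
pose h (x : R) : R := relu2 (1 - t * x); pose h1 (x : R) : R := 2 * Num.max (1 - t * x) 0 * - t.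
have dl (x : R) : is_derive x 1 (fun x => 1 - t * x) (- t).
  have := is_deriveB (is_derive_cst (1 : R) x 1)
    (is_derive_mul (is_derive_cst t x 1) (is_derive_id x 1)).
  by rewrite mulr1 mulr0 addr0 sub0r.
have dh (x : R) : is_derive x 1 h (h1 x) := is_derive_compR (dl x) (is_derive_relu2 (1 - t * x)).
have c1 := @continuous_one_subM R t.
have ch1 : continuous h1.
  move=> x; apply: cvgM; last exact: cvg_cst.
  exact: (@continuous_comp _ _ _ (fun x : R => 1 - t * x) (fun x => 2 * Num.max x 0) _ (c1 x) (@continuous_relu2' R _)).
have h0 x : 0 <= h x by exact: relu2_ge0.
have fv := first_variation closedM metric_g volM immX n0 (X p0) dh ch1 h0.
have cH : continuous H by exact: (continuous_curv closedM metric_g immX n0).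
have ch : continuous (fun p => h (u p)) := crelu (t := t).
have ch1u : continuous (fun p => h1 (u p)).
  by move=> p; apply: (@continuous_comp _ _ _ u h1); [exact: cu|exact: ch1].
have ct := continuous_sqr_tangential metric_g immX (closedM := closedM) (b := X p0).
have K0 : 0 <= bump_mass t by apply: Rintegral_ge0 => p _; exact: relu2_ge0.
(* The cut-off is nonincreasing, so [h1 (u p) <= 0]; replacing the squared tangential part by the
   larger [u] lowers the left side. *)
apply: (@le_trans _ _ (\int[dv]_p (n%:R * h (u p) + 2 * h1 (u p) * sqr_tangential X closedM (X p0) p))).
  have i1 := ci (crelu (t := t)); have i2 := ci (crelu' (t := t)).
  rewrite /bump_mass /bump_mass' -RintegralZl// -[2 * t * _]RintegralZl// -RintegralD//; last 2 first.
  - by have := integrableZl measurableT n%:R i1; apply: eq_integrable.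
  - by have := integrableZl measurableT (2 * t) i2; apply: eq_integrable.
  apply: le_Rintegral => //.
  - apply: ci => p; apply: cvgD.
      by apply: cvgM; [exact: cvg_cst|exact: (crelu (t := t))].
    by apply: cvgM; [exact: cvg_cst|exact: (crelu' (t := t))].
  - apply: ci => p; apply: cvgD.
      by apply: cvgM; [exact: cvg_cst|exact: ch].
    apply: cvgM; last exact: ct.
    by apply: cvgM; [exact: cvg_cst|exact: ch1u].
  move=> p _; rewrite lerD2l /h1.
  have /andP[w0 wu] := sqr_tangential_bounds closedM metric_g immX (X p0) p.
  have m0 : 0 <= Num.max (1 - t * u p) 0 by rewrite le_max lexx orbT.
  have -> : 2 * t * - (u p * (2 * Num.max (1 - t * u p) 0)) =
    - (4 * t * Num.max (1 - t * u p) 0) * u p by ring.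
  have -> : 2 * (2 * Num.max (1 - t * u p) 0 * - t) * sqr_tangential X closedM (X p0) p =
    - (4 * t * Num.max (1 - t * u p) 0) * sqr_tangential X closedM (X p0) p by ring.
  by rewrite !mulNr lerN2 ler_wpM2l// !mulr_ge0// ltW.
apply: (le_trans fv).
have cHh : continuous (fun p => H p * h (u p)).
  by move=> p; apply: cvgM; [exact: cH|exact: ch].
(* Where the cut-off is nonzero [t u < 1], which bounds [sqrt u] by [t^(-1/2)]. *)
apply: (@le_trans _ _ (n%:R * t `^ (- 2^-1) * \int[dv]_p (H p * h (u p)))).
  rewrite -RintegralZl//; last exact: ci.
  apply: le_Rintegral => //.
  - apply: ci => p; apply: cvgM; last exact: ch.
    have cc1 : {for p, continuous (fun p => n%:R * H p)}.
      by apply: cvgM; [exact: cvg_cst|exact: cH].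
    have cc2 : {for p, continuous (Num.sqrt \o u)}.
      by apply: continuous_comp; [exact: cu|exact: sqrt_continuous].
    exact: cvgM cc1 cc2.
  - by apply: ci => p; apply: cvgM; [exact: cvg_cst|exact: cHh].
  move=> p _; rewrite -[sqr_radius _ _ _]/(u p) -/(H p).
  have H0 : 0 <= H p by exact: normr_ge0.
  have [tu|tu] := leP (1 - t * u p) 0.
    by rewrite /h (relu2_le0 tu) !mulr0.
  rewrite mulrA ler_wpM2r// mulrAC ler_wpM2r// ler_wpM2l//.
  by apply: ler_sqrt_inv => //; rewrite -subr_ge0 ltW.
rewrite -!mulrA ler_wpM2l// ler_wpM2l ?powR_ge0//.
have [B HB] := continuous_bounded closedM cH.
(* The exponent conjugate to [q]. As [0 <= h <= 1] and [r >= 1], the integral of [h^r] in Hoelder's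
   inequality is at most that of [h], namely [bump_mass t]. *)
pose r := (1 - q^-1)^-1.
have qV : q^-1 < 1 by rewrite invf_lt1.
have r0 : 0 < r by rewrite invr_gt0 subr_gt0.
have r1 : 1 <= r by rewrite invf_ge1 ?subr_gt0// lerBlDr lerDl invr_ge0 ltW.
have h01 p : 0 <= h (u p) <= 1.
  rewrite h0 /= /h /relu2 expr_le1// ?le_max ?lexx ?orbT// ge_max ler01 andbT.
  by rewrite lerBlDr lerDl mulr_ge0// ltW.
have B0 : 0 <= B by apply: le_trans (HB p0).
have Hb p : 0 <= H p <= B + 1.
  rewrite normr_ge0 /=; apply: (@le_trans _ _ B); last by rewrite lerDl.
  by have := HB p; apply: le_trans; exact: ler_norm.
have hb p : 0 <= h (u p) <= B + 1.
  by have /andP[-> h1'] := h01 p; rewrite (le_trans h1')// lerDr.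
have mH : measurable_fun setT (H : borel M -> R) by exact: continuous_measurable_borel.
have mh : measurable_fun setT ((fun p => h (u p)) : borel M -> R).
  exact: continuous_measurable_borel.
have pq : q^-1 + r^-1 = 1 by rewrite /r invrK addrC subrK.
have := @Rintegral_hoelder _ _ _ dv fin_dv _ _ q r _ mH mh Hb hb q0 r0 pq.
move=> /le_trans; apply; apply: ler_wpM2l; first exact: powR_ge0.
rewrite /r invrK ge0_ler_powR ?nnegrE ?subr_ge0 ?(ltW qV)//.
- by apply: Rintegral_ge0 => p _; exact: powR_ge0.
- apply: le_Rintegral => //.
  + by apply: (powR_integrable fin_dv (ltW r0) mh h01).
  + exact: ci.
  move=> p _; have /andP[hp0 hp1] := h01 p; rewrite -/(h (u p)).
  have [hp|hp] := eqVneq (h (u p)) 0; first by rewrite hp powR0// gt_eqF.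
  by apply: ge1r_powR => //; rewrite lt_neqAle eq_sym hp hp0.
Qed.

Lemma bump_mass_ge (t : R) : 0 < t ->
  4^-1 * fine (dv [set p | enorm (X p - X p0) < (2 * Num.sqrt t)^-1]) <= bump_mass t.
Proof.
move=> t0; apply: (mass_le_Rintegral fin_dv).
- exact: (measurable_extrinsic_ball closedM immX).
- exact: ci.
- by move=> p; exact: relu2_ge0.
move=> p /= pt.
have st : 0 < Num.sqrt t by rewrite sqrtr_gt0.
(* At half the radius of the support the cut-off is at least [(3/4)^2], hence at least [1/4]. *)
have ut : t * u p <= 4^-1.
  rewrite /u /sqr_radius -sqr_enorm -(sqr_sqrtr (ltW t0)) -exprMn.
  have -> : 4^-1 = 2^-1 ^+ 2 :> R by field.
  rewrite ler_pXn2r// ?nnegrE ?mulr_ge0 ?enorm_ge0 ?sqrtr_ge0//.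
  rewrite mulrC -ler_pdivlMr//; apply: ltW; apply: lt_le_trans pt _.
  by rewrite invfM.
have H34 : 3 / 4 <= 1 - t * u p by lra.
rewrite /relu2 max_l; last by lra.
by nra.
Qed.

Lemma bump_mass_le (t s : R) : 0 < s -> 1 <= t * s ^+ 2 ->
  bump_mass t <= fine (dv [set p | enorm (X p - X p0) < s]).
Proof.
move=> s0 ts; have t0 : 0 < t.
  by rewrite ltNge; apply/negP => t0; have := sqr_ge0 s; nra.
apply: (Rintegral_le_mass fin_dv).
- exact: (measurable_extrinsic_ball closedM immX).
- exact: ci.
move=> p; rewrite indicE; have [ps|ps] := boolP (p \in _).
  rewrite /relu2 expr_le1// ?le_max ?lexx ?orbT// ge_max ler01 andbT.
  by rewrite lerBlDr lerDl mulr_ge0// ltW.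
rewrite relu2_le0// subr_le0; apply: le_trans ts _.
rewrite ler_wpM2l ?(ltW t0)// /u /sqr_radius -sqr_enorm ler_pXn2r ?nnegrE ?enorm_ge0 ?(ltW s0)//.
by move: ps; rewrite notin_setE /= => /negP; rewrite -leNgt.
Qed.

Section SmallBalls.
Variable c0 : R.
Hypotheses (c00 : 0 < c0) (ell : forall (G : 'M[R]_n) (a : 'rV[R]_n) (s : R), posdef G -> 0 < s ->
    ((c0 * s ^+ n)%:E <= (Num.sqrt (\det G))%:E * leb n (ellipsoid G a s))%E).

(** One quarter from [bump_mass_ge], then one half and [(s / 2)^n] from [small_ball_volume] with
    [s / 2 = 1 / (4 sqrt t)]. *)
Let cd : R := c0 / (8 * 4 ^+ n).

Let cd0 : 0 < cd.
Proof. by rewrite divr_gt0// mulr_gt0// exprn_gt0. Qed.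

Lemma bump_mass_large : exists T0, forall t, 0 < t -> T0 < t ->
  cd * Num.sqrt t ^- n <= bump_mass t.
Proof.
have [s1 s10 sb] := small_ball_volume closedM metric_g volM immX p0 c00 ell.
exists (s1 ^- 2) => t t0 tT.
have st : 0 < Num.sqrt t by rewrite sqrtr_gt0.
apply: le_trans (bump_mass_ge t0).
pose s := (2 * Num.sqrt t)^-1.
have s0 : 0 < s by rewrite invr_gt0 mulr_gt0.
have ss1 : s < s1.
  apply: (@lt_trans _ _ (Num.sqrt t)^-1).
    by rewrite ltf_pV2 ?posrE ?mulr_gt0// ltr_pMl// ltr1n.
  rewrite -[s1]invrK ltf_pV2 ?posrE ?invr_gt0//.
  by rewrite -(@ltr_pXn2r _ 2)// ?nnegrE ?invr_ge0 ?ltW// sqr_sqrtr ?(ltW t0)// exprVn.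
have := sb s; rewrite s0 ss1 => /(_ isT).
rewrite (measure_fine fin_dv (measurable_extrinsic_ball closedM immX p0 s)) lee_fin => H1.
apply: le_trans (ler_wpM2l _ H1); last by rewrite invr_ge0.
rewrite le_eqVlt; apply/orP; left; apply/eqP.
have -> : s / 2 = (4 * Num.sqrt t)^-1 by rewrite /s; field; rewrite gt_eqF.
rewrite exprVn exprMn /cd; field.
by rewrite !expf_neq0// gt_eqF.
Qed.

(** The cut-offs decrease as [t] grows, so positivity for large [t] extends to all [t > 0]. *)
Lemma bump_mass_gt0 t : 0 < t -> 0 < bump_mass t.
Proof.
move=> t0; have [T0 H0] := bump_mass_large.
pose T := Num.max t T0 + 1.
have tT : t < T by rewrite /T ltr_pwDr// le_max lexx.
have T0T : T0 < T by rewrite /T ltr_pwDr// le_max lexx orbT.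
have TT : 0 < T by exact: lt_trans tT.
apply: (@lt_le_trans _ _ (bump_mass T)).
  by apply: lt_le_trans (H0 T TT T0T); rewrite mulr_gt0// invr_gt0 exprn_gt0// sqrtr_gt0.
apply: le_Rintegral => //; [exact: ci|exact: ci|move=> p _].
have m0 (x : R) : 0 <= Num.max x 0 by rewrite le_max lexx orbT.
rewrite /relu2 ler_pXn2r ?nnegrE//.
rewrite ge_max; apply/andP; split; last by rewrite le_max lexx orbT.
by rewrite le_max lerD2l lerN2 ler_wpM2r// ltW.
Qed.

(** With [t = s^-2] the cut-off is supported in the ball of radius [s]. The hypothesis keeps the
    curvature term of [differential_inequality] below half the limiting constant; raising to the
    power [q] gives the volume. *)
Lemma density_bound (s : R) : 0 < s ->
  n%:R * curv_norm / (q - n%:R) * s `^ (1 - n%:R / q) <= cd `^ q^-1 / 2 ->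
  (cd `^ q^-1 / 2) `^ q * s ^+ n <= fine (dv [set p | enorm (X p - X p0) < s]).
Proof.
move=> s0; set D := _ / (q - _); set c1 := cd `^ _ => Ds.
have [T0 HT] := bump_mass_large.
have c10 : 0 < c1 by exact: powR_gt0.
have n0R : 0 < n%:R :> R by rewrite ltr0n.
have lim (t : R) : Num.max T0 0 < t -> c1 <= t `^ (n%:R / (2 * q)) * bump_mass t `^ q^-1.
  rewrite gt_max => /andP[T0t t0].
  have st : 0 < Num.sqrt t by rewrite sqrtr_gt0.
  have -> : n%:R / (2 * q) = (2^-1 * n%:R) * q^-1 by field; rewrite gt_eqF.
  have K0 := ltW (bump_mass_gt0 t0).
  rewrite powRrM -powRM ?powR_ge0//.
  have P0 : 0 <= t `^ (2^-1 * n%:R) * bump_mass t by rewrite mulr_ge0// powR_ge0.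
  rewrite ge0_ler_powR ?nnegrE ?P0 ?(ltW cd0) ?invr_ge0 ?(ltW q0)//.
  rewrite powRrM powR_mulrn ?powR_ge0// powR12_sqrt; last exact: ltW.
  by rewrite mulrC -ler_pdivrMr ?exprn_gt0//; exact: HT.
have L0 : 0 <= curv_norm by exact: powR_ge0.
pose t := s ^- 2.
have t0 : 0 < t by rewrite invr_gt0 exprn_gt0.
have := differential_inequality n0R nq L0 bump_mass_gt0 (fun t _ => is_derive_bump_mass t)
  bump_mass_inequality lim t0.
rewrite -/D.
have tE (a : R) : t `^ a = s `^ (- 2 * a).
  rewrite powRrM; congr (_ `^ _).
  by rewrite powRN powR_mulrn// ltW.
rewrite !tE.
have -> : - 2 * - ((1 - n%:R / q) / 2) = 1 - n%:R / q by field; rewrite gt_eqF.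
have -> : - 2 * (n%:R / (2 * q)) = - (n%:R / q) by field; rewrite gt_eqF.
move=> H1.
have H2 : c1 / 2 <= s `^ (- (n%:R / q)) * bump_mass t `^ q^-1.
  by apply: le_trans H1; move: Ds; set y := D * _; lra.
apply: (@le_trans _ _ (bump_mass t)); last first.
  by apply: bump_mass_le => //; rewrite /t mulVf// gt_eqF// exprn_gt0.
have Kt := bump_mass_gt0 t0.
have H3 : c1 / 2 * s `^ (n%:R / q) <= bump_mass t `^ q^-1.
  by move: H2; rewrite powRN [leRHS]mulrC ler_pdivlMr ?powR_gt0.
have c120 : 0 <= c1 / 2 by rewrite divr_ge0// ltW.
have := @ge0_ler_powR R q (ltW q0) _ _ _ _ H3.
rewrite !nnegrE powR_ge0 mulr_ge0 ?powR_ge0// => /(_ isT isT).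
rewrite powRM ?powR_ge0// -!powRrM divfK ?gt_eqF// mulVf ?gt_eqF// powR_mulrn ?(ltW s0)//.
by rewrite powRr1// ltW.
Qed.

End SmallBalls.

End AtPoint.

End DensityBound.

(** * Deviation of the radius *)

Section Exponents.
Context {R : realType}.
Variables (n : nat) (q c1 : R).
Hypotheses (n2 : (2 <= n)%N) (nq : n%:R < q) (c10 : 0 < c1).

Let gamma : R := q / (2 * (q - n%:R)).
(** Makes the condition of [scale_admissible] an equality at [s0]. *)
Let a : R := c1 * (q - n%:R) / n%:R.
Let e : R := 2 * (1 + n%:R * gamma).
(* Chosen so that [T ^+ 2 * s0 ^+ n = k * V] in [sqr_scale]. *)
Let k : R := a `^ (n%:R * q / (q - n%:R)).
Let eta : R := c1 `^ q.
(** A lower bound for [T]: [eta s0^n <= V] and [T^2 s0^n = k V] imply [eta k <= T^2]. *)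
Let rho : R := Num.sqrt (eta * k).

Let n0 : 0 < n%:R :> R.
Proof. by rewrite ltr0n (leq_trans _ n2). Qed.

Let q0 : 0 < q. Proof. exact: lt_trans nq. Qed.

Let qn0 : 0 < q - n%:R. Proof. by rewrite subr_gt0. Qed.

Let a0 : 0 < a. Proof. by rewrite divr_gt0// mulr_gt0. Qed.

Let k0 : 0 < k. Proof. exact: powR_gt0. Qed.

Let eta0 : 0 < eta. Proof. exact: powR_gt0. Qed.

Let rho0 : 0 < rho. Proof. by rewrite sqrtr_gt0 mulr_gt0. Qed.

Let gamma12 : 2^-1 < gamma.
Proof.
rewrite /gamma ltr_pdivlMr ?mulr_gt0// mulrA mulVf// mul1r.
by rewrite ltrBlDr ltrDl.
Qed.

Let gamma0 : 0 < gamma. Proof. by apply: lt_trans gamma12; rewrite invr_gt0. Qed.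

Let e0 : 0 < e.
Proof. by rewrite mulr_gt0// ltr_pwDl// mulr_ge0// ltW. Qed.

Lemma exponent_ge (j : nat) : (j <= n.+2)%N -> j%:R <= e.
Proof.
move=> jn; apply: (@le_trans _ _ n.+2%:R); first by rewrite ler_nat.
rewrite /e -natr1 -natr1 mulrDr mulr1 -addrA addrC -[1 + 1]/(2%:R) lerD2l.
rewrite [leRHS]mulrCA ler_peMr ?(ltW n0)//.
by rewrite mulrC -ler_pdivrMr// div1r ltW.
Qed.

(** Used with [j = 2] and [j = n + 2], the two powers that occur. Since [gamma > 1/2], [e] is at
    least [n + 2], and for [eps <= 1] lowering the exponent from [1/j] to [1/e] only increases the
    value. *)
Lemma pow_deficit_ge (eps : R) (j : nat) : 0 <= eps <= 1 -> (j <= n.+2)%N ->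
  eps <= (eps `^ e^-1) ^+ j.
Proof.
move=> /andP[eps0 eps1] jn.
have [->|epsN0] := eqVneq eps 0; first by rewrite exprn_ge0// powR_ge0.
rewrite -powR_mulrn ?powR_ge0// -powRrM ger1_powR//.
  by rewrite lt_neqAle eq_sym epsN0 eps0.
by rewrite mulrC ler_pdivrMr// mul1r; exact: exponent_ge.
Qed.

Section Scale.
Variables (V NH : R).
Hypotheses (V0 : 0 < V) (NH0 : 0 < NH).

Let D : R := n%:R * (NH * V `^ q^-1) / (q - n%:R).
Let s0 : R := (a / (NH * V `^ q^-1)) `^ (q / (q - n%:R)).
Let T : R := (V * NH ^+ n) `^ gamma.

Let L0 : 0 < NH * V `^ q^-1. Proof. by rewrite mulr_gt0// powR_gt0. Qed.

Lemma scale_gt0 : 0 < s0. Proof. by rewrite powR_gt0// divr_gt0. Qed.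

Lemma scale_admissible (s : R) : 0 < s <= s0 -> D * s `^ (1 - n%:R / q) <= c1.
Proof.
move=> /andP[sgt0 ss0].
have b0 : 0 <= 1 - n%:R / q by rewrite subr_ge0 ler_pdivrMr// mul1r ltW.
have D0 : 0 <= D by apply: divr_ge0; [apply: mulr_ge0|]; exact: ltW.
have := ge0_ler_powR b0 _ _ ss0; rewrite !nnegrE (ltW sgt0) (ltW scale_gt0) => /(_ isT isT) H.
apply: le_trans (ler_wpM2l D0 H) _.
rewrite /s0 -powRrM.
have -> : q / (q - n%:R) * (1 - n%:R / q) = 1 by field; rewrite !gt_eqF.
rewrite powRr1; last by apply: mulr_ge0; [exact: ltW|rewrite invr_ge0; exact: ltW].
rewrite /D /a le_eqVlt; apply/orP; left; apply/eqP.
by field; rewrite !gt_eqF// powR_gt0.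
Qed.

(** The powers of [NH] cancel, and those of [V] add up to 1 because [q / (q - n) * (1 - n / q) = 1].
    This is what fixes the exponent [gamma]. *)
Lemma sqr_scale : T ^+ 2 * s0 ^+ n = k * V.
Proof.
have PP : 0 < V * NH ^+ n by rewrite mulr_gt0// exprn_gt0.
rewrite -powR_mulrn ?powR_ge0// -[in s0 ^+ n]powR_mulrn ?powR_ge0// /T /s0 -!powRrM.
have -> : gamma * 2 = q / (q - n%:R) by rewrite /gamma; field; rewrite gt_eqF.
rewrite powRM ?(ltW V0) ?exprn_ge0 ?(ltW NH0)//.
rewrite -[NH ^+ n]powR_mulrn ?(ltW NH0)// -powRrM.
set z := q / (q - n%:R).
rewrite -[a / _]/(a * _) powRM ?(ltW a0) ?invr_ge0 ?(ltW L0)//.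
rewrite -[(NH * _)^-1]powR_inv1 ?(ltW L0)// -powRrM.
rewrite powRM ?(ltW NH0) ?powR_ge0// -[(V `^ _) `^ _]powRrM.
have -> : a `^ (z * n%:R) = k by rewrite /k /z; congr (_ `^ _); field; rewrite gt_eqF.
rewrite (_ : _ * _ = k * (V `^ z * V `^ (q^-1 * (-1 * (z * n%:R)))) *
  (NH `^ (n%:R * z) * NH `^ (-1 * (z * n%:R)))); last by ring.
rewrite -!powRD ?(gt_eqF V0) ?(gt_eqF NH0) ?implybT//.
rewrite (_ : n%:R * z + _ = 0); last by ring.
rewrite powRr0 mulr1 (_ : z + _ = 1) ?powRr1 ?(ltW V0)//.
by rewrite /z; field; rewrite !gt_eqF.
Qed.

End Scale.

(** What remains concerns real numbers only: [V] stands for the volume, [NH], [N1], [N2] for the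
    norms, [m] for the deviation at a point and [W s] for the volume of the extrinsic ball of radius
    [s] about it. *)
Lemma final_estimate : exists2 C : R, 0 <= C &
  forall (V NH N1 N2 m : R) (W : R -> R), 0 < V -> 0 <= NH -> 0 <= N1 <= N2 ->
  1 <= NH * N2 -> 0 <= m ->
  (forall s, W s <= V) ->
  (forall s, 0 < s -> n%:R * (NH * V `^ q^-1) / (q - n%:R) * s `^ (1 - n%:R / q) <= c1 ->
     c1 `^ q * s ^+ n <= W s) ->
  (m / 2) ^+ 2 * W (m / 2) <= V * (2 * N2 ^+ 2 - 2 * N2 * N1) ->
  (forall s, s <= m / 2 -> W s <= W (m / 2)) ->
  m <= C * (V * NH ^+ n) `^ gamma * N2 * (1 - N1 / N2) `^ e^-1 /\
  N2 + m <= C * (V * NH ^+ n) `^ gamma * N2.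
Proof.
pose C2 : R := rho `^ gamma^-1 / rho ^+ n.+2.
have C20 : 0 < C2 by rewrite divr_gt0 ?powR_gt0// exprn_gt0.
(* Adding 1 makes [x <= (1 + x)^j] available for [j = 2] here and [j = n + 2] for [C3], so no root
   of a constant is taken. *)
pose C1 : R := 1 + 8 / (eta * k).
pose C3 : R := 1 + 2 ^+ n.+3 * C2 / eta.
have C10 : 1 <= C1 by rewrite lerDl divr_ge0// mulr_ge0// ltW.
have C30 : 1 <= C3.
  rewrite lerDl; apply: divr_ge0; last exact: ltW.
  by apply: mulr_ge0; [exact: exprn_ge0|exact: ltW].
have rV0 : 0 <= rho^-1 by rewrite invr_ge0 ltW.
exists (C1 + C3 + rho^-1); first by lra.
move=> V NH N1 N2 m W V0 NHge0 /andP[N10 N12] NHN2 m0 WV Ws Wm Wmono.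
have N20 : 0 < N2.
  rewrite lt_neqAle (le_trans N10 N12) andbT; apply/eqP => N20.
  by move: NHN2; rewrite -N20 mulr0 ler10.
have NH0 : 0 < NH.
  rewrite lt_neqAle NHge0 andbT; apply/eqP => NH0.
  by move: NHN2; rewrite -NH0 mul0r ler10.
pose eps : R := 1 - N1 / N2; rewrite -/eps.
have eps01 : 0 <= eps <= 1.
  by rewrite subr_ge0 ler_pdivrMr// mul1r N12 /= lerBlDr lerDl divr_ge0// ltW.
have /andP[eps0 eps1] := eps01.
pose E : R := eps `^ e^-1; rewrite -/E.
have E0 : 0 <= E by exact: powR_ge0.
have E1 : E <= 1.
  have := @ge0_ler_powR R e^-1 _ eps 1; rewrite invr_ge0 (ltW e0) !nnegrE eps0 ler01.
  by move=> /(_ isT isT isT eps1); rewrite powR1.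
have deficit : V * (2 * N2 ^+ 2 - 2 * N2 * N1) = 2 * V * N2 ^+ 2 * eps.
  by rewrite /eps; field; rewrite gt_eqF.
rewrite deficit in Wm.
set T := (V * NH ^+ n) `^ gamma.
pose s0 : R := (a / (NH * V `^ q^-1)) `^ (q / (q - n%:R)).
have s00 : 0 < s0 := scale_gt0 V0 NH0.
have T0 : 0 < T by rewrite powR_gt0// mulr_gt0// exprn_gt0.
have Ts : T ^+ 2 * s0 ^+ n = k * V := sqr_scale V0 NH0.
have W0 : eta * s0 ^+ n <= W s0.
  by apply: Ws => //; apply: scale_admissible => //; rewrite s00 lexx.
have rhoT : rho <= T.
  rewrite -(@ler_pXn2r _ 2)// ?nnegrE ?(ltW rho0) ?(ltW T0)//.
  rewrite sqr_sqrtr; last by rewrite mulr_ge0// ltW.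
  rewrite -(ler_pM2r V0) -mulrA -Ts mulrCA ler_wpM2l ?sqr_ge0//.
  exact: le_trans (WV s0).
have mE : m <= (C1 + C3) * (T * N2 * E).
  have TNE : 0 <= T * N2 * E by rewrite !mulr_ge0// ltW.
  (* If [m / 2] is at least [s0], the volume bound is used at [s0] and transported by the
     monotonicity of [W]; otherwise it is used at [m / 2] itself. *)
  have [ms|ms] := leP s0 (m / 2).
    suff : m <= C1 * (T * N2 * E).
      by move=> /le_trans; apply; rewrite ler_wpM2r// lerDl (le_trans ler01).
    have H1 : (m / 2) ^+ 2 * (eta * s0 ^+ n) <= 2 * V * N2 ^+ 2 * eps.
      apply: le_trans Wm; rewrite ler_wpM2l ?sqr_ge0//.
      by apply: le_trans W0 _; exact: Wmono.
    have H2 : m ^+ 2 * (eta * k) <= 8 * (T * N2) ^+ 2 * eps.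
      rewrite -(ler_pM2r V0).
      have := ler_wpM2l (sqr_ge0 T) H1.
      rewrite (_ : T ^+ 2 * ((m / 2) ^+ 2 * (eta * s0 ^+ n)) = 4^-1 * (m ^+ 2 * eta * (T ^+ 2 * s0 ^+ n))); last by field.
      rewrite Ts -ler_pdivlMl ?invr_gt0// invrK => H.
      rewrite (_ : m ^+ 2 * (eta * k) * V = m ^+ 2 * eta * (k * V)); last by ring.
      by apply: le_trans H _; rewrite le_eqVlt; apply/orP; left; apply/eqP; ring.
    have ek : 0 < eta * k by rewrite mulr_gt0.
    have H3 : m ^+ 2 <= (8 / (eta * k)) * (T * N2 * E) ^+ 2.
      rewrite -ler_pdivlMr// in H2; apply: le_trans H2 _.
      rewrite (_ : 8 * (T * N2) ^+ 2 * eps / (eta * k) = 8 / (eta * k) * (T * N2) ^+ 2 * eps); last by move: (eta * k)^-1 => z; ring.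
      rewrite [(T * N2 * E) ^+ 2]exprMn [leRHS]mulrA ler_wpM2l//.
        by rewrite mulr_ge0 ?sqr_ge0// divr_ge0// ltW.
      exact: pow_deficit_ge.
    have P1 : 0 <= C1 * (T * N2 * E) by rewrite mulr_ge0// (le_trans ler01).
    rewrite -(@ler_pXn2r _ 2) ?nnegrE//.
    apply: le_trans H3 _; rewrite [leRHS]exprMn ler_wpM2r ?sqr_ge0//.
    apply: (@le_trans _ _ C1); first by rewrite lerDr.
    by rewrite expr2 ler_peMr// (le_trans ler01).
  suff : m <= C3 * (T * N2 * E).
    by move=> /le_trans; apply; rewrite ler_wpM2r// lerDr (le_trans ler01).
  have [->|mN0] := eqVneq m 0; first by rewrite mulr_ge0// (le_trans ler01).
  have mgt0 : 0 < m by rewrite lt_neqAle eq_sym mN0.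
  have W1 : eta * (m / 2) ^+ n <= W (m / 2).
    apply: Ws; first by rewrite divr_gt0.
    by apply: scale_admissible => //; rewrite divr_gt0// ltW.
  have H1 : (m / 2) ^+ 2 * (eta * (m / 2) ^+ n) <= 2 * V * N2 ^+ 2 * eps.
    by apply: le_trans Wm; rewrite ler_wpM2l ?sqr_ge0.
  (* [1 <= NH N2] supplies the power of [N2] that homogeneity requires. *)
  have H2 : V <= V * NH ^+ n * N2 ^+ n.
    by rewrite -mulrA -exprMn ler_peMr ?(ltW V0)// exprn_ege1.
  (* The left side is [T^(1/gamma)]. As [T >= rho] and [1/gamma <= 2 <= n + 2], raising the exponent
     costs only the constant [C2]. *)
  have H3 : V * NH ^+ n <= C2 * T ^+ n.+2.
    have P0 : 0 < V * NH ^+ n by rewrite mulr_gt0// exprn_gt0.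
    have -> : V * NH ^+ n = T `^ gamma^-1.
      by rewrite /T -powRrM mulfV ?gt_eqF// powRr1// ltW.
    have Tr1 : 1 <= T / rho by rewrite ler_pdivlMr// mul1r.
    have -> : T `^ gamma^-1 = rho `^ gamma^-1 * (T / rho) `^ gamma^-1.
      rewrite -powRM ?(ltW rho0) ?divr_ge0 ?(ltW T0) ?(ltW rho0)//.
      by rewrite mulrC divfK// gt_eqF.
    rewrite /C2 -mulrA ler_wpM2l ?powR_ge0// [leRHS]mulrC -expr_div_n.
    rewrite -powR_mulrn; last by rewrite (le_trans ler01).
    rewrite ler_powR// (@le_trans _ _ 2)//; last by rewrite ler_nat.
    by rewrite -[2]invrK lef_pV2 ?posrE ?invr_gt0// ltW.
  have H4 : m ^+ n.+2 <= 2 ^+ n.+3 * C2 / eta * (T * N2 * E) ^+ n.+2.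
    have H5 : (m / 2) ^+ n.+2 * eta <= 2 * (C2 * T ^+ n.+2) * N2 ^+ n.+2 * E ^+ n.+2.
      rewrite (_ : (m / 2) ^+ n.+2 * eta = (m / 2) ^+ 2 * (eta * (m / 2) ^+ n)); last first.
        by rewrite -[n.+2]addn2 exprD; ring.
      apply: le_trans H1 _.
      apply: (@le_trans _ _ (2 * (C2 * T ^+ n.+2 * N2 ^+ n) * N2 ^+ 2 * eps)).
        rewrite ler_wpM2r// ler_wpM2r ?sqr_ge0// ler_wpM2l//.
        by apply: le_trans H2 _; rewrite ler_wpM2r// exprn_ge0// ltW.
      have -> : N2 ^+ n.+2 = N2 ^+ n * N2 ^+ 2 by rewrite -exprD addn2.
      rewrite (_ : 2 * (C2 * T ^+ n.+2) * (N2 ^+ n * N2 ^+ 2) = 2 * (C2 * T ^+ n.+2 * N2 ^+ n) * N2 ^+ 2); last by ring.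
      rewrite ler_wpM2l ?pow_deficit_ge//.
      apply: mulr_ge0; last exact: sqr_ge0.
      apply: mulr_ge0 => //; apply: mulr_ge0; last by rewrite exprn_ge0// ltW.
      by apply: mulr_ge0; [exact: ltW|rewrite exprn_ge0// ltW].
    rewrite -ler_pdivlMr// expr_div_n ler_pdivrMr ?exprn_gt0// in H5.
    apply: le_trans H5 _; rewrite le_eqVlt; apply/orP; left; apply/eqP.
    rewrite !exprMn [2 ^+ n.+3]exprS.
    by field; rewrite gt_eqF.
  have P3 : 0 <= C3 * (T * N2 * E) by rewrite mulr_ge0// (le_trans ler01).
  rewrite -(@ler_pXn2r _ n.+2) ?nnegrE//.
  apply: le_trans H4 _; rewrite [leRHS]exprMn ler_wpM2r ?exprn_ge0//.
  apply: (@le_trans _ _ C3); first by rewrite lerDr.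
  by rewrite exprS ler_peMr ?exprn_ege1// (le_trans ler01).
have TN : 0 <= T * N2 by rewrite mulr_ge0// ltW.
split.
  apply: le_trans mE _; rewrite -!mulrA ler_wpM2r ?lerDl//.
  by rewrite !mulr_ge0// ltW.
(* As [T >= rho], the term [N2] is absorbed into a multiple of [T N2]; this is the summand [rho^-1]
   of the constant. The term [m] follows from [E <= 1]. *)
have H6 : N2 <= rho^-1 * (T * N2).
  by rewrite mulrA ler_peMl ?(ltW N20)// mulrC ler_pdivlMr// mul1r.
apply: le_trans (lerD H6 mE) _.
rewrite -[leRHS]mulrA [leRHS]mulrDl [leRHS]addrC lerD2l.
by apply: ler_wpM2l; [lra|rewrite ler_piMr].
Qed.

End Exponents.

Lemma hoelder_homogeneous (R : realType) (V a b p p' : R) : 0 < V -> 0 <= a -> 0 <= b ->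
  0 < p -> 0 < p' -> p^-1 + p'^-1 = 1 ->
  (V * a `^ p) `^ p^-1 * (V * b `^ p') `^ p'^-1 = V * (a * b).
Proof.
move=> V0 a0 b0 p0 p'0 pp'; have V0' := ltW V0.
rewrite !powRM ?powR_ge0// -!powRrM !mulfV ?gt_eqF// (powRr1 a0) (powRr1 b0).
by rewrite mulrACA -powRD ?(gt_eqF V0) ?implybT// pp' powRr1.
Qed.

(** The hypothesis is Hoelder's inequality against the constant function 1; the powers of [V]
    balance, which leaves [a^p <= b^p]. *)
Lemma power_mean_homogeneous (R : realType) (V a b p p' : R) : 0 < V -> 0 <= a -> 0 <= b ->
  0 < p -> p < p' ->
  V * a `^ p <= (V * b `^ p') `^ (p' / p)^-1 * V `^ (1 - p / p')^-1^-1 -> a <= b.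
Proof.
move=> V0 a0 b0 p0 pp'; have V0' := ltW V0; have p'0 : 0 < p' by exact: lt_trans pp'.
rewrite invrK invf_div powRM ?powR_ge0// -powRrM mulrAC -powRD ?(gt_eqF V0) ?implybT//.
rewrite subrKC powRr1// ler_pM2l// mulrC divfK ?gt_eqF// => ab.
rewrite leNgt; apply/negP => ba.
have := gt0_ltr_powR p0 _ _ ba; rewrite !nnegrE a0 b0 => /(_ isT isT).
by rewrite ltNge ab.
Qed.

Section Deviation.
Context {R : realType} {n : nat} {M : ptopologicalType}.
Variables (A : set (chart R n M)) (g : chart R n M -> 'rV[R]_n -> 'M[R]_n)
  (X : M -> 'rV[R]_n.+1) (dv : {measure set (borel M) -> \bar R}).
Hypotheses (closedM : closed_manifold A) (metric_g : riemannian_metric A g)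
  (volM : volume_measure A g dv) (immX : isometric_immersion A g X) (n2 : (2 <= n)%N).
Variable q : R.
Hypothesis nq : n%:R < q.

Let n0 : (0 < n)%N. Proof. exact: leq_trans n2. Qed.
Let q0 : 0 < q. Proof. by apply: lt_trans nq; rewrite ltr0n. Qed.
Let H := curv A g X.
Let ci f (cf : continuous f) := continuous_integrable closedM metric_g volM immX cf.
Let fin_dv := dv_finite closedM metric_g volM immX.
Let V := Vol dv.
Let cH : continuous H. Proof. exact: (continuous_curv closedM metric_g immX n0). Qed.

Lemma ball_le_Vol (S : set (borel M)) : measurable S -> fine (dv S) <= V.
Proof.
move=> mS; rewrite -lee_fin -!(measure_fine fin_dv)//.
by apply: le_measure; rewrite ?inE.
Qed.

(** The volume dominates [bump_mass 1] at any point, and this is positive because small balls have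
    positive volume. *)
Lemma Vol_gt0 : 0 < V.
Proof.
have [c0 c00 ell] := @ellipsoid_volume R n.
have K0 := bump_mass_gt0 closedM metric_g volM immX point c00 (fun G a s => ell G a s) (@ltr01 R).
apply: lt_le_trans K0 _; apply: (@le_trans _ _ (fine (dv [set p | enorm (X p - X point) < 1]))).
  by apply: (bump_mass_le closedM metric_g volM immX) => //; rewrite expr1n mulr1.
by apply: ball_le_Vol; exact: (measurable_extrinsic_ball closedM immX).
Qed.

Lemma Rintegral_Lp (f : M -> R) (p : R) : 0 < p ->
  \int[dv]_x (`|f x| `^ p) = V * normalized_Lp dv p f `^ p.
Proof.
move=> p0; rewrite /normalized_Lp -powRrM mulVf ?gt_eqF// powRr1; last first.
  rewrite mulr_ge0 ?invr_ge0 ?(ltW Vol_gt0)//.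
  by apply: Rintegral_ge0 => x _; exact: powR_ge0.
by rewrite mulrA mulfV ?mul1r// gt_eqF// Vol_gt0.
Qed.

Lemma continuous_normr (f : M -> R) : continuous f -> continuous (fun x => `|f x|).
Proof.
by move=> cf x; apply: continuous_comp; [exact: cf|exact: norm_continuous].
Qed.

Lemma Rintegral_hoelder_Lp (f h : M -> R) (p p' : R) : continuous f -> continuous h ->
  0 < p -> 0 < p' -> p^-1 + p'^-1 = 1 ->
  \int[dv]_x (`|f x| * `|h x|) <= V * (normalized_Lp dv p f * normalized_Lp dv p' h).
Proof.
move=> cf ch p0 p'0 pp'.
have cf' := continuous_normr cf.
have ch' := continuous_normr ch.
have [B fB] := continuous_bounded closedM cf.
have [B' hB] := continuous_bounded closedM ch.
have fBB x : 0 <= `|f x| <= Num.max B B' by rewrite normr_ge0 le_max fB.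
have hBB x : 0 <= `|h x| <= Num.max B B' by rewrite normr_ge0 le_max hB orbT.
have mf : measurable_fun setT ((fun x => `|f x|) : borel M -> R) by exact: continuous_measurable_borel.
have mh : measurable_fun setT ((fun x => `|h x|) : borel M -> R) by exact: continuous_measurable_borel.
apply: le_trans (Rintegral_hoelder fin_dv mf mh fBB hBB p0 p'0 pp') _.
rewrite (Rintegral_Lp f p0) (Rintegral_Lp h p'0).
by rewrite (hoelder_homogeneous Vol_gt0 (powR_ge0 _ _) (powR_ge0 _ _) p0 p'0 pp').
Qed.

Lemma normalized_Lp_mono (f : M -> R) (p p' : R) : continuous f -> 0 < p -> p <= p' ->
  normalized_Lp dv p f <= normalized_Lp dv p' f.
Proof.
move=> cf p0; rewrite le_eqVlt => /predU1P[->//|pp'].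
have p'0 : 0 < p' by exact: lt_trans pp'.
have [B fB] := continuous_bounded closedM cf.
have B0 : 0 <= B by apply: le_trans (fB point).
have cf' := continuous_normr cf.
have mf : measurable_fun setT ((fun x => `|f x|) : borel M -> R) by exact: continuous_measurable_borel.
have mfp : measurable_fun setT ((fun x => `|f x| `^ p) : borel M -> R).
  exact: measurableT_comp (measurable_powR p) mf.
pose C := Num.max (B `^ p) 1.
have fC x : 0 <= `|f x| `^ p <= C.
  by rewrite powR_ge0 le_max ge0_ler_powR ?nnegrE// ltW.
have oC (x : M) : 0 <= (cst 1 x : R) <= C by rewrite ler01 le_max lexx orbT.
pose s := p' / p; pose s' := (1 - p / p')^-1.
have s0 : 0 < s by rewrite divr_gt0.
have s'0 : 0 < s' by rewrite invr_gt0 subr_gt0 ltr_pdivrMr// mul1r.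
have ss' : s^-1 + s'^-1 = 1 by rewrite /s /s' invrK invf_div addrC subrK.
have := Rintegral_hoelder fin_dv mfp (@measurable_cst _ _ _ _ _ _) fC oC s0 s'0 ss'.
have -> : \int[dv]_x (`|f x| `^ p * cst 1 x) = \int[dv]_x (`|f x| `^ p).
  by apply: eq_Rintegral => x _; rewrite mulr1.
have -> : \int[dv]_x ((`|f x| `^ p) `^ s) = \int[dv]_x (`|f x| `^ p').
  by apply: eq_Rintegral => x _; rewrite -powRrM /s mulrC divfK// gt_eqF.
have -> : \int[dv]_x (cst 1 x `^ s' : R) = V.
  by under eq_Rintegral do rewrite powR1; rewrite Rintegral_cst// mul1r.
rewrite (Rintegral_Lp f p0) (Rintegral_Lp f p'0).
exact: (power_mean_homogeneous Vol_gt0 (powR_ge0 _ _) (powR_ge0 _ _) p0 pp').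
Qed.

Section Centre.
Variable b : 'rV[R]_n.+1.

Let r p := enorm (X p - b).
Let N1 := normalized_Lp dv 1 r.
Let N2 := normalized_Lp dv 2 r.
Let NH := normalized_Lp dv q (mean_curvature A g X).

Let cr : continuous r.
Proof.
move=> p; apply: (@continuous_comp _ _ _ (fun p => X p - b) (@enorm R n.+1)).
  by apply: cvgB; [exact: (continuous_X closedM immX)|exact: cvg_cst].
exact: continuous_enorm.
Qed.

Let r0 p : `|r p| = r p. Proof. by rewrite ger0_norm// enorm_ge0. Qed.

Let NHE p : normalized_Lp dv p (mean_curvature A g X) = normalized_Lp dv p H.
Proof.
have E : \int[dv]_x (`|mean_curvature A g X x| `^ p) = \int[dv]_x (`|H x| `^ p).
  by apply: eq_Rintegral => x _; rewrite /H /curv normr_id.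
by rewrite /normalized_Lp E.
Qed.

Lemma integral_radius : \int[dv]_p r p = V * N1.
Proof.
have := Rintegral_Lp r (@ltr01 R); rewrite powRr1 ?powR_ge0// -/N1 => <-.
by apply: eq_Rintegral => x _; rewrite r0 powRr1// enorm_ge0.
Qed.

Lemma integral_sqr_radius : \int[dv]_p (r p ^+ 2) = V * N2 ^+ 2.
Proof.
have := Rintegral_Lp r (@ltr0n R 2); rewrite powR_mulrn ?powR_ge0// -/N2 => <-//.
by apply: eq_Rintegral => x _; rewrite r0 powR_mulrn// enorm_ge0.
Qed.

Lemma curvature_radius_ge1 : 1 <= NH * N2.
Proof.
have n0R : 0 < n%:R :> R by rewrite ltr0n.
have dh (t : R) : is_derive t 1 (cst (1 : R)) (cst (0 : R) t) by exact: is_derive_cst.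
have := first_variation closedM metric_g volM immX n0 b dh (@cst_continuous _ _ _) (fun=> ler01).
have -> : \int[dv]_p (n%:R * cst 1 (sqr_radius X b p) +
    2 * cst 0 (sqr_radius X b p) * sqr_tangential X closedM b p) = n%:R * V :> R.
  under eq_Rintegral do rewrite /= mulr1 mulr0 mul0r addr0.
  by rewrite Rintegral_cst.
have -> : \int[dv]_p (n%:R * curv A g X p * Num.sqrt (sqr_radius X b p) * cst 1 (sqr_radius X b p)) =
    n%:R * \int[dv]_p (`|H p| * `|r p|).
  rewrite -RintegralZl//.
    apply: eq_Rintegral => p _; rewrite /= mulr1 -mulrA; congr (_ * _).
    by rewrite -enormE r0 /H /curv normr_id.
  apply: ci => p.
  by apply: cvgM; [exact: (continuous_normr cH)|exact: (continuous_normr cr)].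
rewrite ler_pM2l// => /le_trans /(_ (Rintegral_hoelder_Lp cH cr _ _ _)) HV.
have two : 2^-1 + 2^-1 = 1 :> R by field.
have := HV 2 2 (@ltr0n R 2) (@ltr0n R 2) two.
have P (x : R) : V <= V * x -> 1 <= x by rewrite -{1}[V]mulr1 ler_pM2l ?Vol_gt0.
move=> /P /le_trans; apply.
(* Since [2 <= n < q], the normalized L^2 norm of [H] is at most its L^q norm. *)
rewrite /NH NHE; apply: ler_wpM2r; first exact: powR_ge0.
apply: normalized_Lp_mono => //.
by apply: le_trans (ltW nq); rewrite ler_nat.
Qed.

Lemma radius_norms : 0 <= N1 <= N2.
Proof. by rewrite powR_ge0 normalized_Lp_mono// ler1n. Qed.

Lemma integral_sqr_deviation :
  \int[dv]_p ((r p - N2) ^+ 2) = V * (2 * N2 ^+ 2 - 2 * N2 * N1).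
Proof.
have i1 : dv.-integrable setT (EFin \o (fun p => r p ^+ 2)).
  by apply: ci => p; apply: cvgM; exact: cr.
have i2 : dv.-integrable setT (EFin \o (fun p => 2 * N2 * r p)).
  by apply: ci => p; apply: cvgM; [exact: cvg_cst|exact: cr].
have i3 : dv.-integrable setT (EFin \o (fun p => r p ^+ 2 - 2 * N2 * r p)).
  by have := integrableB measurableT i1 i2; apply: eq_integrable.
have i4 : dv.-integrable setT (EFin \o (fun p : M => N2 ^+ 2)).
  exact: (ci (f := cst (N2 ^+ 2)) (@cst_continuous _ _ _)).
transitivity (\int[dv]_p (r p ^+ 2 - 2 * N2 * r p + N2 ^+ 2)).
  by apply: eq_Rintegral => p _; ring.
rewrite RintegralD// RintegralB// RintegralZl//; last exact: ci.
rewrite Rintegral_cst// integral_radius integral_sqr_radius -/(Vol dv) -/V.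
by ring.
Qed.

Lemma mass_deviation p0 (m := `|r p0 - N2|) :
  (m / 2) ^+ 2 * fine (dv [set p | enorm (X p - X p0) < m / 2]) <=
  V * (2 * N2 ^+ 2 - 2 * N2 * N1).
Proof.
rewrite -integral_sqr_deviation; apply: (mass_le_Rintegral fin_dv).
- exact: (measurable_extrinsic_ball closedM immX).
- by apply: ci => p; apply: cvgM; apply: cvgB; try exact: cvg_cst; exact: cr.
- by move=> p; exact: sqr_ge0.
move=> p /= pm; rewrite -[leRHS]real_normK ?num_real//.
have m0 : 0 <= m by exact: normr_ge0.
rewrite ler_pXn2r ?nnegrE//; last by rewrite divr_ge0.
have E : r p0 - N2 = (r p0 - r p) + (r p - N2) by ring.
have := ler_normD (r p0 - r p) (r p - N2); rewrite -E -/m.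
have : `|r p0 - r p| <= enorm (X p - X p0).
  apply: le_trans (enorm_dist _ _) _.
  by rewrite -enormN opprB opprB addrA subrK.
by move: pm; lra.
Qed.

End Centre.
End Deviation.

Lemma deviation_estimate (R : realType) (n : nat) (q : R) : (2 <= n)%N -> n%:R < q ->
  exists2 C : R, 0 <= C &
  forall (M : ptopologicalType) (A : set (chart R n M))
    (g : chart R n M -> 'rV[R]_n -> 'M[R]_n) (dv : {measure set (borel M) -> \bar R})
    (X : M -> 'rV[R]_n.+1) (b : 'rV[R]_n.+1) (p : M),
  closed_manifold A -> riemannian_metric A g -> volume_measure A g dv ->
  isometric_immersion A g X ->
  let gamma := q / (2 * (q - n%:R)) in
  let r p := enorm (X p - b) in
  let N1 := normalized_Lp dv 1 r in
  let N2 := normalized_Lp dv 2 r in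
  let NH := normalized_Lp dv q (mean_curvature A g X) in
  `|r p - N2| <= C * (Vol dv * NH ^+ n) `^ gamma * N2 *
    (1 - N1 / N2) `^ (2 * (1 + n%:R * gamma))^-1 /\
  N2 + `|r p - N2| <= C * (Vol dv * NH ^+ n) `^ gamma * N2.
Proof.
move=> n2 nq; have n0 : (0 < n)%N by exact: leq_trans n2.
have [c0 c00 ell] := @ellipsoid_volume R n.
(* The constant of [density_bound]; it depends on [n] and [q] only, and is fixed before the
   manifold. *)
pose c1 : R := (c0 / (8 * 4 ^+ n)) `^ q^-1 / 2.
have c10 : 0 < c1.
  by rewrite divr_gt0// powR_gt0// divr_gt0// mulr_gt0// exprn_gt0.
have [C C0 HC] := final_estimate n2 nq c10.
exists C => // M A g dv X b p closedM metric_g volM immX gamma r N1 N2 NH.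
have V0 := Vol_gt0 closedM metric_g volM immX.
have q0 : 0 < q by apply: lt_trans nq; rewrite ltr0n.
apply: (HC _ _ _ _ _ (fun s => fine (dv [set x | enorm (X x - X p) < s]))) => //.
- exact: powR_ge0.
- exact: (radius_norms closedM metric_g volM immX).
- exact: (curvature_radius_ge1 closedM metric_g volM immX n2 nq).
- move=> s; apply: (ball_le_Vol closedM metric_g volM immX).
  exact: (measurable_extrinsic_ball closedM immX).
- move=> s s0 Ds.
  apply: (density_bound closedM metric_g volM immX n0 nq p c00 (fun G a s => ell G a s) s0).
  (* [curv_norm] is not normalized by the volume, whence the factor [V^(1/q)]. *)
  have -> : curv_norm A g X dv q = NH * Vol dv `^ q^-1; last exact: Ds.
  rewrite /curv_norm (Rintegral_Lp closedM metric_g volM immX (mean_curvature A g X) q0).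
  rewrite powRM ?powR_ge0 ?(ltW V0)// -powRrM mulfV ?gt_eqF// powRr1 ?powR_ge0//.
  by rewrite mulrC.
- exact: (mass_deviation closedM metric_g volM immX b p).
- move=> s sm; rewrite -lee_fin.
  have fin := dv_finite closedM metric_g volM immX.
  have ms s' := measurable_extrinsic_ball closedM immX p s'.
  rewrite -(measure_fine fin (ms s)) -(measure_fine fin (ms _)).
  apply: le_measure; rewrite ?inE; [exact: ms|exact: ms|].
  by move=> x /= xs; exact: lt_le_trans sm.
Qed.

Theorem theorem1p6 (R : realType) (n : nat) (q : R)
    (hn : (2 <= n)%N) (hq : n%:R < q) :
  let gamma : R := q / (2 * (q - n%:R)) in
  (exists C : R,
    forall (M : ptopologicalType) (A : set (chart R n M))
      (g : chart R n M -> 'rV[R]_n -> 'M[R]_n)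
      (dv : {measure set (borel M) -> \bar R})
      (X : M -> 'rV[R]_n.+1),
    closed_manifold A -> connected [set: M] ->
    riemannian_metric A g -> volume_measure A g dv ->
    isometric_immersion A g X ->
    let r : M -> R := fun p => enorm (X p - barycenter dv X) in
    let norm1 := normalized_Lp dv 1 r in
    let norm2 := normalized_Lp dv 2 r in
    let normHq := normalized_Lp dv q (mean_curvature A g X) in
    sup (range (fun p => `|r p - norm2|)) <=
      C * (Vol dv * normHq ^+ n) `^ gamma * norm2 *
      (1 - norm1 / norm2) `^ (1 / (2 * (1 + n%:R * gamma)))) /\
  (exists C : R,
    forall (M : ptopologicalType) (A : set (chart R n M))
      (g : chart R n M -> 'rV[R]_n -> 'M[R]_n)
      (dv : {measure set (borel M) -> \bar R})
      (X : M -> 'rV[R]_n.+1),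
    closed_manifold A -> connected [set: M] ->
    riemannian_metric A g -> volume_measure A g dv ->
    isometric_immersion A g X ->
    let r : M -> R := fun p => enorm (X p - barycenter dv X) in
    let norm2 := normalized_Lp dv 2 r in
    let normHq := normalized_Lp dv q (mean_curvature A g X) in
    sup (range r) <= C * (Vol dv * normHq ^+ n) `^ gamma * norm2).
Proof.
move=> gamma; have [C _ HC] := deviation_estimate hn hq.
split; exists C => M A g dv X cM _ mg vM iX; cbv zeta.
  apply: ge_sup; first by eexists; exists point.
  by move=> _ [p _ <-]; rewrite div1r; exact: (HC _ _ _ _ _ _ p cM mg vM iX).1.
apply: ge_sup; first by eexists; exists point.
(* [r p] is at most [N2] plus its deviation from [N2], which the second estimate bounds. *)
move=> _ [p _ <-]; apply: le_trans (HC _ _ _ _ _ _ p cM mg vM iX).2.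
by rewrite -lerBlDl; exact: ler_norm.
Qed.
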